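(* Let $w$ be a normal function and let $1/2<p<\infty$. Suppose that $w$ and $p$ satisfy one of the following: $1/2<p\le1$, $a_w<2p-2$, $b_w>-1$; or $p>1$, $a_w<p-1$, $b_w>p-2$; or, with $w$ satisfying in addition condition ( * ), $1/2<p\le1$, $a_w=2p-2$, $b_w>-1$, or $p>1$, $a_w=p-1$, $b_w>p-2$. Then there exists a constant $c_{p,w}>0$ such that for every Blaschke product $B$ $$\sup_{1/2<r<1}w(r)(1-r)\int_0^{2\pi}|B'(re^{it})|^p\,dt\le c_{p,w}\sum_{B(z)=0}(1-|z|)^{2-p}\,w(|z|),$$ when $a_w<2p-2$, $1/2<p\le1$, or $a_w<p-1$, $p>1$, and $$\sup_{1/2<r<1}w(r)(1-r)\int_0^{2\pi}|B'(re^{it})|^p\,dt\le c_{p,w}\sum_{B(z)=0}(1-|z|)^{2-p}\,w(|z|)\log\frac1{1-|z|},$$ when $a_w=2p-2$, $1/2<p\le1$, or $a_w=p-1$, $p>1$. Suppose that $w$ and $p$ satisfy one of the following: $1/2<p\le1$, $a_w<2p-2$, $b_w>-1$; or $p>1$, $a_w<p-2$, $b_w>-1$; or, with $w$ satisfying in addition condition ( * ), $1/2<p\le1$, $a_w=2p-2$, $b_w>-1$, or $p>1$, $a_w=p-1$, $b_w>p-2$. If the zero set of the Blaschke product $B$ is separated with separation constant $\delta>0$, then for every $\varepsilon>0$ there exists a positive constant $c_{p,w,\delta,\varepsilon}$ (depending only on $p,w,\delta,\varepsilon$) such that $$\sum_{B(z)=0}(1-|z|)^{2-p+\varepsilon}\,w(|z|)\le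 c_{p,w,\delta,\varepsilon}\sup_{1/2<r<1}w(r)(1-r)\int_0^{2\pi}|B'(re^{it})|^p\,dt.$$
   Context: $\mathbb{D}$ is the open unit disk in $\mathbb{C}$. Sums over $B(z)=0$ run over the zeros of $B$ in $\mathbb{D}$, counted with multiplicity. Normal functions: a measurable function $w:[0,1)\to[0,\infty)$ is called normal if there exist real numbers $a$ and $b$ and $r_0\in(0,1)$ such that, for $r>r_0$, the function $w(r)/(1-r)^a$ increases to $\infty$ and the function $w(r)/(1-r)^b$ decreases to $0$ (as $r\to1^-$). The number $a_w$ is the infimum of all real $a$ for which $w(r)/(1-r)^a$ increases to $\infty$ for $r>r_a$, for some $r_a\in(0,1)$; the number $b_w$ is the supremum of all real $b$ for which $w(r)/(1-r)^b$ decreases to $0$ for $r>r_b$, for some $r_b\in(0,1)$. Condition ( * ): there exists $\alpha$ with $0<\alpha<1$ such that the function $\frac{w(r)}{(1-r)^{a_w}}\log^\alpha\frac1{1-r}$ is increasing for $r>r_0$. A sequence $(a_n)$ in $\mathbb{D}$ is separated with separation constant $\delta$ if $\inf_n\prod_{k\ne n}\left|\frac{a_k-a_n}{1-\overline{a}_ka_n}\right|=\delta>0$.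
   Formalization: It is assumed in addition that w lies between two positive constants on each [0,ρ], ρ<1, and in the second inequality log(1/(1-|z|)) is replaced by max(1, log(1/(1-|z|))); without these B(z)=z gives counterexamples. *)

(* Defs.v *)
From HB Require Import structures.
From mathcomp Require Import all_boot all_order all_algebra.
From mathcomp Require Import all_classical all_reals all_analysis.
From mathcomp Require Import complex.

Set Implicit Arguments.
Unset Strict Implicit.
Unset Printing Implicit Defensive.

Import Order.TTheory GRing.Theory Num.Theory.
Import numFieldNormedType.Exports.

Local Open Scope classical_set_scope.
Local Open Scope ring_scope.
Local Open Scope complex_scope.

(** * Normal weights *)

Section weights.
Variable R : realType.
Implicit Types (w f : R -> R) (s : R).

Definition increasing_after f (r0 : R) :=
  {in `]r0, 1[ &, {homo f : x y / x <= y}}.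

Definition decreasing_after f (r0 : R) :=
  {in `]r0, 1[ &, {homo f : x y / y <= x >-> x <= y}}.

Definition increases_to_pinfty f (r0 : R) :=
  increasing_after f r0 /\ f r @[r --> 1^'-] --> +oo.

Definition decreases_to_0 f (r0 : R) :=
  decreasing_after f r0 /\ f r @[r --> 1^'-] --> 0.

Definition over_power w s (r : R) : R := w r / (1 - r) `^ s.

(* A weight on [0, 1) is a function on R whose values outside [0, 1) are
   irrelevant. *)
Definition normal_weight w :=
  [/\ measurable_fun (`[0, 1[ : set R) w,
      forall r, 0 <= r < 1 -> 0 <= w r &
      exists a b r0 : R, [/\ 0 < r0 < 1,
        increases_to_pinfty (over_power w a) r0 &
        decreases_to_0 (over_power w b) r0]].

(* For a normal weight the two sets below are nonempty, and every element of
   the first exceeds every element of the second, so the real-valued inf and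
   sup are the true ones. *)
Definition a_index w : R :=
  inf [set s | exists2 r0 : R, 0 < r0 < 1 & increases_to_pinfty (over_power w s) r0].

Definition b_index w : R :=
  sup [set s | exists2 r0 : R, 0 < r0 < 1 & decreases_to_0 (over_power w s) r0].

Definition log_increasing w :=
  exists al r0 : R, [/\ 0 < al < 1, 0 < r0 < 1 &
    increasing_after
      (fun r => over_power w (a_index w) r * (ln (1 - r)^-1) `^ al) r0].

(* Normality only constrains w near 1, while the norm estimates for Blaschke
   products see w on all of [0, 1): if w is unbounded, or not bounded away from
   0, on a compact subset, they already fail for B(z) = z or for a single
   Blaschke factor. *)
Definition comparable_to_1_on_compacts w :=
  forall rho : R, 0 < rho < 1 -> exists m M : R,
    0 < m /\ forall r, 0 <= r <= rho -> m <= w r <= M.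

End weights.

(** * Blaschke products *)

Section blaschke.
Variable R : realType.
Implicit Types (D : set nat) (a : nat -> R[i]) (B : R[i] -> R[i]^o).

(* The modulus as a real number; `|z| itself lives in R[i]. *)
Definition cabs (z : R[i]) : R := complex.Re `|z|.

Definition circle_pt (r t : R) : R[i] := (r * cos t) +i* (r * sin t).

Definition blaschke_factor (c z : R[i]) : R[i] :=
  if c == 0 then z else `|c| / c * ((c - z) / (1 - c^* * z)).

(* B is a Blaschke product whose zeros, listed with multiplicity, are the
   (a n) for n in D.  A finite D gives the finite Blaschke products; gam is
   an arbitrary unimodular constant.  Only the values of B on the open unit
   disk matter. *)
Definition blaschke_product D a B :=
  [/\ forall n, D n -> cabs (a n) < 1,
      (\esum_(n in D) (1 - cabs (a n))%:E < +oo)%E &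
      exists2 gam : R[i], cabs gam = 1 &
        forall z, cabs z < 1 ->
          (fun N => gam * \prod_(k < N | (k : nat) \in D)
                            blaschke_factor (a k) z : R[i]^o) @ \oo --> B z].

(* The (possibly infinite) product of the pseudohyperbolic distances from a n
   to the other terms; the partial products lie in [0, 1] and decrease. *)
Definition separation_product D a (n : nat) : R :=
  limn (fun N => \prod_(k < N | ((k : nat) \in D) && ((k : nat) != n))
                   cabs ((a k - a n) / (1 - (a k)^* * a n))).

Definition separated_zeros D a (delta : R) :=
  0 < delta /\ inf [set separation_product D a n | n in D] = delta.

Definition circle_mean (p : R) B (r : R) : \bar R :=
  (\int[lebesgue_measure]_(t in `[0%R, (2 * pi)%R])
     (cabs (derive1 B (circle_pt r t)) `^ p)%:E)%E.

Definition weighted_sup (w : R -> R) (p : R) B : \bar R :=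
  ereal_sup [set ((w r * (1 - r))%:E * circle_mean p B r)%E
            | r in `]2^-1, 1[].

Definition zero_sum D a (F : R -> R) : \bar R :=
  (\esum_(n in D) (F (cabs (a n)))%:E)%E.

End blaschke.

(* log (1 / (1 - x)) vanishes at x = 0, where it cannot serve as a factor in an
   upper bound; it is therefore cut off below at 1, which changes it only for
   x < 1 - 1/e. *)
Definition log_factor (R : realType) (x : R) : R :=
  Num.max 1 (ln (1 - x)^-1).

(* Main.v *)
Require Import Defs.
From mathcomp Require Import all_boot all_order all_algebra.
From mathcomp Require Import all_classical all_reals all_analysis.
From mathcomp Require Import measurable_realfun complex ring lra.

Set Implicit Arguments.
Unset Strict Implicit.
Unset Printing Implicit Defensive.

Import Order.TTheory GRing.Theory Num.Theory.
Import numFieldNormedType.Exports.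

Local Open Scope classical_set_scope.
Local Open Scope ring_scope.

(** Both inequalities are proved for the finite products of the first [N] Blaschke
    factors, with constants independent of [N], and then passed to the limit. The
    derivative of such a product is given by the product rule, and its first-order
    expansion has a quadratic remainder controlled by the sum of the [1 - |a_k|]
    alone ([bprod_remainder]). Since this sum converges, the derivatives of the
    finite products converge to [B'] ([derive1_blaschke]); they are bounded by
    [2 / (1 - r)], so the integral means converge as well
    ([blaschke_approximation]).

    Upper bound. Up to the factor two, [|B'(z)|] is at most the sum of the
    [(1 - |a|) / |1 - a^* z|^2]. If [p <= 1] the [p]-th power is distributed over
    the sum; if [p > 1] the excess power [p - 1] is bounded by Schwarz-Pick. What
    remains are integrals of negative powers of [|1 - a^* z|] over a circle
    ([szego_integral]), and the contribution of a zero of modulus [x] to the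
    weighted mean of radius [r] becomes explicit ([partial_mean_le1],
    [partial_mean_gt1]). A normal weight satisfies [w(r) <= C w(x) h^s], with
    [h = (1 - r) / (1 - x)], for [r <= x] when [s] exceeds the upper index, and
    for [x <= r] when [s] is below the lower index ([normal_upper],
    [normal_lower]). The conditions on the indices are what makes the
    contribution at most [(1 - x)^(2 - p) w(x)] up to a constant, whatever [r] is
    ([weight_factor_le1], [weight_factor_gt1]). When the upper index takes the
    critical value, the first comparison holds with a logarithm, by the
    growth condition with the logarithmic factor ([normal_upper_log]).

    Lower bound. Separation makes [|B'|] at least [delta / (12 (1 - |a|))] on a
    disk around each zero [a] of radius proportional to [1 - |a|], and makes these
    disks disjoint ([dbprod_ge], [disjoint_boxes]). Grouping the zeros by levels
    [1 - |a| ~ th^j], the circle of radius [1 - th^j] meets the disks of level [j]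
    in disjoint arcs, so its mean dominates the sum of [(1 - |a|)^(1 - p)] over
    that level ([partial_mean_ge_arcs]). Each level is thus bounded by the
    supremum, and the extra power [eps] of [1 - |a|] turns the sum over the levels
    into a geometric series. This leaves the zeros with [|a| <= 1/2], for which
    the level circles may be too small. Separation bounds their number
    ([small_count]), and a Cauchy estimate on the circle of radius [3 / 4] shows
    that the supremum is bounded below if there is one ([small_zero_mean]). *)

(** * The modulus of a complex number *)

Section modulus.
Context {R : realType}.
Implicit Types (z u v : R[i]%C).

Lemma norm_cabs z : `|z| = (cabs z)%:C%C.
Proof. by rewrite /cabs normc_def. Qed.

Lemma cabs_sqr z : cabs z ^+ 2 = complex.Re z ^+ 2 + complex.Im z ^+ 2.
Proof. by apply: complexI; rewrite rmorphXn /= -norm_cabs add_Re2_Im2. Qed.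

Lemma cabs_ge0 z : 0 <= cabs z.
Proof. by rewrite -ler0c -norm_cabs normr_ge0. Qed.

Lemma cabsM z u : cabs (z * u) = cabs z * cabs u.
Proof. by apply: complexI; rewrite rmorphM /= -!norm_cabs normrM. Qed.

Lemma cabsN z : cabs (- z) = cabs z.
Proof. by rewrite /cabs normrN. Qed.

Lemma cabs_distC z u : cabs (z - u) = cabs (u - z).
Proof. by rewrite -cabsN opprB. Qed.

Lemma cabsV z : cabs z^-1 = (cabs z)^-1.
Proof. by apply: complexI; rewrite fmorphV /= -!norm_cabs normfV. Qed.

Lemma cabsX z n : cabs (z ^+ n) = cabs z ^+ n.
Proof. by apply: complexI; rewrite rmorphXn /= -!norm_cabs normrX. Qed.

Lemma cabs1 : cabs (1 : R[i]%C) = 1.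
Proof. by rewrite /cabs normr1. Qed.

Lemma cabs0 : cabs (0 : R[i]%C) = 0.
Proof. by rewrite /cabs normr0. Qed.

Lemma cabs_real (x : R) : cabs x%:C%C = `|x|.
Proof. by rewrite /cabs normc_def /= expr0n addr0 sqrtr_sqr. Qed.

Lemma cabsJ z : cabs z^* = cabs z.
Proof. by rewrite /cabs norm_conjC. Qed.

Lemma cabs_eq0 z : (cabs z == 0) = (z == 0).
Proof. by rewrite -(inj_eq (@complexI R)) -norm_cabs normr_eq0. Qed.

Lemma cabs_gt0 z : (0 < cabs z) = (z != 0).
Proof. by rewrite lt_def cabs_ge0 cabs_eq0 andbT. Qed.

Lemma cabsD z u : cabs (z + u) <= cabs z + cabs u.
Proof. by rewrite -lecR rmorphD /= -!norm_cabs ler_normD. Qed.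

Lemma cabsB z u : cabs (z - u) <= cabs z + cabs u.
Proof. by rewrite -[X in _ <= _ + X]cabsN cabsD. Qed.

Lemma cabs_subr_ge z u : cabs z - cabs u <= cabs (z - u).
Proof. by rewrite lerBlDr -{1}(subrK u z) cabsD. Qed.

Lemma cabs_dist z u : `|cabs z - cabs u| <= cabs (z - u).
Proof.
rewrite ler_norml cabs_subr_ge andbT lerNl opprB (cabs_distC z u).
exact: cabs_subr_ge.
Qed.

Lemma cabs_sum (I : Type) (s : seq I) (P : pred I) (f : I -> R[i]%C) :
  cabs (\sum_(i <- s | P i) f i) <= \sum_(i <- s | P i) cabs (f i).
Proof.
elim/big_ind2: _ => [|x1 x2 y1 y2 h1 h2|//]; first by rewrite cabs0.
by rewrite (le_trans (cabsD _ _)) ?lerD.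
Qed.

Lemma cabs_prod (I : Type) (s : seq I) (P : pred I) (f : I -> R[i]%C) :
  cabs (\prod_(i <- s | P i) f i) = \prod_(i <- s | P i) cabs (f i).
Proof. exact: (big_morph (@cabs R) cabsM cabs1). Qed.

Lemma Re_le_cabs z : `|complex.Re z| <= cabs z.
Proof. by rewrite -lecR -norm_cabs normc_ge_Re. Qed.

Lemma Im_le_cabs z : `|complex.Im z| <= cabs z.
Proof.
rewrite -(@ler_pXn2r _ 2) ?nnegrE ?cabs_ge0 ?normr_ge0//.
by rewrite cabs_sqr real_normK ?num_real// lerDr sqr_ge0.
Qed.

Lemma cabs_le_ReIm z : cabs z <= `|complex.Re z| + `|complex.Im z|.
Proof.
rewrite -(@ler_pXn2r _ 2) ?nnegrE ?cabs_ge0 ?addr_ge0//.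
rewrite cabs_sqr -(real_normK (num_real (complex.Re z))).
rewrite -(real_normK (num_real (complex.Im z))) sqrrD -addrA lerD2l lerDr.
by rewrite mulrn_wge0 ?mulr_ge0.
Qed.

Lemma mulJ_cabs z : z * z^* = (cabs z ^+ 2)%:C%C.
Proof. by rewrite rmorphXn /= -norm_cabs normCK. Qed.

Lemma cabs_circle_pt (r t : R) : cabs (circle_pt r t) = `|r|.
Proof.
apply/eqP; rewrite -(@eqrXn2 _ 2) ?cabs_ge0 ?normr_ge0// cabs_sqr /=.
by rewrite !exprMn -mulrDr cos2Dsin2 mulr1 real_normK ?num_real.
Qed.

End modulus.

(** * Disk automorphisms *)

Section moebius.
Context {R : realType}.
Implicit Types (c z w : R[i]%C) (r K : R).

Definition moebius c z : R[i]%C := (c - z) / (1 - c^* * z).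

Definition dmoebius c z : R[i]%C := - (1 - c * c^*) / (1 - c^* * z) ^+ 2.

(** A Blaschke factor is this unimodular constant times [moebius c]; at [c = 0]
    the two differ by a sign. *)
Definition blaschke_unit c : R[i]%C := if c == 0 then -1 else `|c| / c.

Lemma cabs_blaschke_unit c : cabs (blaschke_unit c) = 1.
Proof.
rewrite /blaschke_unit; case: eqVneq => [_|c0]; first by rewrite cabsN cabs1.
rewrite cabsM cabsV norm_cabs cabs_real ger0_norm ?cabs_ge0// divff//.
by rewrite cabs_eq0.
Qed.

Lemma blaschke_factorE c z :
  blaschke_factor c z = blaschke_unit c * moebius c z.
Proof.
rewrite /blaschke_factor /blaschke_unit /moebius; case: eqVneq => // ->.
by rewrite rmorph0 mul0r subr0 sub0r divr1 mulrNN mul1r.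
Qed.

Lemma cabs_den_ge c z : 1 - cabs c * cabs z <= cabs (1 - c^* * z).
Proof. by rewrite -{1}(@cabs1 R) -(cabsJ c) -cabsM cabs_subr_ge. Qed.

Lemma cabs_den_ge_c c z : cabs z <= 1 -> 1 - cabs c <= cabs (1 - c^* * z).
Proof.
move=> z1; rewrite (le_trans _ (cabs_den_ge _ _))// lerD2l lerN2.
by rewrite ler_piMr ?cabs_ge0.
Qed.

Lemma cabs_den_ge_z c z : cabs c <= 1 -> 1 - cabs z <= cabs (1 - c^* * z).
Proof.
move=> c1; rewrite (le_trans _ (cabs_den_ge _ _))// lerD2l lerN2.
by rewrite ler_piMl ?cabs_ge0.
Qed.

Lemma den_neq0 c z : cabs c < 1 -> cabs z <= 1 -> 1 - c^* * z != 0.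
Proof.
move=> c1 z1; rewrite -cabs_gt0 (lt_le_trans _ (cabs_den_ge_c c z1))//.
by rewrite subr_gt0.
Qed.

Lemma cabs_1Bsqr c : cabs c <= 1 -> cabs (1 - c * c^*) = 1 - cabs c ^+ 2.
Proof.
move=> c1; rewrite mulJ_cabs -[1](rmorph1 (real_complex R)) -rmorphB /=.
by rewrite cabs_real ger0_norm// subr_ge0 expr_le1 ?cabs_ge0.
Qed.

Lemma moebiusB c z w : cabs c < 1 -> cabs z <= 1 -> cabs w <= 1 ->
  cabs (moebius c w - moebius c z) =
  (1 - cabs c ^+ 2) * cabs (w - z) / (cabs (1 - c^* * z) * cabs (1 - c^* * w)).
Proof.
move=> c1 z1 w1; have dz := den_neq0 c1 z1; have dw := den_neq0 c1 w1.
rewrite -cabs_1Bsqr ?ltW// -2!cabsM -cabsV -cabsM -cabsN /moebius.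
congr (cabs _); move: (c^*) dz dw => c' dz dw; field.
by rewrite dz dw.
Qed.

(** The exact second-order remainder of a disk automorphism. It takes the place
    of complex differentiability: being an identity, it can be summed over the
    factors of a product. *)
Lemma moebius_remainder c z w : cabs c < 1 -> cabs z <= 1 -> cabs w <= 1 ->
  cabs (moebius c w - moebius c z - dmoebius c z * (w - z)) =
  (1 - cabs c ^+ 2) * cabs c * cabs (w - z) ^+ 2 /
    (cabs (1 - c^* * z) ^+ 2 * cabs (1 - c^* * w)).
Proof.
move=> c1 z1 w1; have dz := den_neq0 c1 z1; have dw := den_neq0 c1 w1.
rewrite -cabs_1Bsqr ?ltW// -!cabsX -(cabsJ c) -3!cabsM -cabsV -cabsM -cabsN.
rewrite /moebius /dmoebius.
congr (cabs _); move: (c^*) dz dw => c' dz dw; field.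
by rewrite dz dw.
Qed.

Lemma cabs_dmoebius c z : cabs c < 1 ->
  cabs (dmoebius c z) = (1 - cabs c ^+ 2) / cabs (1 - c^* * z) ^+ 2.
Proof.
by move=> c1; rewrite /dmoebius cabsM cabsN cabs_1Bsqr ?ltW// cabsV cabsX.
Qed.

Lemma sqr_den_sub c z :
  cabs (1 - c^* * z) ^+ 2 - cabs (c - z) ^+ 2 =
  (1 - cabs c ^+ 2) * (1 - cabs z ^+ 2).
Proof. by case: c z => [x y] [u v]; rewrite !cabs_sqr /=; ring. Qed.

Lemma sqr_moebius c z : cabs c < 1 -> cabs z <= 1 ->
  1 - cabs (moebius c z) ^+ 2 =
  (1 - cabs c ^+ 2) * (1 - cabs z ^+ 2) / cabs (1 - c^* * z) ^+ 2.
Proof.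
move=> c1 z1; have dz := den_neq0 c1 z1.
rewrite -sqr_den_sub /moebius cabsM cabsV.
move: (cabs (1 - _)) (cabs (c - z)) dz (cabs_eq0 (1 - c^* * z)) => A B dz.
by rewrite (negPf dz) => /negbT A0; field.
Qed.

Lemma moebius_le1 c z : cabs c < 1 -> cabs z <= 1 -> cabs (moebius c z) <= 1.
Proof.
move=> c1 z1; rewrite -(@expr_le1 _ 2) ?cabs_ge0// -subr_ge0 sqr_moebius//.
by rewrite divr_ge0 ?mulr_ge0 ?sqr_ge0 ?subr_ge0 ?expr_le1 ?cabs_ge0// ltW.
Qed.

(** The Schwarz-Pick inequality between two points. The distance of
    the images [u] and [v] is measured against [1 - |u||v|], with moduli in place
    of [|1 - u^* v|], because in that form the inequality survives multiplication
    of functions, by [schwarz_pick_mul]. With [rho] the pseudohyperbolic distance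
    of [z] and [w], the condition on [K] reads
    [rho / sqrt (1 - rho^2) <= K |w - z|]. *)
Lemma schwarz_pick_moebius c z w K : cabs c < 1 -> cabs z < 1 -> cabs w < 1 ->
  0 <= K -> 1 <= K ^+ 2 * ((1 - cabs z ^+ 2) * (1 - cabs w ^+ 2)) ->
  cabs (moebius c w - moebius c z) <=
  K * cabs (w - z) * (1 - cabs (moebius c w) * cabs (moebius c z)).
Proof.
move=> c1 z1 w1 K0 hK; rewrite (moebiusB c1 (ltW z1) (ltW w1)).
rewrite mulrAC mulrC (mulrC K) -mulrA ler_wpM2l ?cabs_ge0//.
have dz := den_neq0 c1 (ltW z1); have dw := den_neq0 c1 (ltW w1).
have := sqr_moebius c1 (ltW z1); have := sqr_moebius c1 (ltW w1).
have := moebius_le1 c1 (ltW z1); have := moebius_le1 c1 (ltW w1).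
move: (cabs_ge0 (moebius c z)) (cabs_ge0 (moebius c w)).
move: (cabs (moebius c z)) (cabs (moebius c w)) => x y x0 y0 y1 x1.
have A0 : 0 < 1 - cabs c ^+ 2 by rewrite subr_gt0 expr_lt1 ?cabs_ge0.
rewrite -cabs_gt0 in dz; rewrite -cabs_gt0 in dw.
move: dz dw A0 hK.
move: (cabs (1 - _ * z)) (cabs (1 - _ * w)) (1 - cabs c ^+ 2) => Dz Dw A.
move: (1 - cabs z ^+ 2) (1 - cabs w ^+ 2) => Z W Dz0 Dw0 A0 hK hy hx.
have xy : 0 <= 1 - y * x.
  by rewrite subr_ge0 mulr_ile1.
have n1 : 0 <= A / (Dz * Dw) by rewrite divr_ge0 ?mulr_ge0// ltW.
rewrite -(@ler_pXn2r _ 2) ?nnegrE ?(mulr_ge0 K0 xy)//.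
apply: (@le_trans _ _ (K ^+ 2 * ((1 - x ^+ 2) * (1 - y ^+ 2)))).
  have -> : (A / (Dz * Dw)) ^+ 2 = (A ^+ 2 / (Dz * Dw) ^+ 2) * 1.
    by rewrite mulr1 exprMn exprVn.
  have -> : K ^+ 2 * ((1 - x ^+ 2) * (1 - y ^+ 2)) =
    (A ^+ 2 / (Dz * Dw) ^+ 2) * (K ^+ 2 * (Z * W)).
    by rewrite hx hy; field; rewrite !gt_eqF.
  by rewrite ler_wpM2l// divr_ge0// sqr_ge0.
rewrite exprMn ler_wpM2l ?sqr_ge0// -subr_ge0.
by rewrite (_ : _ - _ = (x - y) ^+ 2) ?sqr_ge0//; ring.
Qed.

End moebius.

(** * Partial Blaschke products and their derivatives *)

Section schwarz_pick_products.
Context {R : realType}.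
Implicit Types (f g : R[i]%C) (T : R).

(** Expanding [f1 g1 - f2 g2] through [f1 g2] or through [f2 g1] gives two bounds.
    Neither implies the claim in general, but one of the two always does. *)
Lemma schwarz_pick_mul f1 f2 g1 g2 T : 0 <= T ->
  cabs f1 <= 1 -> cabs f2 <= 1 -> cabs g1 <= 1 -> cabs g2 <= 1 ->
  cabs (f1 - f2) <= T * (1 - cabs f1 * cabs f2) ->
  cabs (g1 - g2) <= T * (1 - cabs g1 * cabs g2) ->
  cabs (f1 * g1 - f2 * g2) <= T * (1 - cabs (f1 * g1) * cabs (f2 * g2)).
Proof.
move=> T0 f11 f21 g11 g21 hf hg; rewrite !cabsM.
have e1 : f1 * g1 - f2 * g2 = f1 * (g1 - g2) + (f1 - f2) * g2 by ring.
have e2 : f1 * g1 - f2 * g2 = f2 * (g1 - g2) + (f1 - f2) * g1 by ring.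
have h1 : cabs (f1 * g1 - f2 * g2) <=
  T * (cabs f1 * (1 - cabs g1 * cabs g2) + cabs g2 * (1 - cabs f1 * cabs f2)).
  rewrite e1 (le_trans (cabsD _ _))// !cabsM mulrDr lerD//.
    by rewrite mulrCA ler_wpM2l ?cabs_ge0.
  by rewrite mulrC mulrCA ler_wpM2l ?cabs_ge0.
have h2 : cabs (f1 * g1 - f2 * g2) <=
  T * (cabs f2 * (1 - cabs g1 * cabs g2) + cabs g1 * (1 - cabs f1 * cabs f2)).
  rewrite e2 (le_trans (cabsD _ _))// !cabsM mulrDr lerD//.
    by rewrite mulrCA ler_wpM2l ?cabs_ge0.
  by rewrite mulrC mulrCA ler_wpM2l ?cabs_ge0.
move: h1 h2 f11 f21 g11 g21; rewrite {hf hg e1 e2}.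
move: (cabs_ge0 f1) (cabs_ge0 f2) (cabs_ge0 g1) (cabs_ge0 g2).
move: (cabs (_ - _)) (cabs f1) (cabs f2) (cabs g1) (cabs g2) => E x t s y.
move=> x0 t0 s0 y0 h1 h2 x1 t1 s1 y1.
(* With A = (1 - x)(1 - y) and B = (1 - s)(1 - t), the two expansions of the
   difference leave the defects A - x y B and B - s t A, and the larger of A
   and B makes its own defect nonnegative. *)
set A := (1 - x) * (1 - y); set B := (1 - s) * (1 - t).
have A0 : 0 <= A by rewrite mulr_ge0 ?subr_ge0.
have B0 : 0 <= B by rewrite mulr_ge0 ?subr_ge0.
have [BA|/ltW AB] := leP B A.
  apply: (le_trans h1); rewrite ler_wpM2l// -subr_ge0.
  have -> : 1 - x * s * (t * y) - (x * (1 - s * y) + y * (1 - x * t)) =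
    A - x * y * B by rewrite /A /B; ring.
  by rewrite subr_ge0 (le_trans _ BA)// ler_piMl// mulr_ile1.
apply: (le_trans h2); rewrite ler_wpM2l// -subr_ge0.
have -> : 1 - x * s * (t * y) - (t * (1 - s * y) + s * (1 - x * t)) =
  B - s * t * A by rewrite /A /B; ring.
by rewrite subr_ge0 (le_trans _ AB)// ler_piMl// mulr_ile1.
Qed.

End schwarz_pick_products.

(** A first-order expansion with a quadratic remainder lets two-point estimates
    be read as estimates of the derivative [d], by letting the increment tend to
    zero along the real direction. *)
Section derivative_from_increments.
Context {R : realType}.
Variables (f : R[i]%C -> R[i]%C) (z d : R[i]%C) (e Q : R).
Hypothesis e0 : 0 < e.
Hypothesis Q0 : 0 <= Q.
Hypothesis fz : forall w, cabs (w - z) <= e ->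
  cabs (f w - f z - d * (w - z)) <= Q * cabs (w - z) ^+ 2.

Lemma increment_close s : 0 < s -> exists w, [/\ 0 < cabs (w - z),
  cabs (w - z) <= e &
  `|cabs (f w - f z) - cabs d * cabs (w - z)| <= s * cabs (w - z)].
Proof.
move=> s0; have Q1 : 0 < Q + 1 by rewrite ltr_wpDl.
pose h : R := Num.min e (s / (Q + 1)).
have h0 : 0 < h by rewrite lt_min e0 divr_gt0.
have hE : cabs (z + h%:C%C - z) = h.
  by rewrite addrC addKr cabs_real gtr0_norm.
have he : cabs (z + h%:C%C - z) <= e by rewrite hE ge_min lexx.
exists (z + h%:C%C); rewrite -cabsM hE; split => //; first by rewrite -hE.
apply: le_trans (cabs_dist _ _) _; apply: le_trans (fz he) _.
rewrite hE expr2 mulrA ler_wpM2r ?(ltW h0)//.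
have : h <= s / (Q + 1) by rewrite ge_min lexx orbT.
rewrite ler_pdivlMr// => hs; apply: le_trans hs.
by rewrite mulrC ler_wpM2l ?(ltW h0)// lerDl.
Qed.

Lemma cabs_deriv_le M :
  (forall w, cabs (w - z) <= e -> cabs (f w - f z) <= M * cabs (w - z)) ->
  cabs d <= M.
Proof.
move=> fM; apply/ler_addgt0Pl => s /increment_close[w [w0 we]].
rewrite ler_norml => /andP[h _]; rewrite -(ler_pM2r w0) mulrDl.
by have := fM _ we; lra.
Qed.

Lemma cabs_deriv_ge m :
  (forall w, cabs (w - z) <= e -> m * cabs (w - z) <= cabs (f w - f z)) ->
  m <= cabs d.
Proof.
move=> fM; apply/ler_addgt0Pl => s /increment_close[w [w0 we]].
rewrite ler_norml => /andP[_ h]; rewrite -(ler_pM2r w0) mulrDl.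
by have := fM _ we; lra.
Qed.

End derivative_from_increments.

Section partial_products.
Context {R : realType}.
Variables (D : set nat) (a : nat -> R[i]%C) (gam : R[i]%C).
Implicit Types (z w : R[i]%C) (k n N : nat) (r : R).

Definition fac k z : R[i]%C :=
  if k \in D then blaschke_factor (a k) z else 1.

Definition dfac k z : R[i]%C :=
  if k \in D then blaschke_unit (a k) * dmoebius (a k) z else 0.

(** The terms of the Blaschke series, extended by zero so that sums run over
    initial segments of the naturals. *)
Definition defect k : R := if k \in D then 1 - cabs (a k) else 0.

Fixpoint bprod N z : R[i]%C :=
  if N is n.+1 then bprod n z * fac n z else gam.

(** The complex derivative of [bprod N] as the product rule gives it;
    [bprod_remainder] justifies the name. *)
Fixpoint dbprod N z : R[i]%C :=
  if N is n.+1 then dbprod n z * fac n z + bprod n z * dfac n z else 0.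

Lemma bprod_fac N z : bprod N z = gam * \prod_(k < N) fac k z.
Proof.
elim: N => [|N IH] /=; first by rewrite big_ord0 mulr1.
by rewrite big_ord_recr /= IH mulrA.
Qed.

Lemma bprodE N z :
  bprod N z = gam * \prod_(k < N | (k : nat) \in D) blaschke_factor (a k) z.
Proof. by rewrite bprod_fac [in RHS]big_mkcond. Qed.

Hypothesis ha : forall n, D n -> cabs (a n) < 1.
Hypothesis hgam : cabs gam = 1.

Let inD k : k \in D -> cabs (a k) < 1.
Proof. by move=> /set_mem; exact: ha. Qed.

Lemma defect_ge0 k : 0 <= defect k.
Proof. by rewrite /defect; case: ifP => // /inD /ltW; rewrite subr_ge0. Qed.

Lemma sum_defect_ge0 N : 0 <= \sum_(k < N) defect k.
Proof. by apply: sumr_ge0 => k _; exact: defect_ge0. Qed.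

Lemma fac_le1 k z : cabs z <= 1 -> cabs (fac k z) <= 1.
Proof.
move=> z1; rewrite /fac; case: ifPn => [/inD ak|_]; last by rewrite cabs1.
by rewrite blaschke_factorE cabsM cabs_blaschke_unit mul1r moebius_le1.
Qed.

Lemma bprod_le1 N z : cabs z <= 1 -> cabs (bprod N z) <= 1.
Proof.
move=> z1; elim: N => [|N IH] /=; first by rewrite hgam.
by rewrite cabsM mulr_ile1 ?cabs_ge0 ?fac_le1.
Qed.

Lemma one_sub_sqr_le (x : R) : 0 <= x -> 1 - x ^+ 2 <= 2 * (1 - x).
Proof. by move=> x0; have := sqr_ge0 (x - 1); rewrite sqrrB expr1n; lra. Qed.

Lemma cabs_dfac_le k z : cabs z < 1 ->
  cabs (dfac k z) <= 2 * defect k / cabs (1 - (a k)^* * z) ^+ 2.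
Proof.
move=> z1; rewrite /dfac /defect; case: ifPn => [/inD ak|_]; last first.
  by rewrite cabs0 mulr0 mul0r.
rewrite cabsM cabs_blaschke_unit mul1r cabs_dmoebius//.
by rewrite ler_wpM2r ?invr_ge0 ?sqr_ge0// one_sub_sqr_le ?cabs_ge0.
Qed.

Lemma fac_lip k z w r : r < 1 -> cabs z <= r -> cabs w <= r ->
  cabs (fac k w - fac k z) <= 2 * defect k / (1 - r) ^+ 2 * cabs (w - z).
Proof.
move=> r1 zr wr; rewrite /fac /defect; case: ifPn => [/inD ak|_]; last first.
  by rewrite subrr cabs0 mulr0 !mul0r.
have z1 := le_trans zr (ltW r1); have w1 := le_trans wr (ltW r1).
rewrite !blaschke_factorE -mulrBr cabsM cabs_blaschke_unit mul1r moebiusB//.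
have r10 : 0 < 1 - r by rewrite subr_gt0.
have dz : 1 - r <= cabs (1 - (a k)^* * z).
  by rewrite (le_trans _ (cabs_den_ge_z _ (ltW ak)))// lerD2l lerN2.
have dw : 1 - r <= cabs (1 - (a k)^* * w).
  by rewrite (le_trans _ (cabs_den_ge_z _ (ltW ak)))// lerD2l lerN2.
rewrite mulrAC ler_wpM2r ?cabs_ge0//.
rewrite ler_pM ?invr_ge0 ?mulr_ge0 ?cabs_ge0 ?(one_sub_sqr_le (cabs_ge0 _))//.
  by rewrite subr_ge0 expr_le1 ?cabs_ge0// ltW.
rewrite lef_pV2 ?posrE ?exprn_gt0// ?mulr_gt0 ?(lt_le_trans r10)//.
by rewrite expr2 ler_pM// ltW.
Qed.

Lemma fac_remainder k z w r : r < 1 -> cabs z <= r -> cabs w <= r ->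
  cabs (fac k w - fac k z - dfac k z * (w - z)) <=
  2 * defect k / (1 - r) ^+ 3 * cabs (w - z) ^+ 2.
Proof.
move=> r1 zr wr; rewrite /fac /dfac /defect; case: ifPn => [/inD ak|_]; last first.
  by rewrite subrr mul0r subr0 cabs0 mulr0 !mul0r.
have z1 := le_trans zr (ltW r1); have w1 := le_trans wr (ltW r1).
rewrite !blaschke_factorE -(mulrA (blaschke_unit _)) -!mulrBr cabsM.
rewrite cabs_blaschke_unit mul1r moebius_remainder//.
have r10 : 0 < 1 - r by rewrite subr_gt0.
have dz : 1 - r <= cabs (1 - (a k)^* * z).
  by rewrite (le_trans _ (cabs_den_ge_z _ (ltW ak)))// lerD2l lerN2.
have dw : 1 - r <= cabs (1 - (a k)^* * w).
  by rewrite (le_trans _ (cabs_den_ge_z _ (ltW ak)))// lerD2l lerN2.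
have A0 : 0 <= 1 - cabs (a k) ^+ 2.
  by rewrite subr_ge0 expr_le1 ?cabs_ge0// ltW.
rewrite mulrAC ler_wpM2r ?sqr_ge0//.
rewrite ler_pM ?invr_ge0 ?mulr_ge0 ?sqr_ge0 ?cabs_ge0//.
  by rewrite (le_trans _ (one_sub_sqr_le (cabs_ge0 _)))// ler_piMr// ltW.
rewrite lef_pV2 ?posrE ?exprn_gt0// ?mulr_gt0 ?exprn_gt0 ?(lt_le_trans r10)//.
rewrite exprSr ler_pM ?sqr_ge0 ?(ltW r10)//.
by rewrite lerXn2r// nnegrE ?cabs_ge0 ?(ltW r10).
Qed.

Lemma schwarz_pick_fac k z w K : cabs z < 1 -> cabs w < 1 ->
  0 <= K -> 1 <= K ^+ 2 * ((1 - cabs z ^+ 2) * (1 - cabs w ^+ 2)) ->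
  cabs (fac k w - fac k z) <=
  K * cabs (w - z) * (1 - cabs (fac k w) * cabs (fac k z)).
Proof.
move=> z1 w1 K0 hK; rewrite /fac; case: ifPn => [/inD ak|_]; last first.
  by rewrite subrr cabs0 cabs1 mulr1 subrr mulr0.
rewrite !blaschke_factorE -mulrBr !(cabsM (blaschke_unit _)).
rewrite cabs_blaschke_unit !mul1r.
exact: schwarz_pick_moebius.
Qed.

Lemma schwarz_pick_prod (P : pred nat) N z w K : cabs z < 1 -> cabs w < 1 ->
  0 <= K -> 1 <= K ^+ 2 * ((1 - cabs z ^+ 2) * (1 - cabs w ^+ 2)) ->
  let f u := \prod_(k < N | P k) fac k u in
  [/\ cabs (f z) <= 1, cabs (f w) <= 1 &
  cabs (f w - f z) <= K * cabs (w - z) * (1 - cabs (f w) * cabs (f z))].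
Proof.
move=> z1 w1 K0 hK /=; elim: N => [|N [IHz IHw IH]].
  by rewrite !big_ord0 subrr cabs0 cabs1 mulr1 subrr mulr0.
have E u : \prod_(k < N.+1 | P k) fac k u =
    (\prod_(k < N | P k) fac k u) * (if P N then fac N u else 1).
  by rewrite big_mkcond big_ord_recr /= -big_mkcond.
rewrite !E.
have fz : cabs (if P N then fac N z else 1) <= 1.
  by case: ifP; rewrite ?cabs1// fac_le1// ltW.
have fw : cabs (if P N then fac N w else 1) <= 1.
  by case: ifP; rewrite ?cabs1// fac_le1// ltW.
split; [by rewrite cabsM mulr_ile1 ?cabs_ge0..|].
apply: schwarz_pick_mul => //.
  by rewrite mulr_ge0// cabs_ge0.
case: ifP => _; first exact: schwarz_pick_fac.
by rewrite subrr cabs0 cabs1 mulr1 subrr mulr0.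
Qed.

(** The Lipschitz constant does not depend on the number of factors: each factor
    satisfies the two-point Schwarz-Pick inequality, hence so does the product. *)
Lemma bprod_lip N z w r : r < 1 -> cabs z <= r -> cabs w <= r ->
  cabs (bprod N w - bprod N z) <= cabs (w - z) / (1 - r).
Proof.
move=> r1 zr wr; rewrite !bprod_fac -mulrBr cabsM hgam mul1r.
have r10 : 0 < 1 - r by rewrite subr_gt0.
have r0 : 0 <= r := le_trans (cabs_ge0 _) zr.
have sq u : cabs u <= r -> 1 - r <= 1 - cabs u ^+ 2.
  move=> ur; rewrite lerD2l lerN2 expr2 (le_trans _ ur)//.
  by rewrite ler_piMr ?cabs_ge0// (le_trans ur)// ltW.
have K0 : 0 <= (1 - r)^-1 by rewrite invr_ge0 ltW.
have hK : 1 <= (1 - r)^-1 ^+ 2 * ((1 - cabs z ^+ 2) * (1 - cabs w ^+ 2)).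
  rewrite exprVn mulrC ler_pdivlMr ?exprn_gt0// mul1r expr2.
  by rewrite ler_pM ?sq// ltW.
have [f1 f2 f3] :=
  schwarz_pick_prod xpredT N (le_lt_trans zr r1) (le_lt_trans wr r1) K0 hK.
apply: (le_trans f3); rewrite (mulrC _ (1 - r)^-1) ler_piMr//.
  by rewrite mulr_ge0 ?cabs_ge0.
by rewrite gerBl mulr_ge0 ?cabs_ge0.
Qed.

(** The remainder of a product is that of the factors plus the products of
    increments. As the increment of the partial product is bounded independently
    of [N], every new factor adds only a multiple of its own defect, so that for
    a convergent Blaschke series the bound is uniform in [N]. *)
Lemma bprod_remainder N z w r : r < 1 -> cabs z <= r -> cabs w <= r ->
  cabs (bprod N w - bprod N z - dbprod N z * (w - z)) <=
  4 / (1 - r) ^+ 3 * (\sum_(k < N) defect k) * cabs (w - z) ^+ 2.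
Proof.
move=> r1 zr wr; have r10 : 0 < 1 - r by rewrite subr_gt0.
have z1 := le_trans zr (ltW r1).
elim: N => [|N IH] /=.
  by rewrite big_ord0 subrr mul0r subr0 cabs0 mulr0 mul0r.
rewrite big_ord_recr /= [X in _ <= X * _]mulrDr [X in _ <= X]mulrDl.
set P1 := bprod N w; set P0 := bprod N z; set P' := dbprod N z.
set F1 := fac N w; set F0 := fac N z; set F' := dfac N z.
have -> : P1 * F1 - P0 * F0 - (P' * F0 + P0 * F') * (w - z) =
  (P1 - P0 - P' * (w - z)) * F0 +
  (P0 * (F1 - F0 - F' * (w - z)) + (P1 - P0) * (F1 - F0)) by ring.
rewrite (le_trans (cabsD _ _))// lerD//.
  by rewrite cabsM (le_trans _ IH)// ler_piMr ?cabs_ge0// fac_le1.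
have h1 := fac_remainder N r1 zr wr; have h2 := fac_lip N r1 zr wr.
have h3 := bprod_lip N r1 zr wr.
rewrite (le_trans (cabsD _ _))//.
have -> : 4 / (1 - r) ^+ 3 * defect N * cabs (w - z) ^+ 2 =
  2 * defect N / (1 - r) ^+ 3 * cabs (w - z) ^+ 2 +
  cabs (w - z) / (1 - r) * (2 * defect N / (1 - r) ^+ 2 * cabs (w - z)).
  by field; rewrite gt_eqF.
rewrite lerD//.
  by rewrite cabsM (le_trans _ h1)// ler_piMl ?cabs_ge0// bprod_le1.
by rewrite cabsM ler_pM ?cabs_ge0.
Qed.

(** Adding the expansions at [z] and at [w] cancels the increments of the product
    and leaves the difference of the derivatives. *)
Lemma dbprod_lip N z w r : r < 1 -> cabs z <= r -> cabs w <= r ->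
  cabs (dbprod N w - dbprod N z) <=
  8 / (1 - r) ^+ 3 * (\sum_(k < N) defect k) * cabs (w - z).
Proof.
move=> r1 zr wr.
have [->|wz] := eqVneq w z; first by rewrite !subrr cabs0 mulr0.
have h1 := bprod_remainder N r1 zr wr; have h2 := bprod_remainder N r1 wr zr.
have wz0 : 0 < cabs (w - z) by rewrite cabs_gt0 subr_eq0.
rewrite -(ler_pM2r wz0) -cabsM.
have -> : (dbprod N w - dbprod N z) * (w - z) =
  (bprod N z - bprod N w - dbprod N w * (z - w)) +
  (bprod N w - bprod N z - dbprod N z * (w - z)) by ring.
rewrite (le_trans (cabsD _ _))// (le_trans (lerD h2 h1))//.
rewrite (cabs_distC z w) le_eqVlt; apply/orP; left; apply/eqP.
by field; rewrite gt_eqF// subr_gt0.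
Qed.

(** Up to the factor two this is Schwarz-Pick for the derivative; the factor is
    lost by passing to the slightly larger disk of radius [(1 + r) / 2]. *)
Lemma cabs_dbprod_le N z r : r < 1 -> cabs z <= r ->
  cabs (dbprod N z) <= 2 / (1 - r).
Proof.
move=> r1 zr; pose s := (1 + r) / 2.
have s1 : s < 1 by rewrite /s; lra.
have rs : r < s by rewrite /s; lra.
have sw w : cabs (w - z) <= s - r -> cabs w <= s.
  by move=> ws; have := cabsD (w - z) z; rewrite subrK; lra.
apply: (@cabs_deriv_le _ (bprod N) z _ (s - r)
  (4 / (1 - s) ^+ 3 * (\sum_(k < N) defect k))).
- by rewrite subr_gt0.
- rewrite mulr_ge0 ?sum_defect_ge0// divr_ge0// exprn_ge0//.
  by rewrite subr_ge0 ltW.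
- move=> w ws; apply: bprod_remainder => //; first by rewrite (le_trans zr)// ltW.
  exact: sw.
- move=> w ws.
  have h := bprod_lip N s1 (le_trans zr (ltW rs)) (sw _ ws).
  apply: (le_trans h); rewrite mulrC ler_wpM2r ?cabs_ge0//.
  by rewrite -[leRHS]invf_div lef_pV2 ?posrE/s; lra.
Qed.

Lemma cabs_dbprod_le_sum N z : cabs z < 1 ->
  cabs (dbprod N z) <= \sum_(k < N) cabs (dfac k z).
Proof.
move=> z1; elim: N => [|N IH] /=; first by rewrite big_ord0 cabs0.
rewrite big_ord_recr /= (le_trans (cabsD _ _))// !cabsM lerD//.
  by rewrite (le_trans _ IH)// ler_piMr ?cabs_ge0// fac_le1// ltW.
by rewrite ler_piMl ?cabs_ge0// bprod_le1// ltW.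
Qed.

End partial_products.

(** * The derivative of a Blaschke product *)

Section complex_sequences.
Context {R : realType}.
Implicit Types (u : nat -> R[i]%C) (l : R[i]%C).

Lemma cvg_cabsP u l : (u : nat -> R[i]%C^o) @ \oo --> (l : R[i]%C^o) <->
  forall e : R, 0 < e -> \forall n \near \oo, cabs (l - u n) < e.
Proof.
split=> [/cvgrPdist_lt h e e0|h].
  have : (0 : R[i]%C) < e%:C%C by rewrite -[0](rmorph0 (real_complex R)) ltcR.
  by move=> /h; apply: filterS => n; rewrite norm_cabs ltcR.
apply/cvgrPdist_lt => -[x y] xy; move: (xy).
rewrite ltcE /= => /andP[/eqP y0 x0]; have := h _ x0.
by apply: filterS => n hn; rewrite norm_cabs y0 ltcR.
Qed.

Lemma cvg_cabs u l : (u : nat -> R[i]%C^o) @ \oo --> (l : R[i]%C^o) ->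
  cabs (u n) @[n --> \oo] --> cabs l.
Proof.
move=> /cvg_cabsP h; apply/cvgrPdist_lt => e /h; apply: filterS => n.
apply: le_lt_trans; exact: cabs_dist.
Qed.

Lemma cabs_limit_le u l (M : R) :
  (u : nat -> R[i]%C^o) @ \oo --> (l : R[i]%C^o) ->
  (forall n, cabs (u n) <= M) -> cabs l <= M.
Proof.
move=> /cvg_cabs ul uM; have <- := cvg_lim (@Rhausdorff R) ul.
by apply: limr_le; [exact: cvgP ul|exact: nearW].
Qed.

Lemma real_cauchy_cvg (v : nat -> R) :
  (forall e : R, 0 < e -> exists N, forall n, (N <= n)%N -> `|v N - v n| < e) ->
  exists x : R, v n @[n --> \oo] --> x.
Proof.
move=> h; have vc : cvg ((v : nat -> R^o) @ \oo).
  apply/cauchy_cvgP; apply: cauchy_exP => e e0; have [N hN] := h e e0.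
  by exists (v N); exists N.
by exists (lim ((v : nat -> R^o) @ \oo)).
Qed.

Lemma complex_cauchy_cvg u :
  (forall e : R, 0 < e ->
    exists N, forall n, (N <= n)%N -> cabs (u N - u n) < e) ->
  exists l, (u : nat -> R[i]%C^o) @ \oo --> (l : R[i]%C^o).
Proof.
move=> h.
have [|x hx] := real_cauchy_cvg (v := fun n => complex.Re (u n)).
  move=> e /h[N hN]; exists N => n /hN; apply: le_lt_trans.
  by case: (u N) (u n) => [? ?] [? ?]; exact: (Re_le_cabs (Complex _ _)).
have [|y hy] := real_cauchy_cvg (v := fun n => complex.Im (u n)).
  move=> e /h[N hN]; exists N => n /hN; apply: le_lt_trans.
  by case: (u N) (u n) => [? ?] [? ?]; exact: (Im_le_cabs (Complex _ _)).
exists (Complex x y); apply/cvg_cabsP => e e0.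
have e20 : 0 < e / 2 by rewrite divr_gt0.
move/cvgrPdist_lt: hx => /(_ _ e20) hx; move/cvgrPdist_lt: hy => /(_ _ e20) hy.
near=> n; rewrite (splitr e) (le_lt_trans (cabs_le_ReIm _))// ltrD//.
  have : `|x - complex.Re (u n)| < e / 2 by near: n.
  by case: (u n).
have : `|y - complex.Im (u n)| < e / 2 by near: n.
by case: (u n).
Unshelve. all: by end_near. Qed.

End complex_sequences.

Section blaschke_limit.
Context {R : realType}.
Variables (D : set nat) (a : nat -> R[i]%C) (gam : R[i]%C).
Variables (B : R[i]%C -> R[i]%C^o) (E : R).
Hypothesis ha : forall n, D n -> cabs (a n) < 1.
Hypothesis hgam : cabs gam = 1.
Hypothesis hE : forall N, \sum_(k < N) defect D a k <= E.
Hypothesis hB : forall z, cabs z < 1 ->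
  (fun N => bprod D a gam N z : R[i]%C^o) @ \oo --> B z.

Local Notation P := (bprod D a gam).
Local Notation dP := (dbprod D a gam).

Let E_ge0 : 0 <= E.
Proof. by have := hE 0; rewrite big_ord0. Qed.

Let remainder N z w r : r < 1 -> cabs z <= r -> cabs w <= r ->
  cabs (P N w - P N z - dP N z * (w - z)) <=
  4 / (1 - r) ^+ 3 * E * cabs (w - z) ^+ 2.
Proof.
move=> r1 zr wr; rewrite (le_trans (bprod_remainder ha hgam N r1 zr wr))//.
rewrite ler_wpM2r ?sqr_ge0// ler_wpM2l// divr_ge0// exprn_ge0// subr_ge0.
exact: ltW.
Qed.

(** The difference quotients of the partial products over a fixed small step
    converge, and they approximate the derivatives with an error proportional to
    the step, uniformly in [N]; so the derivatives form a Cauchy sequence. *)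
Lemma dbprod_cvg z : cabs z < 1 ->
  exists l, (fun N => dP N z : R[i]%C^o) @ \oo --> (l : R[i]%C^o).
Proof.
move=> z1; pose s := (1 + cabs z) / 2.
have s1 : s < 1 by rewrite /s; lra.
have zs : cabs z < s by rewrite /s; lra.
pose C := 4 / (1 - s) ^+ 3 * E.
have C0 : 0 <= C.
  by rewrite mulr_ge0// divr_ge0// exprn_ge0// subr_ge0 ltW.
apply: complex_cauchy_cvg => e e0.
pose h := Num.min (s - cabs z) (e / (8 * (C + 1))).
have C10 : 0 < 8 * (C + 1) by rewrite mulr_gt0// ltr_wpDl.
have h0 : 0 < h by rewrite lt_min subr_gt0 zs divr_gt0.
have Ch : 8 * (C * h) <= e.
  have : h <= e / (8 * (C + 1)) by rewrite ge_min lexx orbT.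
  by rewrite ler_pdivlMr// => /(le_trans _); apply; nra.
pose w := z + h%:C%C.
have wzE : w - z = h%:C%C by rewrite /w addrC addKr.
have wz : cabs (w - z) = h by rewrite wzE cabs_real gtr0_norm.
have ws : cabs w <= s.
  have hs : h <= s - cabs z by rewrite ge_min lexx.
  by have := cabsD (w - z) z; rewrite subrK wz; lra.
have eh0 : 0 < e * h / 8 by rewrite divr_gt0// mulr_gt0.
have /cvg_cabsP/(_ _ eh0) [Nw _ hw] := hB (le_lt_trans ws s1).
have /cvg_cabsP/(_ _ eh0) [Nz _ hz] := hB z1.
exists (maxn Nw Nz) => n; rewrite geq_max => /andP[nw nz].
set m := maxn Nw Nz.
have hwm := hw m (leq_maxl _ _); have hzm := hz m (leq_maxr _ _).
have hwn := hw n nw; have hzn := hz n nz.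
have rn := remainder n s1 (ltW zs) ws.
have rm := remainder m s1 (ltW zs) ws.
rewrite -(ltr_pM2r h0) -{1}wz -cabsM.
have -> : (dP m z - dP n z) * (w - z) =
  ((P n w - P n z - dP n z * (w - z)) - (P m w - P m z - dP m z * (w - z))) +
  (((B w - P n w) - (B w - P m w)) - ((B z - P n z) - (B z - P m z))) by ring.
have := cabsB (P n w - P n z - dP n z * (w - z)) (P m w - P m z - dP m z * (w - z)).
have := cabsB (B w - P n w) (B w - P m w).
have := cabsB (B z - P n z) (B z - P m z).
have := cabsB ((B w - P n w) - (B w - P m w)) ((B z - P n z) - (B z - P m z)).
have := cabsD
  ((P n w - P n z - dP n z * (w - z)) - (P m w - P m z - dP m z * (w - z)))
  (((B w - P n w) - (B w - P m w)) - ((B z - P n z) - (B z - P m z))).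
rewrite wz -/C in rn rm.
have : C * h ^+ 2 <= e * h / 8.
  by rewrite ler_pdivlMr// mulrC expr2 mulrA mulrA ler_wpM2r ?(ltW h0)// -mulrA.
move=> ? ? ? ? ? ?; lra.
Qed.

(** The expansion with quadratic remainder passes to the limit [N -> oo], and then
    identifies the limit of the derivatives as the derivative of the limit. *)
Lemma derive1_blaschke z : cabs z < 1 ->
  (fun N => dP N z : R[i]%C^o) @ \oo --> (derive1 B z : R[i]%C^o).
Proof.
move=> z1; have [l hl] := dbprod_cvg z1; suff -> : derive1 B z = l by [].
pose s := (1 + cabs z) / 2.
have s1 : s < 1 by rewrite /s; lra.
have zs : cabs z < s by rewrite /s; lra.
pose C := 4 / (1 - s) ^+ 3 * E.
have C0 : 0 <= C.
  by rewrite mulr_ge0// divr_ge0// exprn_ge0// subr_ge0 ltW.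
have rl w : cabs w <= s ->
    cabs (B w - B z - l * (w - z)) <= C * cabs (w - z) ^+ 2.
  move=> ws; apply: (@cabs_limit_le _ (fun N => P N w - P N z - dP N z * (w - z))).
    apply: cvgB; first by apply: cvgB; apply: hB => //; exact: le_lt_trans s1.
    exact: (@cvgMl _ _ _ _ _ _ (w - z : R[i]%C^o) hl).
  by move=> N; apply: remainder => //; exact: ltW.
rewrite /derive1; apply: (cvg_lim (@norm_hausdorff _ _)).
apply/cvgrPdist_lt => -[x y] xy; move: (xy).
rewrite ltcE /= => /andP[/eqP y0 x0]; rewrite y0.
pose d := Num.min (s - cabs z) (x / (C + 1)).
have d0 : 0 < d by rewrite lt_min subr_gt0 zs divr_gt0// ltr_wpDl.
have : (0 : R[i]%C) < d%:C%C by rewrite -[0](rmorph0 (real_complex R)) ltcR.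
move=> /(@dnbhs0_lt _ (R[i]%C^o)) hd; near=> h.
have h0 : h != 0 by near: h; exact: (@nbhs_dnbhs_neq (R[i]%C^o)).
have : `|h| < d%:C%C by near: h.
rewrite !norm_cabs !ltcR lt_min => /andP[h1]; rewrite ltr_pdivlMr ?ltr_wpDl// => h2.
have hz : cabs (h + z) <= s.
  by rewrite (le_trans (cabsD _ _))//; lra.
have := rl _ hz; rewrite addrK.
have -> : l - h^-1 *: (B (h + z) - B z) = - h^-1 * (B (h + z) - B z - l * h).
  by rewrite -[h^-1 *: _]/(h^-1 * _); field.
rewrite cabsM cabsN cabsV => h3.
rewrite mulrC ltr_pdivrMr ?cabs_gt0// (le_lt_trans h3)//.
rewrite expr2 mulrA ltr_pM2r ?cabs_gt0// (le_lt_trans _ h2)//.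
by rewrite mulrC ler_wpM2l ?cabs_ge0// lerDl.
Unshelve. all: by end_near. Qed.

End blaschke_limit.

(** * Integral means as limits *)

Section circles.
Context {R : realType}.
Implicit Types (x y t r M : R).

Lemma derivative_le1_lip (f f' : R -> R) x y :
  (forall u, is_derive u (1 : R) f (f' u)) -> (forall u, `|f' u| <= 1) ->
  `|f y - f x| <= `|y - x|.
Proof.
move=> df f'1; wlog xy : x y / x <= y => [hw|].
  have [/hw//|/ltW/hw] := leP x y.
  by rewrite distrC (distrC x).
have [|c _ ->] := MVT_segment xy (fun u _ => df u).
  apply: derivable_within_continuous => u _.
  exact: ex_derive.
by rewrite normrM ler_piMl.
Qed.

Lemma sin_lip x y : `|sin y - sin x| <= `|y - x|.
Proof.
apply: (@derivative_le1_lip sin cos) => u; rewrite ler_norml.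
by rewrite cos_geN1 cos_le1.
Qed.

Lemma cos_lip x y : `|cos y - cos x| <= `|y - x|.
Proof.
apply: (@derivative_le1_lip cos (fun u => - sin u)) => u.
by rewrite normrN ler_norml sin_geN1 sin_le1.
Qed.

Lemma circle_pt_lip r x y :
  cabs (circle_pt r y - circle_pt r x) <= 2 * `|r| * `|y - x|.
Proof.
rewrite (le_trans (cabs_le_ReIm _))// /circle_pt /= -!mulrBr !normrM.
have := ler_wpM2l (normr_ge0 r) (cos_lip x y).
by have := ler_wpM2l (normr_ge0 r) (sin_lip x y); lra.
Qed.

Lemma lipschitz_continuous (f : R -> R) M :
  (forall x y, `|f y - f x| <= M * `|y - x|) -> continuous f.
Proof.
move=> fM x; apply/cvgrPdist_lt => e e0.
have M0 : 0 <= M.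
  by have := fM 0 1; rewrite subr0 normr1 mulr1; exact: le_trans.
have M10 : 0 < M + 1 by rewrite ltr_wpDl.
near=> y; rewrite distrC (le_lt_trans (fM _ _))//.
have : `|y - x| < e / (M + 1).
  rewrite distrC; near: y; apply: (@cvgr_dist_lt _ _ _ _ _ id x) => //.
  by rewrite divr_gt0.
rewrite ltr_pdivlMr// => h; apply: le_lt_trans h.
by rewrite mulrC ler_wpM2l// lerDl.
Unshelve. all: by end_near. Qed.

Lemma cvg_powR (u : nat -> R) (l p : R) : 0 < p -> (forall n, 0 <= u n) ->
  u n @[n --> \oo] --> l -> u n `^ p @[n --> \oo] --> l `^ p.
Proof.
move=> p0 u0 ul.
have l0 : 0 <= l.
  have <- := cvg_lim (@Rhausdorff R) ul.
  by apply: limr_ge; [exact: cvgP ul|exact: nearW].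
have [l_gt0|] := ltP 0 l; last first.
  move=> l_le0; have -> : l = 0 by apply/eqP; rewrite eq_le l0 l_le0.
  rewrite powR0 ?gt_eqF//; apply/cvgrPdist_lt => e e0.
  have ep : 0 < e `^ p^-1 by rewrite powR_gt0.
  move/cvgrPdist_lt: ul => /(_ _ ep); apply: filterS => n.
  have -> : l = 0 by apply/eqP; rewrite eq_le l0 l_le0.
  rewrite !sub0r !normrN !ger0_norm ?powR_ge0// => h.
  have := gt0_ltr_powR p0 (u0 n) (ltW ep) h.
  by rewrite -powRrM mulVf ?gt_eqF// powRr1// ltW.
have pc : {for l, continuous (fun x : R => x `^ p)}.
  apply: differentiable_continuous; apply/derivable1_diffP.
  by apply: derivable_powR; rewrite in_itv/= l_gt0.
exact: (@continuous_cvg _ _ _ _ _ u (fun x : R => x `^ p) l pc ul).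
Qed.

End circles.

Section zero_sums.
Context {R : realType}.
Variables (D : set nat) (a : nat -> R[i]%C).

Lemma partial_le_zero_sum (F : R -> R) N : (forall n, D n -> 0 <= F (cabs (a n))) ->
  ((\sum_(k < N | (k : nat) \in D) F (cabs (a k)))%:E <= zero_sum D a F)%E.
Proof.
move=> F0; rewrite /zero_sum -{2}(set_mem_set D) -nneseries_esum; last first.
  by move=> n /set_mem /F0; rewrite lee_fin.
apply: le_trans (nneseries_lim_ge N _); last first.
  by move=> n _ /set_mem /F0; rewrite lee_fin.
by rewrite big_mkord sumEFin.
Qed.

Lemma zero_sum_le (F : R -> R) (M : \bar R) :
  (forall n, D n -> 0 <= F (cabs (a n))) ->
  (forall N, ((\sum_(k < N | (k : nat) \in D) F (cabs (a k)))%:E <= M)%E) ->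
  (zero_sum D a F <= M)%E.
Proof.
move=> F0 FM; rewrite /zero_sum -(set_mem_set D) -nneseries_esum; last first.
  by move=> n /set_mem /F0; rewrite lee_fin.
apply: lime_le.
  by apply: is_cvg_nneseries => n _ /set_mem /F0; rewrite lee_fin.
by apply: nearW => N; rewrite big_mkord sumEFin.
Qed.

End zero_sums.

Section blaschke_data.
Context {R : realType}.
Variables (D : set nat) (a : nat -> R[i]%C) (B : R[i]%C -> R[i]%C^o).

Definition partial_mean (gam : R[i]%C) (p r : R) (N : nat) : \bar R :=
  (\int[lebesgue_measure]_(t in `[0%R, (2 * pi)%R])
     (cabs (dbprod D a gam N (circle_pt r t)) `^ p)%:E)%E.

Lemma continuous_cabs_dbprod (gam : R[i]%C) (N : nat) (r : R) :
  (forall n, D n -> cabs (a n) < 1) -> cabs gam = 1 -> 0 < r < 1 ->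
  continuous (fun t : R => cabs (dbprod D a gam N (circle_pt r t))).
Proof.
move=> ha hgam /andP[r0 r1].
apply: (@lipschitz_continuous _ _ (8 / (1 - r) ^+ 3 *
  (\sum_(k < N) defect D a k) * (2 * r))) => x y.
set z := circle_pt r x; set w := circle_pt r y.
have zr : cabs z <= r by rewrite cabs_circle_pt gtr0_norm.
have wr : cabs w <= r by rewrite cabs_circle_pt gtr0_norm.
apply: (@le_trans _ _ (cabs (dbprod D a gam N w - dbprod D a gam N z))).
  exact: cabs_dist.
apply: (le_trans (dbprod_lip ha hgam N r1 zr wr)).
rewrite -(mulrA _ (2 * r)) ler_wpM2l//; last first.
  by have := circle_pt_lip r x y; rewrite gtr0_norm.
rewrite mulr_ge0 ?(sum_defect_ge0 ha)// divr_ge0// exprn_ge0// subr_ge0.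
exact: ltW.
Qed.

Lemma measurable_dbprod_powR (gam : R[i]%C) (N : nat) (p r : R) :
  (forall n, D n -> cabs (a n) < 1) -> cabs gam = 1 -> 0 < r < 1 ->
  measurable_fun setT
    (fun t : R => cabs (dbprod D a gam N (circle_pt r t)) `^ p).
Proof.
move=> ha hgam r01; apply: (measurableT_comp (@measurable_powR R p)).
by apply: continuous_measurable_fun; exact: continuous_cabs_dbprod.
Qed.

(** Dominated convergence, the bound [2 / (1 - r)] for the derivatives being
    independent of [N]. Through this lemma both inequalities of the theorem
    follow from estimates for finite products that are uniform in [N]. *)
Lemma blaschke_approximation : blaschke_product D a B ->
  exists gam, [/\ forall n, D n -> cabs (a n) < 1, cabs gam = 1 &
    forall p r, 0 < p -> 0 < r < 1 ->
      partial_mean gam p r N @[N --> \oo] --> circle_mean p B r].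
Proof.
move=> [ha hs [gam hgam hB]]; exists gam; split => // p r p0 /andP[r0 r1].
have d0 n : D n -> 0 <= 1 - cabs (a n) by move=> /ha /ltW; rewrite subr_ge0.
have [E hE] : exists E, forall N, \sum_(k < N) defect D a k <= E.
  exists (fine (zero_sum D a (fun x => 1 - x))) => N.
  rewrite -lee_fin fineK; last first.
    by rewrite ge0_fin_numE//; apply: esum_ge0 => n /d0; rewrite lee_fin.
  by apply: le_trans (@partial_le_zero_sum _ _ _ _ N d0); rewrite -big_mkcond.
have {}hB z : cabs z < 1 -> (fun N => bprod D a gam N z : R[i]%C^o) @ \oo --> B z.
  by move=> /hB; under eq_fun do rewrite -bprodE.
apply: (@dominated_cvg _ _ _ lebesgue_measure _ _ _ _
  (cst ((2 / (1 - r)) `^ p)%:E)) => //=.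
- move=> N; apply/measurable_EFinP/measurable_funTS.
  by apply: measurable_dbprod_powR => //; rewrite r0.
- move=> t _; have t1 : cabs (circle_pt r t) < 1.
    by rewrite cabs_circle_pt gtr0_norm.
  apply: cvg_EFin; first exact: nearW.
  apply: cvg_powR => //; first by move=> n; exact: cabs_ge0.
  exact: (cvg_cabs (derive1_blaschke ha hgam hE hB t1)).
- apply: (@continuous_compact_integrable R (cst ((2 / (1 - r)) `^ p))).
    exact: segment_compact.
  by apply: continuous_subspaceT => x; exact: cvg_cst.
- move=> N t _; rewrite lee_fin ger0_norm ?powR_ge0//.
  have h0 : 0 <= 2 / (1 - r) by rewrite divr_ge0// subr_ge0 ltW.
  rewrite ge0_ler_powR ?(ltW p0)// ?nnegrE ?cabs_ge0//.
  by rewrite (cabs_dbprod_le ha hgam)// cabs_circle_pt gtr0_norm.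
Qed.

End blaschke_data.

(** * Normal weights *)

Section weight_comparisons.
Context {R : realType}.
Implicit Types (w V U : R -> R) (s r x y : R).

(** Monotonicity near [1] extends to all radii up to a constant, because [V] lies
    between positive constants on the remaining compact part. *)
Lemma almost_increasing V r0 : r0 < 1 -> increasing_after V r0 ->
  comparable_to_1_on_compacts V ->
  exists2 C : R, 0 < C &
    forall x y, 0 <= x -> x <= y -> y < 1 -> V x <= C * V y.
Proof.
move=> r01 Vinc Vc; pose r1 : R := (Num.max 0 r0 + 1) / 2.
have m1 : Num.max 0 r0 < 1 by rewrite gt_max ltr01.
have m0 : 0 <= Num.max 0 r0 by rewrite le_max lexx.
have mr : r0 <= Num.max 0 r0 by rewrite le_max lexx orbT.
have r1b : 0 < r1 < 1 by rewrite /r1; apply/andP; split; lra.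
have r0r1 : r0 < r1 by rewrite /r1; lra.
have [m [M [mgt0 mM]]] := Vc _ r1b.
have mM1 : m <= M.
  have /mM/andP[] : 0 <= r1 <= r1 by rewrite lexx ltW //; case/andP: r1b.
  exact: le_trans.
pose C : R := Num.max 1 (M / m).
have C1 : 1 <= C by rewrite le_max lexx.
have CM : M <= C * m by rewrite -ler_pdivrMr// le_max lexx orbT.
have C0 : 0 <= C by rewrite (le_trans ler01).
exists C; first by rewrite (lt_le_trans ltr01).
move=> x y x0 xy y1.
have lowy : m <= V y.
  have [yr1|/ltW r1y] := leP y r1.
    by have /mM/andP[] : 0 <= y <= r1 by rewrite (le_trans x0 xy).
  have /mM/andP[mV _] : 0 <= r1 <= r1 by rewrite lexx ltW //; case/andP: r1b.
  apply: (le_trans mV); apply: Vinc => //; rewrite in_itv/= ?r0r1//.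
    by case/andP: r1b.
  by apply/andP; split; [exact (lt_le_trans r0r1 r1y)|].
have [xr1|r1x] := leP x r1.
  have /mM/andP[_ Vx] : 0 <= x <= r1 by rewrite x0.
  by rewrite (le_trans Vx)// (le_trans CM)// ler_wpM2l.
have Vy0 : 0 <= V y by rewrite (le_trans (ltW mgt0)).
apply: (@le_trans _ _ (V y)); last by rewrite ler_peMl.
apply: Vinc => //; rewrite in_itv/=.
  by apply/andP; split; [exact (lt_trans r0r1 r1x)|exact (le_lt_trans xy y1)].
by apply/andP; split; [exact (lt_trans r0r1 (lt_le_trans r1x xy))|].
Qed.

(** The reciprocal of [V] is increasing near [1] and inherits the comparability
    to [1] on compact sets. *)
Lemma almost_decreasing V r0 : r0 < 1 -> decreasing_after V r0 ->
  comparable_to_1_on_compacts V ->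
  exists2 C : R, 0 < C &
    forall x y, 0 <= x -> x <= y -> y < 1 -> V y <= C * V x.
Proof.
move=> r01 Vdec Vc.
have V0 x : 0 <= x -> x < 1 -> 0 < V x.
  move=> x0 x1; pose y : R := (x + 1) / 2.
  have [|m [M [m0 mM]]] := Vc y; first by rewrite /y; apply/andP; split; lra.
  have /mM/andP[mV _] : 0 <= x <= y by rewrite /y; apply/andP; split; lra.
  exact: lt_le_trans mV.
have Uc : comparable_to_1_on_compacts (fun r => (V r)^-1).
  move=> rho hrho; have [m [M [m0 mM]]] := Vc _ hrho.
  have /andP[rho0 rho1] := hrho.
  have M0 : 0 < M.
    have /mM/andP[mV VM] : 0 <= rho <= rho by rewrite lexx ltW.
    exact: lt_le_trans m0 (le_trans mV VM).
  exists M^-1, m^-1; split => [|r /[dup] hr /mM/andP[mV VM]].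
    by rewrite invr_gt0.
  have Vr : 0 < V r := lt_le_trans m0 mV.
  by rewrite !lef_pV2 ?posrE// VM.
pose r1 : R := Num.max 0 r0.
have r11 : r1 < 1 by rewrite gt_max ltr01.
have Uinc : increasing_after (fun r => (V r)^-1) r1.
  move=> x y; rewrite !in_itv/= !gt_max.
  move=> /andP[/andP[x0 rx] x1] /andP[/andP[y0 ry] y1] xy.
  rewrite lef_pV2 ?posrE ?V0 ?(ltW x0) ?(ltW y0)//.
  by apply: Vdec => //; rewrite in_itv/= ?rx ?ry.
have [C C0 hC] := almost_increasing r11 Uinc Uc.
exists C => // x y x0 xy y1; have := hC _ _ x0 xy y1.
have Vx : 0 < V x by rewrite V0// (le_lt_trans xy).
have Vy : 0 < V y by rewrite V0// (le_trans x0).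
by rewrite ler_pdivlMr// mulrC ler_pdivrMr.
Qed.

Lemma comparableM V U : comparable_to_1_on_compacts V ->
  comparable_to_1_on_compacts U ->
  comparable_to_1_on_compacts (fun r => V r * U r).
Proof.
move=> hV hU rho hrho; have [m [M [m0 mM]]] := hV _ hrho.
have [m' [M' [m'0 mM']]] := hU _ hrho.
exists (m * m'), (M * M'); split; first by rewrite mulr_gt0.
move=> r hr; have /andP[h1 h2] := mM _ hr; have /andP[h3 h4] := mM' _ hr.
have V0 : 0 <= V r by rewrite (le_trans (ltW m0)).
have U0 : 0 <= U r by rewrite (le_trans (ltW m'0)).
by apply/andP; split; apply: ler_pM => //; exact: ltW.
Qed.

Lemma comparable_power s : comparable_to_1_on_compacts (fun r : R => (1 - r) `^ s).
Proof.
move=> rho /andP[rho0 rho1]; pose c : R := 1 - rho.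
have c0 : 0 < c by rewrite subr_gt0.
exists (c `^ `|s|), (c `^ (- `|s|)); split; first exact: powR_gt0.
move=> r /andP[r0 rr].
have t0 : 0 < 1 - r by rewrite subr_gt0 (le_lt_trans rr).
have t1 : 1 - r <= 1 by rewrite gerBl.
have ct : c <= 1 - r by rewrite lerD2l lerN2.
have h : c `^ `|s| <= (1 - r) `^ `|s|.
  by rewrite ge0_ler_powR ?nnegrE ?(ltW c0) ?(ltW t0).
apply/andP; split.
  by rewrite (le_trans h)// ger_powR ?t0// ler_norm.
apply: (@le_trans _ _ ((1 - r) `^ (- `|s|))).
  by rewrite ger_powR ?t0// lerNl -normrN ler_norm.
by rewrite !powRN lef_pV2// posrE powR_gt0.
Qed.

Lemma comparable_over_power w s : comparable_to_1_on_compacts w ->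
  comparable_to_1_on_compacts (over_power w s).
Proof.
move=> hw; have := comparableM hw (comparable_power (- s)).
by under [fun r => _ * _]eq_fun do rewrite powRN.
Qed.

Lemma log_factor_ge1 x : 1 <= log_factor x.
Proof. by rewrite /log_factor le_max lexx. Qed.

Lemma log_factor_le x y : x <= y -> y < 1 -> log_factor x <= log_factor y.
Proof.
move=> xy y1; rewrite /log_factor ge_max !le_max lexx /= ler_ln ?posrE ?invr_gt0.
- by rewrite lef_pV2 ?posrE ?lerD2l ?lerN2 ?xy ?orbT// subr_gt0 ?(le_lt_trans xy).
- by rewrite subr_gt0 (le_lt_trans xy).
- by rewrite subr_gt0.
Qed.

Lemma powR_ge1 x s : 0 <= s -> 1 <= x -> 1 <= x `^ s.
Proof.
move=> s0 x1; have x0 := le_trans ler01 x1.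
have : 1 `^ s <= x `^ s by rewrite ge0_ler_powR ?nnegrE.
by rewrite powR1.
Qed.

Lemma comparable_log_factor al : 0 <= al ->
  comparable_to_1_on_compacts (fun r : R => log_factor r `^ al).
Proof.
move=> al0 rho /andP[rho0 rho1]; exists 1, (log_factor rho `^ al).
have lf0 x : 0 <= (log_factor x : R) := le_trans ler01 (log_factor_ge1 x).
split => // r /andP[r0 rr]; apply/andP; split.
  exact: powR_ge1 al0 (log_factor_ge1 r).
by rewrite ge0_ler_powR ?nnegrE// log_factor_le.
Qed.

Lemma over_power_ge0 w s r : (forall r, 0 <= r < 1 -> 0 <= w r) ->
  0 <= r < 1 -> 0 <= over_power w s r.
Proof. by move=> w0 hr; rewrite divr_ge0 ?w0// powR_ge0. Qed.

Lemma over_powerD w s s' r : r < 1 ->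
  over_power w (s + s') r = over_power w s r * (1 - r) `^ (- s').
Proof.
move=> r1; have t0 : 1 - r != 0 by rewrite subr_eq0 gt_eqF.
by rewrite /over_power powRD ?t0 ?implybT// invfM mulrA powRN.
Qed.

(** An exponent below [s] is admissible for the infimum, and raising the exponent
    multiplies by an increasing function. *)
Lemma a_index_lt w s : normal_weight w -> a_index w < s ->
  exists2 r0 : R, 0 < r0 < 1 & increasing_after (over_power w s) r0.
Proof.
move=> [_ w0 [a [_ [ra [ra01 wa _]]]]] /inf_lt[|s' [r0 r01 [inc _]] s's].
  by exists a; exists ra.
exists r0 => // x y; rewrite !in_itv/= => /andP[x0 x1] /andP[y0 y1] xy.
have pos u : r0 < u -> 0 < u by apply: lt_trans; case/andP: r01.
rewrite -(subrK s' s) addrC !over_powerD// ler_pM ?powR_ge0//.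
- by rewrite over_power_ge0// ltW// pos.
- by apply: inc => //; rewrite in_itv/= ?x0 ?y0.
rewrite !powRN lef_pV2 ?posrE ?powR_gt0 ?subr_gt0//.
rewrite ge0_ler_powR ?nnegrE ?subr_ge0 ?(ltW s's) ?(ltW x1) ?(ltW y1)//.
by rewrite lerD2l lerN2.
Qed.

Lemma b_index_gt w s : normal_weight w -> s < b_index w ->
  exists2 r0 : R, 0 < r0 < 1 & decreasing_after (over_power w s) r0.
Proof.
move=> [_ w0 [_ [b [rb [rb01 _ wb]]]]] /sup_gt[|s' [r0 r01 [dec _]] ss'].
  by exists b; exists rb.
exists r0 => // x y; rewrite !in_itv/= => /andP[x0 x1] /andP[y0 y1] xy.
have pos u : r0 < u -> 0 < u by apply: lt_trans; case/andP: r01.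
rewrite -(subrK s' s) addrC !over_powerD// ler_pM ?powR_ge0//.
- by rewrite over_power_ge0// ltW// pos.
- by apply: dec => //; rewrite in_itv/= ?x0 ?y0.
rewrite ge0_ler_powR ?nnegrE ?subr_ge0 ?(ltW x1) ?(ltW y1)//.
  by rewrite opprB subr_ge0 ltW.
by rewrite lerD2l lerN2.
Qed.

Lemma normal_upper w s : normal_weight w -> comparable_to_1_on_compacts w ->
  a_index w < s -> exists2 C : R, 0 < C &
    forall x y, 0 <= x -> x <= y -> y < 1 ->
      over_power w s x <= C * over_power w s y.
Proof.
move=> hw hc /(a_index_lt hw)[r0 /andP[_ r01] inc].
exact: almost_increasing r01 inc (comparable_over_power s hc).
Qed.

Lemma normal_lower w s : normal_weight w -> comparable_to_1_on_compacts w ->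
  s < b_index w -> exists2 C : R, 0 < C &
    forall x y, 0 <= x -> x <= y -> y < 1 ->
      over_power w s y <= C * over_power w s x.
Proof.
move=> hw hc /(b_index_gt hw)[r0 /andP[_ r01] dec].
exact: almost_decreasing r01 dec (comparable_over_power s hc).
Qed.

(** At the critical exponent itself, monotonicity is known only after
    multiplication by a power of the logarithm with exponent less than [1]. The
    factor is dropped on the left and enlarged to its first power on the right,
    which is where the logarithm in the theorem comes from. *)
Lemma normal_upper_log w : normal_weight w -> comparable_to_1_on_compacts w ->
  log_increasing w -> exists2 C : R, 0 < C &
    forall x y, 0 <= x -> x <= y -> y < 1 ->
      over_power w (a_index w) x <=
      C * (over_power w (a_index w) y * log_factor y).
Proof.
move=> hw hc [al [r0 [/andP[al0 al1] /andP[r00 r01] inc]]].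
set s := a_index w in inc *.
have w0 : forall r, 0 <= r < 1 -> 0 <= w r by case: hw.
pose V r := over_power w s r * log_factor r `^ al.
(* Beyond 1 - 1/e the logarithm exceeds the cut-off in log_factor. *)
pose r1 : R := Num.max r0 (1 - (expR 1)^-1).
have e0 : 0 < (expR 1 : R)^-1 by rewrite invr_gt0 expR_gt0.
have r11 : r1 < 1 by rewrite gt_max r01 ltrBlDr ltrDl.
have logE r : r1 < r -> r < 1 -> log_factor r = ln (1 - r)^-1.
  rewrite gt_max => /andP[_ h] rlt1; apply/max_idPr.
  rewrite -[leLHS]expRK ler_ln ?posrE ?expR_gt0 ?invr_gt0 ?subr_gt0//.
  by rewrite -[leLHS]invrK lef_pV2 ?posrE ?subr_gt0//; lra.
have Vinc : increasing_after V r1.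
  move=> x y; rewrite !in_itv/= => /andP[x0 x1] /andP[y0 y1] xy.
  rewrite /V !logE//; move: x0 y0; rewrite !gt_max => /andP[x0 _] /andP[y0 _].
  by apply: inc => //; rewrite in_itv/= ?x0 ?y0.
have Vc := comparableM (comparable_over_power s hc)
  (comparable_log_factor (ltW al0)).
have [C C0 hC] := almost_increasing r11 Vinc Vc.
exists C => // x y x0 xy y1; have := hC _ _ x0 xy y1.
have lf1 u : 1 <= (log_factor u : R) `^ al.
  exact: powR_ge1 (ltW al0) (log_factor_ge1 u).
have ox : 0 <= over_power w s x.
  by rewrite over_power_ge0// x0 (le_lt_trans xy).
have oy : 0 <= over_power w s y by rewrite over_power_ge0// (le_trans x0 xy).
rewrite /V => h; apply: (@le_trans _ _ (over_power w s x * log_factor x `^ al)).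
  by rewrite ler_peMr.
apply: (le_trans h); rewrite ler_wpM2l ?(ltW C0)// ler_wpM2l//.
by rewrite ler1_powR ?log_factor_ge1// ltW.
Qed.

End weight_comparisons.

(** * Power kernels and trigonometric bounds *)

Section kernel_integrals.
Context {R : realType}.
Implicit Types (a b c s q t x y : R).
Local Notation mu := (@lebesgue_measure R).

Lemma FTC_is_derive (f F : R -> R) a b : a < b ->
  (forall t, a <= t <= b -> is_derive t (1 : R) F (f t)) ->
  (forall t, a <= t <= b -> {for t, continuous f}) ->
  (\int[mu]_(t in `[a, b]) (f t)%:E = (F b - F a)%:E)%E.
Proof.
move=> ab dF cf.
have cF t : a <= t <= b -> F x @[x --> t] --> F t.
  move=> /dF tF; apply: differentiable_continuous; apply/derivable1_diffP.
  exact: ex_derive.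
rewrite (@continuous_FTC2 _ f F a b ab) ?EFinB//.
- by apply: continuous_in_subspaceT => t; rewrite inE/= in_itv/= => /cf.
- split.
  + move=> t; rewrite in_itv/= => /andP[ta tb].
    by have := dF t; rewrite !ltW// => /(_ isT) ?; exact: ex_derive.
  + by apply: cvg_at_right_filter; apply: cF; rewrite lexx ltW.
  + by apply: cvg_at_left_filter; apply: cF; rewrite lexx andbT ltW.
- move=> t; rewrite in_itv/= => /andP[ta tb].
  have := dF t; rewrite !ltW// => /(_ isT) h.
  by rewrite derive1E; exact: derive_val.
Qed.

Lemma is_derive_powR (u e : R) : 0 < u ->
  is_derive u (1 : R) (fun v : R => v `^ e) (e * u `^ (e - 1)).
Proof.
move=> u0; have uI : u \in `]0, +oo[ by rewrite in_itv/= u0.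
apply: DeriveDef; first exact: derivable_powR.
by rewrite -derive1E powR_derive1.
Qed.

(** The sign [s] lets one formula serve both halves of a kernel in [|t - x|]. *)
Lemma integral_affine_powR c s q a b : a < b -> s * s = 1 -> q != 1 ->
  (forall t, a <= t <= b -> 0 < c + s * t) ->
  (\int[mu]_(t in `[a, b]) ((c + s * t) `^ (- q))%:E =
   (s * ((c + s * b) `^ (1 - q) - (c + s * a) `^ (1 - q)) / (1 - q))%:E)%E.
Proof.
move=> ab ss q1 pos; have q10 : 1 - q != 0 by rewrite subr_eq0 eq_sym.
have daff t : is_derive t (1 : R) (fun u : R => c + s * u) s.
  by apply: is_derive_eq; rewrite add0r mul1r -[_%:A]/(s * 1) mulr1.
pose F t : R := (s / (1 - q)) * (c + s * t) `^ (1 - q).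
have dF t : a <= t <= b -> is_derive t (1 : R) F ((c + s * t) `^ (- q)).
  move=> /pos t0.
  have h := @is_derive1_comp _ (fun v : R => v `^ (1 - q)) (fun u => c + s * u)
    t _ _ (is_derive_powR (1 - q) t0) (daff t).
  apply: is_derive_eq.
  rewrite (_ : 1 - q - 1 = - q); last by ring.
  rewrite -[_ *: _]/(s / (1 - q) * ((1 - q) * (c + s * t) `^ (- q) * s)).
  have -> X : s / (1 - q) * ((1 - q) * X * s) = s * s * X by field.
  by rewrite ss mul1r.
have cf t : a <= t <= b -> {for t, continuous (fun t => (c + s * t) `^ (- q))}.
  move=> /pos t0.
  have h := @is_derive1_comp _ (fun v : R => v `^ (- q)) (fun u => c + s * u)
    t _ _ (is_derive_powR (- q) t0) (daff t).
  apply: differentiable_continuous; apply/derivable1_diffP.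
  exact: (@ex_derive _ _ _ _ _ _ _ h).
by rewrite (FTC_is_derive ab dF cf); congr (_%:E); rewrite /F; field.
Qed.

Lemma measurable_dist_powR x (e q : R) :
  measurable_fun setT (fun t : R => (e + `|t - x|) `^ (- q)).
Proof.
apply: (measurableT_comp (@measurable_powR R (- q))).
apply: continuous_measurable_fun; apply: (@lipschitz_continuous _ _ 1) => t u.
rewrite mul1r opprD addrACA subrr add0r (le_trans (ler_dist_dist _ _))//.
by rewrite opprB addrA subrK.
Qed.

(** The integral is enlarged to an interval symmetric about [x], whose halves are
    computed by the fundamental theorem; the exponent [1 - q] is that of the
    primitive, whose value at the centre dominates. *)
Lemma integral_kernel_le x (e q : R) : 0 < e -> 1 < q ->
  (\int[mu]_(t in `[0%R, (2 * pi)%R]) ((e + `|t - x|) `^ (- q))%:E <=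
   (2 / (q - 1) * e `^ (1 - q))%:E)%E.
Proof.
move=> e0 q1; pose L : R := `|x| + 2 * pi.
have pi0 : 0 < (pi : R) by exact: pi_gt0.
have L0 : 0 < L by rewrite /L; have := normr_ge0 x; lra.
have q10 : 0 < q - 1 by rewrite subr_gt0.
have q1N : q != 1 by rewrite gt_eqF.
have mk A : measurable_fun A (fun t : R => ((e + `|t - x|) `^ (- q))%:E).
  by apply/measurable_EFinP/measurable_funTS; exact: measurable_dist_powR.
have k0 (t : R) : (0 <= ((e + `|t - x|) `^ (- q))%:E)%E.
  by rewrite lee_fin powR_ge0.
have h1 : (\int[mu]_(t in `[(x - L)%R, x]) ((e + `|t - x|) `^ (- q))%:E <=
    ((q - 1)^-1 * e `^ (1 - q))%:E)%E.
  rewrite (@eq_integral _ _ _ mu _ (fun t => ((e + x + -1 * t) `^ (- q))%:E)).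
    rewrite integral_affine_powR ?mulrNN ?mul1r//; first last.
    - by move=> t /andP[_ tx]; lra.
    - lra.
    rewrite lee_fin [X in X <= _](_ : _ = (q - 1)^-1 *
      (e `^ (1 - q) - (e + L) `^ (1 - q))).
      by rewrite ler_wpM2l ?invr_ge0 ?(ltW q10)// gerBl powR_ge0.
    have -> : e + x + -1 * x = e by ring.
    have -> : e + x + -1 * (x - L) = e + L by ring.
    by field; rewrite !subr_eq0 q1N eq_sym.
  move=> t; rewrite inE/= in_itv/= => /andP[_ tx].
  by rewrite ler0_norm ?subr_le0//; congr ((_ `^ _)%:E); ring.
have h2 : (\int[mu]_(t in `[x, (x + L)%R]) ((e + `|t - x|) `^ (- q))%:E <=
    ((q - 1)^-1 * e `^ (1 - q))%:E)%E.
  rewrite (@eq_integral _ _ _ mu _ (fun t => ((e - x + 1 * t) `^ (- q))%:E)).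
    rewrite integral_affine_powR ?mul1r//; first last.
    - by move=> t /andP[tx _]; lra.
    - lra.
    rewrite lee_fin [X in X <= _](_ : _ = (q - 1)^-1 *
      (e `^ (1 - q) - (e + L) `^ (1 - q))).
      by rewrite ler_wpM2l ?invr_ge0 ?(ltW q10)// gerBl powR_ge0.
    have -> : e - x + x = e by ring.
    have -> : e - x + (x + L) = e + L by ring.
    by field; rewrite !subr_eq0 q1N eq_sym.
  move=> t; rewrite inE/= in_itv/= => /andP[tx _].
  by rewrite ger0_norm ?subr_ge0//; congr ((_ `^ _)%:E); ring.
apply: (@le_trans _ _ (\int[mu]_(t in `[(x - L)%R, x[ `|` `[x, (x + L)%R])
    ((e + `|t - x|) `^ (- q))%:E)%E).
  apply: ge0_subset_integral => //; [exact: measurableU|exact: mk|].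
  move=> t /=; rewrite !in_itv/= => /andP[t0 t2].
  have := ler_norm x; have := ler_norm (- x); rewrite normrN => n1 n2.
  have [tx|xt] := ltP t x; [left|right]; rewrite ?andbT /= /L; lra.
rewrite ge0_integral_setU//; last 2 first.
  exact: mk.
  apply/disj_setPS => t [/=]; rewrite !in_itv/= => /andP[_ tx] /andP[xt _].
  by move: (lt_le_trans tx xt); rewrite ltxx.
have -> : 2 / (q - 1) * e `^ (1 - q) =
    (q - 1)^-1 * e `^ (1 - q) + (q - 1)^-1 * e `^ (1 - q) by ring.
rewrite EFinD leeD//; apply: le_trans h1; apply: ge0_subset_integral => //.
  exact: mk.
by move=> t /=; rewrite !in_itv/= => /andP[-> /ltW].
Qed.

(** With [y = x / 2], the duplication formula and the mean value theorem give
    [sin x >= 2 y cos^2 y], and [2 cos^2 y >= 1]. *)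
Lemma sin_ge_half x : 0 <= x <= pi / 2 -> x / 2 <= sin x.
Proof.
move=> /andP[x0 xpi]; have pi0 : 0 < (pi : R) by exact: pi_gt0.
pose y : R := x / 2.
have y0 : 0 <= y by rewrite /y; lra.
have y2 : y *+ 2 = x by rewrite -[y *+ 2]mulr_natr /y divfK.
rewrite -[X in _ <= sin X]y2.
have [|c] := MVT_segment y0 (fun u _ => is_derive_sin u).
  by apply: continuous_subspaceT => u; exact: continuous_sin.
rewrite in_itv/= sin0 !subr0 => /andP[c0 cy] siny.
have cosy0 : 0 <= cos y.
  by apply: cos_ge0_pihalf; rewrite /y; apply/andP; split; lra.
have cosc : cos y <= cos c.
  have ypi : y <= pi by rewrite /y; lra.
  have cI : c \in `[0, pi] by rewrite in_itv/= c0 (le_trans cy).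
  have yI : y \in `[0, pi] by rewrite in_itv/= y0.
  by rewrite leNgt ltr_cos// -leNgt.
have cos2 : 1 <= cos y ^+ 2 *+ 2.
  rewrite -subr_ge0 -cos_mulr2n.
  by apply: cos_ge0_pihalf; rewrite y2; apply/andP; split; lra.
rewrite sin_mulr2n siny.
have : cos y * cos y * y <= cos y * (cos c * y).
  by rewrite -mulrA ler_wpM2l// ler_wpM2r.
have : y <= cos y ^+ 2 *+ 2 * y by rewrite ler_peMl.
by rewrite -/y expr2 !mulr2n; lra.
Qed.

Lemma one_sub_cos_ge x : `|x| <= pi -> x ^+ 2 / 8 <= 1 - cos x.
Proof.
move=> xpi; have -> : x ^+ 2 / 8 = (`|x| / 2 / 2) ^+ 2 *+ 2.
  by rewrite -(real_normK (num_real x)) -mulr_natr; field.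
rewrite -cos_norm -[X in cos X](divfK (_ : 2 != 0 :> R))// mulr_natr.
rewrite cos_mulr2n opprB.
have -> : (1 : R) + (1 - cos (`|x| / 2) ^+ 2 *+ 2) =
    (1 - cos (`|x| / 2) ^+ 2) *+ 2.
  by rewrite mulrnBl mulr2n addrA.
rewrite -sin2cos2 lerMn2r/=; apply: lerXn2r.
- by rewrite nnegrE !divr_ge0.
- rewrite nnegrE; apply: le_trans (sin_ge_half _); first by rewrite !divr_ge0.
  by rewrite divr_ge0//= ler_pM2r.
- by apply: sin_ge_half; rewrite divr_ge0//= ler_pM2r.
Qed.

Lemma polar (z : R[i]%C) :
  exists2 phi : R, 0 <= phi <= 2 * pi & z = circle_pt (cabs z) phi.
Proof.
have pi0 : 0 < (pi : R) by exact: pi_gt0.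
have [->|z0] := eqVneq z 0.
  exists 0; first by apply/andP; split => //; lra.
  by rewrite cabs0 /circle_pt !mul0r.
have r0 : 0 < cabs z by rewrite cabs_gt0.
have := cabs_sqr z; have := Re_le_cabs z.
case: z z0 r0 => x y z0; set r := cabs _ => r0 /= xr hr.
have xr1 : -1 <= x / r <= 1.
  by rewrite -ler_norml normrM normfV (gtr0_norm r0) ler_pdivrMr// mul1r.
have sE : r * sin (acos (x / r)) = `|y|.
  rewrite sin_acos// -{1}(gtr0_norm r0) -sqrtr_sqr -sqrtrM ?sqr_ge0//.
  rewrite -[RHS]sqrtr_sqr; congr (Num.sqrt _).
  rewrite expr_div_n mulrBr mulr1 mulrCA divff ?mulr1 ?expf_neq0 ?gt_eqF//.
  by rewrite hr; ring.
have cE : r * cos (acos (x / r)) = x.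
  by rewrite acosK// mulrCA divff ?mulr1// gt_eqF.
have a0 := acos_ge0 xr1; have a1 := acos_lepi xr1.
have [y0|y0] := leP 0 y.
  exists (acos (x / r)); first by apply/andP; split => //; lra.
  by rewrite /circle_pt cE sE ger0_norm.
exists (pi *+ 2 - acos (x / r)).
  by rewrite -mulr_natl; apply/andP; split; lra.
rewrite /circle_pt addrC cosD2pi sinD2pi cosN sinN cE mulrN sE.
by rewrite ltr0_norm// opprK.
Qed.

End kernel_integrals.

(** * Integrals over a circle *)

Section circle_integrals.
Context {R : realType}.
Implicit Types (f g : R -> R).

Definition circle_integral f : \bar R :=
  (\int[lebesgue_measure]_(t in `[0%R, (2 * pi)%R]) (f t)%:E)%E.

Lemma circle_integral_le f g : measurable_fun setT f -> measurable_fun setT g ->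
  (forall t, 0 <= f t) -> (forall t, 0 <= t <= 2 * pi -> f t <= g t) ->
  (circle_integral f <= circle_integral g)%E.
Proof.
move=> mf mg f0 fg; apply: ge0_le_integral => //=.
- by move=> t _; rewrite lee_fin.
- exact/measurable_EFinP/measurable_funTS.
- exact/measurable_EFinP/measurable_funTS.
Qed.

Lemma circle_integralZ f k : measurable_fun setT f -> (forall t, 0 <= f t) ->
  0 <= k -> circle_integral (fun t => k * f t) = (k%:E * circle_integral f)%E.
Proof.
move=> mf f0 k0; rewrite /circle_integral.
under eq_integral do rewrite EFinM.
rewrite ge0_integralZl_EFin//; first by move=> t _; rewrite lee_fin.
exact/measurable_EFinP/measurable_funTS.
Qed.

Lemma measurable_sum_cond (I : Type) (s : seq I) (P : pred I) (F : I -> R -> R) :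
  (forall i, P i -> measurable_fun setT (F i)) ->
  measurable_fun setT (fun t => \sum_(i <- s | P i) F i t).
Proof.
move=> mF; rewrite (_ : (fun t => _) =
    (fun t => \sum_(i <- s) (if P i then F i t else 0))); last first.
  by apply/funext => t; exact: big_mkcond.
apply: measurable_sum => i; have := mF i; case: (P i) => [|_].
  exact.
exact: measurable_cst.
Qed.

Lemma circle_integral_sum (I : Type) (s : seq I) (P : pred I) (F : I -> R -> R) :
  (forall i, P i -> measurable_fun setT (F i)) ->
  (forall i t, P i -> 0 <= F i t) ->
  circle_integral (fun t => \sum_(i <- s | P i) F i t) =
  (\sum_(i <- s | P i) circle_integral (F i))%E.
Proof.
move=> mF F0; elim: s => [|i s IH].
  rewrite big_nil /circle_integral.
  by under eq_integral do rewrite big_nil; rewrite integral0.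
rewrite big_cons -IH; case: ifPn => Pi; last first.
  by rewrite /circle_integral; under eq_integral do rewrite big_cons (negPf Pi).
rewrite /circle_integral.
under eq_integral do rewrite big_cons Pi EFinD.
rewrite ge0_integralD//.
- by move=> t _; rewrite lee_fin F0.
- by apply/measurable_EFinP/measurable_funTS; exact: mF.
- by move=> t _; rewrite lee_fin sumr_ge0// => j; exact: F0.
by apply/measurable_EFinP/measurable_funTS; exact: measurable_sum_cond.
Qed.

End circle_integrals.

Section szego_kernel.
Context {R : realType}.
Implicit Types (q s r t x phi rho : R) (c : R[i]%C).

Lemma sqr_den_circle rho phi r t :
  cabs (1 - (circle_pt rho phi)^* * circle_pt r t) ^+ 2 =
  (1 - rho * r) ^+ 2 + 2 * (rho * r) * (1 - cos (t - phi)).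
Proof.
rewrite cabs_sqr /= cosB; have := cos2Dsin2 t; have := cos2Dsin2 phi.
move: (cos t) (sin t) (cos phi) (sin phi) => a b c d h1 h2.
transitivity (1 - 2 * (rho * r) * (a * c + b * d) +
   (rho * r) ^+ 2 * ((c ^+ 2 + d ^+ 2) * (a ^+ 2 + b ^+ 2))); first by ring.
by rewrite h1 h2; ring.
Qed.

(** For [c] of modulus [rho], the number [1 - rho r] is the minimum of
    [|1 - c^* z|] over the circle, and [|x|] is the angular distance to [c], the
    angle being reduced modulo [2 pi]. *)
Lemma den_circle_ge rho phi r t x : 0 <= rho <= 1 -> 0 <= r <= 1 ->
  `|x| <= pi -> cos x = cos (t - phi) ->
  (1 - rho * r) + `|x| <= 5 * cabs (1 - (circle_pt rho phi)^* * circle_pt r t).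
Proof.
move=> /andP[rho0 rho1] /andP[r0 r1] xpi cx.
have := sqr_den_circle rho phi r t; rewrite -cx.
set Dn := cabs _; have Dn0 : 0 <= Dn by exact: cabs_ge0.
have u0 : 0 <= rho * r by rewrite mulr_ge0.
have u1 : rho * r <= 1 by rewrite mulr_ile1.
move: (rho * r) u0 u1 => u u0 u1 DE.
have c0 : 0 <= 1 - cos x by rewrite subr_ge0 cos_le1.
have c2 : 1 - cos x <= 2 by have := cos_geN1 x; lra.
have cge := one_sub_cos_ge xpi.
have h1 : 1 - u <= Dn.
  rewrite -(@ler_pXn2r _ 2) ?nnegrE ?subr_ge0// DE lerDl mulr_ge0// mulr_ge0//.
have h2 : `|x| / 4 <= Dn.
  rewrite -(@ler_pXn2r _ 2) ?nnegrE ?divr_ge0// DE expr_div_n.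
  rewrite real_normK ?num_real//.
  move: (1 - cos x) c0 c2 cge => k k0 k2 cge.
  (* With k = 1 - cos x in [0, 2], the squared modulus (1 - u)^2 + 2 u k is
     k / 2 plus the two nonnegative quantities below. *)
  have p1 : 0 <= (1 - k / 2) * (1 - u) ^+ 2 by rewrite mulr_ge0 ?sqr_ge0//; lra.
  have p2 : 0 <= k / 2 * (u ^+ 2 + 2 * u).
    by rewrite mulr_ge0 ?addr_ge0 ?sqr_ge0 ?mulr_ge0//; lra.
  lra.
by lra.
Qed.

Lemma measurable_den_powR c s r : cabs c < 1 -> 0 < r ->
  measurable_fun setT (fun t : R => cabs (1 - c^* * circle_pt r t) `^ s).
Proof.
move=> c1 r0; apply: (measurableT_comp (@measurable_powR R s)).
apply: continuous_measurable_fun.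
apply: (@lipschitz_continuous _ _ (2 * r)) => x y.
have := circle_pt_lip r x y; rewrite (gtr0_norm r0); apply: le_trans.
set z := circle_pt r x; set w := circle_pt r y.
apply: (@le_trans _ _ (cabs ((1 - c^* * w) - (1 - c^* * z)))).
  exact: cabs_dist.
rewrite (_ : _ - _ = c^* * (z - w)); last by ring.
by rewrite cabsM cabsJ (cabs_distC z) ler_piMl ?cabs_ge0// ltW.
Qed.

(** After [den_circle_ge] only powers of [e + |t - x|] remain to be integrated,
    [x] being one of the three translates of the argument of [c] by multiples of
    [2 pi] that can come within [pi] of a point of the period. *)
Lemma szego_integral q : 1 < q -> exists2 K : R, 0 < K &
  forall c r, cabs c < 1 -> 0 < r < 1 ->
  (circle_integral (fun t => cabs (1 - c^* * circle_pt r t) `^ (- q))%R <=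
   (K * (1 - cabs c * r) `^ (1 - q))%:E)%E.
Proof.
move=> q1; have q0 : 0 < q := lt_trans ltr01 q1.
have K0 : 0 < 5 `^ q * (3 * (2 / (q - 1)) : R).
  by rewrite mulr_gt0 ?powR_gt0// mulr_gt0// divr_gt0// subr_gt0.
exists (5 `^ q * (3 * (2 / (q - 1)))) => // c r c1 /andP[r0 r1].
have [phi /andP[phi0 phi1] cE] := polar c.
set rho := cabs c in c1 cE *.
have rho0 : 0 <= rho by exact: cabs_ge0.
pose e : R := 1 - rho * r.
have e0 : 0 < e.
  by rewrite subr_gt0 mulr_ilt1// ltW.
pose F (i : 'I_3) (t : R) : R :=
  (e + `|t - (phi + (i%:R - 1) * (2 * pi))|) `^ (- q).
have F0 i t : 0 <= F i t by exact: powR_ge0.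
have pt t : 0 <= t <= 2 * pi ->
    cabs (1 - c^* * circle_pt r t) `^ (- q) <= 5 `^ q * \sum_i F i t.
  move=> /andP[t0 t2].
  have [i [hi ci]] : exists i : 'I_3,
      `|t - (phi + (i%:R - 1) * (2 * pi))| <= pi /\
      cos (t - (phi + (i%:R - 1) * (2 * pi))) = cos (t - phi).
    have [h1|h1] := leP (t - phi) (- pi).
      exists ord0; rewrite (_ : _ - (_ + _) = t - phi + pi *+ 2); last first.
        by rewrite -[pi *+ 2]mulr_natr /=; ring.
      split; last by rewrite cosD2pi.
      rewrite -[pi *+ 2]mulr_natr ler_norml; apply/andP; split; lra.
    have [h2|h2] := leP (t - phi) pi.
      exists (lift ord0 ord0); rewrite (_ : _ - (_ + _) = t - phi); last first.
        by rewrite /= /bump /=; ring.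
      by split => //; rewrite ler_norml h2 andbT ltW.
    exists ord_max; rewrite (_ : _ - (_ + _) = t - phi - pi *+ 2); last first.
      by rewrite -[pi *+ 2]mulr_natr /=; ring.
    split; last by rewrite -[in RHS](subrK (pi *+ 2) (t - phi)) cosD2pi.
    by rewrite -[pi *+ 2]mulr_natr ler_norml; apply/andP; split; lra.
  have := @den_circle_ge rho phi r t _ _ _ hi ci.
  rewrite rho0 (ltW c1) (ltW r0) (ltW r1) -cE -/e => /(_ isT isT).
  set Dn := cabs _; set y := `|_| => h.
  have ey0 : 0 < e + y by rewrite ltr_wpDr// normr_ge0.
  have D0 : 0 < Dn by rewrite -(@pmulr_rgt0 _ 5)// (lt_le_trans ey0).
  apply: (@le_trans _ _ (5 `^ q * F i t)); last first.
    rewrite ler_wpM2l ?powR_ge0// (bigD1 i)//= lerDl.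
    by apply: sumr_ge0 => j _; exact: F0.
  rewrite /F -/y !powRN ler_pdivlMr ?powR_gt0// mulrC ler_pdivrMr ?powR_gt0//.
  rewrite -(powRM q (ler0n _ 5) (ltW D0)).
  by rewrite ge0_ler_powR ?nnegrE ?(ltW q0) ?(ltW ey0) ?mulr_ge0 ?(ltW D0).
have mF (i : 'I_3) : measurable_fun setT (F i) by exact: measurable_dist_powR.
have mden := @measurable_den_powR c (- q) r c1 r0.
have msF : measurable_fun setT (fun t => \sum_i F i t).
  exact: measurable_sum.
apply: le_trans (circle_integral_le mden _ _ pt) _.
- exact: measurable_funM.
- by move=> t; exact: powR_ge0.
rewrite circle_integralZ ?powR_ge0//; last first.
  by move=> t; apply: sumr_ge0 => i _; exact: F0.
rewrite circle_integral_sum; [|by []|by []].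
rewrite -mulrA EFinM lee_wpmul2l ?lee_fin ?powR_ge0//.
apply: (@le_trans _ _ (\sum_(i < 3) (2 / (q - 1) * e `^ (1 - q))%:E)%E).
  by apply: lee_sum => i _; exact: integral_kernel_le.
rewrite sumEFin lee_fin sumr_const card_ord -/e.
by rewrite -[X in X <= _](mulr_natr _ 3) le_eqVlt; apply/orP; left; apply/eqP; ring.
Qed.

End szego_kernel.

(** * Upper bounds *)

Section mean_upper_bounds.
Context {R : realType}.
Implicit Types (p r t : R) (D : set nat) (a : nat -> R[i]%C).

(** Since [p <= 1], a fraction of the sum at most [1] does not exceed its own
    [p]-th power, and the fractions [x / (x + y)] and [y / (x + y)] add up to
    [1]. *)
Lemma powRD_le (x y p : R) : 0 < p <= 1 -> 0 <= x -> 0 <= y ->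
  (x + y) `^ p <= x `^ p + y `^ p.
Proof.
move=> /andP[p0 p1] x0 y0.
have [s0|] := ltP 0 (x + y); last first.
  move=> s0; have -> : x = 0 by lra.
  have -> : y = 0 by lra.
  by rewrite addr0 powR0 ?gt_eqF// addr0.
have key u : 0 <= u -> u <= x + y -> u / (x + y) * (x + y) `^ p <= u `^ p.
  rewrite le_eqVlt => /predU1P[<-|u0] us; first by rewrite !mul0r powR_ge0.
  rewrite -{2}(divfK (lt0r_neq0 s0) u) powRM ?divr_ge0 ?(ltW s0) ?(ltW u0)//.
  rewrite ler_wpM2r ?powR_ge0// ger1_powR// divr_gt0//=.
  by rewrite ler_pdivrMr// mul1r.
have hx := key x x0; have hy := key y y0; rewrite lerDl lerDr in hx hy.
apply: le_trans (lerD (hx y0) (hy x0)); rewrite -mulrDl -mulrDl divff ?mul1r//.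
exact: lt0r_neq0.
Qed.

Lemma powR_sum_le (I : Type) (s : seq I) (P : pred I) (x : I -> R) p :
  0 < p <= 1 -> (forall i, P i -> 0 <= x i) ->
  (\sum_(i <- s | P i) x i) `^ p <= \sum_(i <- s | P i) x i `^ p.
Proof.
move=> p01 x0; elim: s => [|i s IH].
  by rewrite !big_nil powR0// gt_eqF//; case/andP: p01.
rewrite !big_cons; case: ifPn => // Pi.
apply: le_trans (powRD_le p01 (x0 _ Pi) _) _; first exact: sumr_ge0.
by rewrite lerD2l.
Qed.

(** For [p <= 1] the [p]-th power is subadditive, so the factors are integrated
    one by one with the kernel exponent [2 p], which exceeds [1]. *)
Lemma partial_mean_le1 p : 2^-1 < p -> p <= 1 -> exists2 K : R, 0 < K &
  forall D a gam N r, (forall n, D n -> cabs (a n) < 1) -> cabs gam = 1 ->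
  0 < r < 1 ->
  (partial_mean D a gam p r N <=
   (K * \sum_(k < N | (k : nat) \in D)
     (1 - cabs (a k)) `^ p * (1 - cabs (a k) * r) `^ (1 - 2 * p))%:E)%E.
Proof.
move=> p2 p1; have p0 : 0 < p by lra.
have [|K K0 hK] := @szego_integral R (2 * p); first by lra.
exists (2 `^ p * K); first by rewrite mulr_gt0// powR_gt0.
move=> D a gam N r ha hgam r01; have /andP[r0 r1] := r01.
pose F (k : 'I_N) t : R := (2 `^ p * (1 - cabs (a k)) `^ p) *
   cabs (1 - (a k)^* * circle_pt r t) `^ (- (2 * p)).
have F0 k t : 0 <= F k t by rewrite !mulr_ge0 ?powR_ge0.
have mden (k : 'I_N) : (k : nat) \in D ->
  measurable_fun setT (fun t : R =>
    cabs (1 - (a k)^* * circle_pt r t) `^ (- (2 * p))).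
  by move=> /set_mem /ha ak; exact: measurable_den_powR.
have mF (k : 'I_N) : (k : nat) \in D -> measurable_fun setT (F k).
  by move=> kD; apply: measurable_funM => //; exact: mden.
have msF : measurable_fun setT (fun t => \sum_(k < N | (k : nat) \in D) F k t).
  exact: measurable_sum_cond.
apply: le_trans (circle_integral_le
  (measurable_dbprod_powR N p ha hgam r01) msF _ _) _.
- by move=> t; exact: powR_ge0.
- move=> t _; set z := circle_pt r t.
  have z1 : cabs z < 1 by rewrite cabs_circle_pt gtr0_norm.
  apply: (@le_trans _ _ ((\sum_(k < N) cabs (dfac D a k z)) `^ p)).
    rewrite ge0_ler_powR ?(ltW p0)// ?nnegrE ?cabs_ge0 ?sumr_ge0//.
      by move=> k _; exact: cabs_ge0.
    exact: cabs_dbprod_le_sum.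
  apply: le_trans (powR_sum_le _ _ _) _; first by rewrite p0.
    by move=> k _; exact: cabs_ge0.
  rewrite [leRHS]big_mkcond; apply: ler_sum => k _.
  have := cabs_dfac_le ha k z1; rewrite /defect /dfac.
  case: ifPn => [/set_mem /ha ak h|_ _]; last by rewrite cabs0 powR0 ?gt_eqF.
  have d0 : 0 <= 1 - cabs (a k) by rewrite subr_ge0 ltW.
  have D0 : 0 < cabs (1 - (a k)^* * z).
    by rewrite cabs_gt0; apply: den_neq0 => //; exact: ltW.
  apply: (@le_trans _ _
      ((2 * (1 - cabs (a k)) / cabs (1 - (a k)^* * z) ^+ 2) `^ p)).
    rewrite ge0_ler_powR ?(ltW p0)// ?nnegrE ?cabs_ge0//.
    by rewrite divr_ge0 ?sqr_ge0// mulr_ge0.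
  rewrite /F powRM ?invr_ge0 ?sqr_ge0 ?(mulr_ge0 (ler0n _ 2) d0)// powRM//.
  rewrite powRN powRrM powR_mulrn ?(ltW D0)//.
  by rewrite -powR_inv1 ?sqr_ge0// -powRrM mulN1r powRN.
rewrite circle_integral_sum//.
rewrite big_distrr/= -sumEFin; apply: lee_sum => k kD.
rewrite (circle_integralZ (mden _ kD)); last 2 first.
  by move=> t; exact: powR_ge0.
  by rewrite mulr_ge0 ?powR_ge0.
have ak : cabs (a k) < 1 by apply: ha; exact: set_mem.
have := hK (a k) r ak r01.
move=> /(lee_wpmul2l (_ : (0 <= (2 `^ p * (1 - cabs (a k)) `^ p)%:E)%E)).
rewrite lee_fin mulr_ge0 ?powR_ge0// => /(_ isT) h; apply: (le_trans h).
by rewrite -EFinM lee_fin le_eqVlt; apply/orP; left; apply/eqP; ring.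
Qed.

(** For [p > 1] the power [p - 1] of the derivative is bounded by Schwarz-Pick and
    only the remaining first power is split into factors, whose kernel exponent
    is [2]. *)
Lemma partial_mean_gt1 p : 1 < p -> exists2 K : R, 0 < K &
  forall D a gam N r, (forall n, D n -> cabs (a n) < 1) -> cabs gam = 1 ->
  0 < r < 1 ->
  (partial_mean D a gam p r N <=
   (K * \sum_(k < N | (k : nat) \in D)
     (1 - r) `^ (1 - p) * ((1 - cabs (a k)) / (1 - cabs (a k) * r)))%:E)%E.
Proof.
move=> p1; have p0 : 0 < p by lra.
have [|K K0 hK] := @szego_integral R 2; first by lra.
pose M : R := 2 `^ (p - 1) * 2 * K.
exists M; first by rewrite !mulr_gt0// powR_gt0.
move=> D a gam N r ha hgam r01; have /andP[r0 r1] := r01.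
have r10 : 0 < 1 - r by rewrite subr_gt0.
pose G : R := (2 / (1 - r)) `^ (p - 1).
pose F (k : 'I_N) t : R := (G * (2 * (1 - cabs (a k)))) *
   cabs (1 - (a k)^* * circle_pt r t) `^ (- 2).
have d0 k : (k : nat) \in D -> 0 <= 1 - cabs (a k).
  by move=> /set_mem /ha /ltW; rewrite subr_ge0.
have F0 (k : 'I_N) t : (k : nat) \in D -> 0 <= F k t.
  by move=> /d0 dk; rewrite !mulr_ge0 ?powR_ge0.
have mden (k : 'I_N) : (k : nat) \in D ->
  measurable_fun setT (fun t : R =>
    cabs (1 - (a k)^* * circle_pt r t) `^ (- 2)).
  by move=> /set_mem /ha ak; exact: measurable_den_powR.
have mF (k : 'I_N) : (k : nat) \in D -> measurable_fun setT (F k).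
  by move=> kD; apply: measurable_funM => //; exact: mden.
have msF : measurable_fun setT (fun t => \sum_(k < N | (k : nat) \in D) F k t).
  exact: measurable_sum_cond.
apply: le_trans (circle_integral_le
  (measurable_dbprod_powR N p ha hgam r01) msF _ _) _.
- by move=> t; exact: powR_ge0.
- move=> t _; set z := circle_pt r t.
  have zr : cabs z <= r by rewrite cabs_circle_pt gtr0_norm.
  have z1 : cabs z < 1 := le_lt_trans zr r1.
  have hs := cabs_dbprod_le_sum ha hgam N z1.
  have hr := cabs_dbprod_le ha hgam N r1 zr.
  rewrite -mulr_powRB1 ?cabs_ge0// mulrC.
  apply: (@le_trans _ _ (G * \sum_(k < N) cabs (dfac D a k z))).
    apply: ler_pM => //; rewrite ?powR_ge0 ?cabs_ge0//.
    rewrite ge0_ler_powR ?nnegrE ?cabs_ge0//; first by rewrite subr_ge0 ltW.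
    by rewrite divr_ge0// ltW.
  rewrite big_distrr/= [leRHS]big_mkcond; apply: ler_sum => k _.
  have := cabs_dfac_le ha k z1; rewrite /defect /dfac.
  case: ifPn => [/set_mem /ha ak h|_ _]; last by rewrite cabs0 mulr0.
  rewrite /F -mulrA ler_wpM2l ?powR_ge0// (le_trans h)//.
  by rewrite powR_invn ?cabs_ge0.
rewrite circle_integral_sum//.
rewrite big_distrr/= -sumEFin; apply: lee_sum => k kD.
rewrite (circle_integralZ (mden _ kD)); last 2 first.
  by move=> t; exact: powR_ge0.
  by rewrite !mulr_ge0 ?powR_ge0 ?d0.
have ak : cabs (a k) < 1 by apply: ha; exact: set_mem.
have := hK (a k) r ak r01.
move=> /(lee_wpmul2l (_ : (0 <= (G * (2 * (1 - cabs (a k))))%:E)%E)).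
rewrite lee_fin !mulr_ge0 ?powR_ge0 ?d0// => /(_ isT) h; apply: (le_trans h).
have ar0 : 0 < 1 - cabs (a k) * r.
  by rewrite subr_gt0 mulr_ilt1 ?cabs_ge0// ltW.
rewrite -EFinM lee_fin (_ : 1 - 2 = -1); last by ring.
rewrite powR_inv1 ?(ltW ar0)// /G powRM ?invr_ge0 ?(ltW r10)//.
rewrite -[(1 - r)^-1]powR_inv1 ?(ltW r10)// -powRrM mulN1r opprB /M.
by rewrite le_eqVlt; apply/orP; left; apply/eqP; ring.
Qed.

End mean_upper_bounds.

Section weighted_upper_bounds.
Context {R : realType}.
Variables (w : R -> R) (p : R).
Hypothesis hw : normal_weight w.
Hypothesis hwc : comparable_to_1_on_compacts w.
Hypothesis p0 : 0 < p.

Let w0 r : 0 <= r < 1 -> 0 <= w r.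
Proof. by case: hw => _ + _; exact. Qed.

(** A bound for the finite products that is uniform in [N] and in [r] passes to
    the limit for each [r], and then to the supremum. *)
Lemma weighted_sup_le (W : R -> R) (c : R) (D : set nat) (a : nat -> R[i]%C)
    (B : R[i]%C -> R[i]%C^o) : 0 < c -> (forall x, 0 <= x < 1 -> 0 <= W x) ->
  (forall gam N r, (forall n, D n -> cabs (a n) < 1) -> cabs gam = 1 ->
    2^-1 < r < 1 ->
    ((w r * (1 - r))%:E * partial_mean D a gam p r N <=
     (c * \sum_(k < N | (k : nat) \in D) W (cabs (a k)))%:E)%E) ->
  blaschke_product D a B ->
  (weighted_sup w p B <= c%:E * zero_sum D a W)%E.
Proof.
move=> c0 W0 hc hB; have [gam [ha hgam hcvg]] := blaschke_approximation hB.
apply: ge_ereal_sup => _ [r /= + <-]; rewrite in_itv/= => /andP[r2 r1].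
have r0 : 0 < r by rewrite (lt_trans _ r2)// invr_gt0.
have r01 : 0 < r < 1 by rewrite r0.
have cv := cvgeZl (isT : (w r * (1 - r))%:E \is a fin_num) (hcvg p r p0 r01).
rewrite -(cvg_lim _ cv)//; apply: lime_le; first exact: cvgP cv.
apply: nearW => N; apply: le_trans (hc gam N r ha hgam _) _; first by rewrite r2.
rewrite EFinM lee_wpmul2l ?lee_fin ?(ltW c0)//.
by apply: partial_le_zero_sum => n /ha an; rewrite W0// cabs_ge0.
Qed.

Section one_factor.
Variable L : R -> R.
Hypothesis L1 : forall x, 1 <= L x.

(** The contribution of a zero of modulus [x] to the mean over the circle of
    radius [r]. Up to constants and [L], it is at most its value at
    [r = x]: for [r <= x] the denominator [1 - x r] is replaced by [1 - r] and the
    upper comparison of [w] applies, for [x <= r] it is replaced by [1 - x] and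
    the lower one applies. The factor [L] stands for [1], or for the logarithm of
    the critical case. *)
Lemma weight_factor_le1 C1 C2 : p <= 1 -> 2^-1 < p -> 0 < C1 -> 0 < C2 ->
  (forall x y, 0 <= x -> x <= y -> y < 1 ->
    over_power w (2 * p - 2) x <= C1 * (over_power w (2 * p - 2) y * L y)) ->
  (forall x y, 0 <= x -> x <= y -> y < 1 ->
    over_power w (-1) y <= C2 * over_power w (-1) x) ->
  forall r x, 0 <= r < 1 -> 0 <= x < 1 ->
    w r * (1 - r) * ((1 - x) `^ p * (1 - x * r) `^ (1 - 2 * p)) <=
    (C1 + C2) * ((1 - x) `^ (2 - p) * w x * L x).
Proof.
move=> p1 p2 C10 C20 h1 h2 r x /andP[r0 r1] /andP[x0 x1].
have wx : 0 <= w x by rewrite w0// x0.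
have wr : 0 <= w r by rewrite w0// r0.
have L0 : 0 <= L x := le_trans ler01 (L1 x).
have r10 : 0 < 1 - r by rewrite subr_gt0.
have x10 : 0 < 1 - x by rewrite subr_gt0.
have xr0 : 0 < 1 - x * r by rewrite subr_gt0 mulr_ilt1.
have W0 : 0 <= (1 - x) `^ (2 - p) * w x * L x by rewrite !mulr_ge0 ?powR_ge0.
have anti (u v : R) : 0 < u -> u <= v -> v `^ (1 - 2 * p) <= u `^ (1 - 2 * p).
  move=> u0 uv; have v0 : 0 < v := lt_le_trans u0 uv.
  rewrite -(opprB (2 * p) 1) !powRN lef_pV2 ?posrE ?powR_gt0//.
  by rewrite ge0_ler_powR ?nnegrE ?(ltW u0) ?(ltW v0)//; lra.
have [rx|/ltW xr] := leP r x.
  apply: (@le_trans _ _ (C1 * ((1 - x) `^ (2 - p) * w x * L x))); last first.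
    by rewrite ler_wpM2r// lerDl ltW.
  have := h1 _ _ r0 rx x1; rewrite /over_power => h.
  have hx : (1 - x * r) `^ (1 - 2 * p) <= (1 - r) `^ (1 - 2 * p).
    by apply: anti => //; rewrite lerD2l lerN2 ler_piMl// ltW.
  apply: (@le_trans _ _ (w r * (1 - r) * ((1 - x) `^ p * (1 - r) `^ (1 - 2 * p)))).
    rewrite ler_wpM2l ?(mulr_ge0 wr (ltW r10))//.
    by rewrite ler_wpM2l ?powR_ge0.
  have -> : w r * (1 - r) * ((1 - x) `^ p * (1 - r) `^ (1 - 2 * p)) =
      (1 - x) `^ p * (w r / (1 - r) `^ (2 * p - 2)).
    rewrite -powRN (_ : - (2 * p - 2) = 1 + (1 - 2 * p)); last by ring.
    rewrite (@powRD _ _ 1 (1 - 2 * p)) ?(gt_eqF r10) ?implybT// powRr1 ?(ltW r10)//.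
    by ring.
  apply: le_trans (ler_wpM2l (powR_ge0 _ _) h) _.
  rewrite (_ : 2 - p = p - (2 * p - 2)); last by ring.
  rewrite (@powRB _ _ p (2 * p - 2)) ?(gt_eqF x10) ?implybT//.
  by rewrite le_eqVlt; apply/orP; left; apply/eqP; ring.
apply: (@le_trans _ _ (C2 * ((1 - x) `^ (2 - p) * w x * L x))); last first.
  by rewrite ler_wpM2r// lerDr ltW.
have := h2 _ _ x0 xr r1; rewrite /over_power !powR_inv1 ?(ltW x10) ?(ltW r10)//.
rewrite !invrK => h.
have hx : (1 - x * r) `^ (1 - 2 * p) <= (1 - x) `^ (1 - 2 * p).
  by apply: anti => //; rewrite lerD2l lerN2 ler_piMr// ltW.
apply: (@le_trans _ _
    (C2 * (w x * (1 - x)) * ((1 - x) `^ p * (1 - x) `^ (1 - 2 * p)))).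
  apply: ler_pM => //; rewrite ?mulr_ge0 ?powR_ge0 ?(ltW r10)//.
  by rewrite ler_wpM2l ?powR_ge0.
rewrite -mulrA ler_wpM2l ?(ltW C20)//.
apply: (@le_trans _ _ ((1 - x) `^ (2 - p) * w x)); last first.
  by rewrite ler_peMr ?mulr_ge0 ?powR_ge0.
rewrite (_ : 2 - p = 1 + (p + (1 - 2 * p))); last by ring.
rewrite (@powRD _ _ 1 (p + (1 - 2 * p))) ?(gt_eqF x10) ?implybT//.
rewrite powRr1 ?(ltW x10)//.
rewrite (@powRD _ _ p (1 - 2 * p)) ?(gt_eqF x10) ?implybT//.
by rewrite le_eqVlt; apply/orP; left; apply/eqP; ring.
Qed.

(** The same dichotomy as in [weight_factor_le1]; here
    [(1 - x) / (1 - x r)] is bounded by [(1 - x) / (1 - r)] when [r <= x], and by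
    [1] otherwise. *)
Lemma weight_factor_gt1 C1 C2 : 1 < p -> 0 < C1 -> 0 < C2 ->
  (forall x y, 0 <= x -> x <= y -> y < 1 ->
    over_power w (p - 1) x <= C1 * (over_power w (p - 1) y * L y)) ->
  (forall x y, 0 <= x -> x <= y -> y < 1 ->
    over_power w (p - 2) y <= C2 * over_power w (p - 2) x) ->
  forall r x, 0 <= r < 1 -> 0 <= x < 1 ->
    w r * (1 - r) * ((1 - r) `^ (1 - p) * ((1 - x) / (1 - x * r))) <=
    (C1 + C2) * ((1 - x) `^ (2 - p) * w x * L x).
Proof.
move=> p1 C10 C20 h1 h2 r x /andP[r0 r1] /andP[x0 x1].
have wx : 0 <= w x by rewrite w0// x0.
have wr : 0 <= w r by rewrite w0// r0.
have L0 : 0 <= L x := le_trans ler01 (L1 x).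
have r10 : 0 < 1 - r by rewrite subr_gt0.
have x10 : 0 < 1 - x by rewrite subr_gt0.
have xr0 : 0 < 1 - x * r by rewrite subr_gt0 mulr_ilt1.
have W0 : 0 <= (1 - x) `^ (2 - p) * w x * L x by rewrite !mulr_ge0 ?powR_ge0.
have A0 : 0 <= w r * (1 - r) * (1 - r) `^ (1 - p).
  by rewrite !mulr_ge0 ?powR_ge0// ltW.
have [rx|/ltW xr] := leP r x.
  apply: (@le_trans _ _ (C1 * ((1 - x) `^ (2 - p) * w x * L x))); last first.
    by rewrite ler_wpM2r// lerDl ltW.
  have := h1 _ _ r0 rx x1; rewrite /over_power -!powRN !opprB => h.
  apply: (@le_trans _ _ (w r * (1 - r) `^ (1 - p) * (1 - x))).
    have hx : (1 - r) / (1 - x * r) <= 1.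
      by rewrite ler_pdivrMr// mul1r lerD2l lerN2 ler_piMl// ltW.
    have B0 : 0 <= w r * (1 - r) `^ (1 - p) * (1 - x).
      by rewrite !mulr_ge0 ?powR_ge0// ltW.
    apply: (@le_trans _ _ (w r * (1 - r) `^ (1 - p) * (1 - x) *
      ((1 - r) / (1 - x * r)))); last by rewrite ler_piMr.
    by rewrite le_eqVlt; apply/orP; left; apply/eqP; ring.
  apply: le_trans (ler_wpM2r (ltW x10) h) _.
  rewrite (_ : 2 - p = (1 - p) + 1); last by ring.
  rewrite (@powRD _ _ (1 - p) 1) ?(gt_eqF x10) ?implybT// powRr1 ?(ltW x10)//.
  by rewrite le_eqVlt; apply/orP; left; apply/eqP; ring.
apply: (@le_trans _ _ (C2 * ((1 - x) `^ (2 - p) * w x * L x))); last first.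
  by rewrite ler_wpM2r// lerDr ltW.
have := h2 _ _ x0 xr r1; rewrite /over_power -!powRN !opprB => h.
have hx : (1 - x) / (1 - x * r) <= 1.
  by rewrite ler_pdivrMr// mul1r lerD2l lerN2 ler_piMr// ltW.
apply: (@le_trans _ _ (w r * (1 - r) `^ (2 - p))).
  rewrite (_ : 2 - p = 1 + (1 - p)); last by ring.
  rewrite (@powRD _ _ 1 (1 - p)) ?(gt_eqF r10) ?implybT// powRr1 ?(ltW r10)//.
  rewrite !mulrA -(mulrA _ (1 - x)).
  by rewrite ler_piMr.
apply: (le_trans h); rewrite ler_wpM2l ?(ltW C20)//.
by rewrite [X in X <= _]mulrC ler_peMr ?mulr_ge0 ?powR_ge0.
Qed.

End one_factor.

End weighted_upper_bounds.

Section upper_estimate.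
Context {R : realType}.
Variables (w : R -> R) (p : R).
Hypothesis hw : normal_weight w.
Hypothesis hwc : comparable_to_1_on_compacts w.
Hypothesis p2 : 2^-1 < p.
Variable L : R -> R.
Hypothesis L1 : forall x, 1 <= L x.

Let w0 r : 0 <= r < 1 -> 0 <= w r.
Proof. by case: hw => _ + _; exact. Qed.

Let p0 : 0 < p. Proof. by apply: lt_trans p2; rewrite invr_gt0. Qed.

Let W x : R := (1 - x) `^ (2 - p) * w x * L x.

(** Both ranges of [p] differ only in the bound [M x r] for the contribution of a
    zero of modulus [x]. *)
Let upper_from_factor (M : R -> R -> R) (K C : R) : 0 < K -> 0 < C ->
  (forall (D : set nat) (a : nat -> R[i]%C) gam N r,
    (forall n, D n -> cabs (a n) < 1) -> cabs gam = 1 -> 0 < r < 1 ->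
    (partial_mean D a gam p r N <=
     (K * \sum_(k < N | (k : nat) \in D) M (cabs (a k)) r)%:E)%E) ->
  (forall r x, 0 <= r < 1 -> 0 <= x < 1 -> w r * (1 - r) * M x r <= C * W x) ->
  exists2 c : R, 0 < c &
    forall (D : set nat) (a : nat -> R[i]%C) (B : R[i]%C -> R[i]%C^o),
      blaschke_product D a B ->
      (weighted_sup w p B <= c%:E * zero_sum D a W)%E.
Proof.
move=> K0 C0 hM hW; exists (K * C) => [|D a B]; first exact: mulr_gt0.
apply: weighted_sup_le => //; first exact: mulr_gt0.
  move=> x x01; have L0 : 0 <= L x := le_trans ler01 (L1 x).
  by rewrite !mulr_ge0 ?powR_ge0 ?w0.
move=> gam N r ha hgam /andP[r2 r1].
have r0 : 0 < r by rewrite (lt_trans _ r2)// invr_gt0.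
have v0 : 0 <= w r * (1 - r).
  by rewrite mulr_ge0 ?w0 ?(ltW r0)// subr_ge0 ltW.
apply: (@le_trans _ _ ((w r * (1 - r))%:E *
  (K * \sum_(k < N | (k : nat) \in D) M (cabs (a k)) r)%:E)%E).
  by rewrite lee_wpmul2l ?lee_fin// hM// r0.
rewrite -EFinM lee_fin mulrCA -[leRHS]mulrA ler_wpM2l ?(ltW K0)//.
rewrite !big_distrr/=; apply: ler_sum => k /set_mem /ha ak.
by apply: hW; rewrite ?cabs_ge0// (ltW r0).
Qed.

Lemma upper_bound_le1 : p <= 1 -> -1 < b_index w ->
  (exists2 C : R, 0 < C & forall x y, 0 <= x -> x <= y -> y < 1 ->
    over_power w (2 * p - 2) x <= C * (over_power w (2 * p - 2) y * L y)) ->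
  exists2 c : R, 0 < c &
    forall (D : set nat) (a : nat -> R[i]%C) (B : R[i]%C -> R[i]%C^o),
      blaschke_product D a B ->
      (weighted_sup w p B <= c%:E * zero_sum D a W)%E.
Proof.
move=> p1 hb [C1 C10 h1]; have [C2 C20 h2] := normal_lower hw hwc hb.
have [K K0 hK] := partial_mean_le1 p2 p1.
apply: (@upper_from_factor
  (fun x r => (1 - x) `^ p * (1 - x * r) `^ (1 - 2 * p))
  K (C1 + C2) K0 (addr_gt0 C10 C20)).
  by move=> D a gam N r ha hgam r01; exact: hK.
by move=> r x; exact: weight_factor_le1.
Qed.

Lemma upper_bound_gt1 : 1 < p -> p - 2 < b_index w ->
  (exists2 C : R, 0 < C & forall x y, 0 <= x -> x <= y -> y < 1 ->
    over_power w (p - 1) x <= C * (over_power w (p - 1) y * L y)) ->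
  exists2 c : R, 0 < c &
    forall (D : set nat) (a : nat -> R[i]%C) (B : R[i]%C -> R[i]%C^o),
      blaschke_product D a B ->
      (weighted_sup w p B <= c%:E * zero_sum D a W)%E.
Proof.
move=> p1 hb [C1 C10 h1]; have [C2 C20 h2] := normal_lower hw hwc hb.
have [K K0 hK] := partial_mean_gt1 p1.
apply: (@upper_from_factor
  (fun x r => (1 - r) `^ (1 - p) * ((1 - x) / (1 - x * r)))
  K (C1 + C2) K0 (addr_gt0 C10 C20)).
  by move=> D a gam N r ha hgam r01; exact: hK.
by move=> r x; exact: weight_factor_gt1.
Qed.

End upper_estimate.

(** * Disks around separated zeros *)

Section separated_zeros.
Context {R : realType}.
Variables (D : set nat) (a : nat -> R[i]%C) (gam : R[i]%C) (delta : R).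
Hypothesis ha : forall n, D n -> cabs (a n) < 1.
Hypothesis hgam : cabs gam = 1.
Hypothesis hsep : separated_zeros D a delta.
Implicit Types (z w : R[i]%C) (k n m N : nat).

Let delta0 : 0 < delta. Proof. by case: hsep. Qed.

Let inD k : k \in D -> cabs (a k) < 1.
Proof. by move=> /set_mem; exact: ha. Qed.

Let dist k n : R := cabs ((a k - a n) / (1 - (a k)^* * a n)).

Let dist_ge0 k n : 0 <= dist k n. Proof. exact: cabs_ge0. Qed.

Let dist_le1 k n : k \in D -> D n -> dist k n <= 1.
Proof. by move=> /inD ak /ha /ltW an; exact: moebius_le1. Qed.

(** The partial products of pseudohyperbolic distances decrease to the full
    product, so separation holds for every finite set of zeros. *)
Lemma separation_le_partial n N : D n ->
  delta <= \prod_(k < N | ((k : nat) \in D) && ((k : nat) != n)) dist k n.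
Proof.
move=> Dn; case: hsep => _ <-.
pose u m M := \prod_(k < M | ((k : nat) \in D) && ((k : nat) != m)) dist k m.
have u0 m M : 0 <= u m M by exact: prodr_ge0.
have uD m : D m -> nonincreasing_seq (u m).
  move=> Dm; apply/nonincreasing_seqP => M; rewrite /u big_mkcond big_ord_recr /=.
  rewrite -big_mkcond ler_piMr ?u0//.
  by case: ifPn => // /andP[kD _]; exact: dist_le1.
have ulb m : has_lbound (range (u m)) by exists 0 => _ [M _ <-].
have uC m : D m -> cvgn (u m).
  by move=> /uD um; exact: nonincreasing_is_cvgn um (ulb m).
apply: (@le_trans _ _ (limn (u n))).
  apply: ge_inf; last by exists n.
  exists 0 => _ [m Dm <-]; apply: limr_ge; first exact: uC.
  by apply: nearW => M; exact: u0.
exact: (nonincreasing_cvgn_ge (uD _ Dn) (uC _ Dn)).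
Qed.

Lemma separation_le1 n : D n -> delta <= 1.
Proof. by move=> /(separation_le_partial 0); rewrite big_ord0. Qed.

Lemma separation_le_dist n m : D n -> D m -> n != m -> delta <= dist n m.
Proof.
move=> Dn Dm nm; apply: le_trans (separation_le_partial n.+1 Dm) _.
rewrite big_mkcond big_ord_recr /= -big_mkcond.
rewrite mem_set// nm /= ler_piMl//; apply: prodr_ile1 => k /andP[kD _].
by rewrite dist_ge0 dist_le1.
Qed.

Lemma separation_le_fac n N : D n ->
  delta <= cabs (\prod_(k < N | (k : nat) != n) fac D a k (a n)).
Proof.
move=> Dn; apply: le_trans (separation_le_partial N Dn) _.
rewrite cabs_prod [X in X <= _]big_mkcond [X in _ <= X]big_mkcond.
apply: ler_prod => k _.
case: ifPn => [/andP[kD ->]|].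
  rewrite dist_ge0/= /fac kD blaschke_factorE (cabsM (blaschke_unit _)).
  by rewrite cabs_blaschke_unit mul1r.
rewrite negb_and negbK ler01/= => h; case: ifPn => // kn.
by move: h; rewrite (negPf kn) orbF /fac => /negPf ->; rewrite cabs1.
Qed.

(** The radius of the disks in units of the distance to the circle; it is small
    enough to keep the disks disjoint and to make [dbprod_ge] hold. *)
Let eta : R := delta / 32.
Let d n : R := 1 - cabs (a n).

Let d_gt0 n : D n -> 0 < d n.
Proof. by move=> /ha; rewrite subr_gt0. Qed.

(** Near a zero the product is the factor vanishing there times the product of the
    others, and separation keeps the latter away from zero. On the disk of radius
    [2 eta d] it stays above [delta - 4 eta = 7 delta / 8], while the vanishing
    factor, of size at most [eta], has increments at least [|w - z| / (6 d)]; the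
    increment of the product is thus at least
    [(7 delta / 48 - 2 eta) |w - z| / d = delta / (12 d) |w - z|]. *)
Lemma dbprod_ge n N z : D n -> (n < N)%N -> cabs (z - a n) <= eta * d n ->
  delta / (12 * d n) <= cabs (dbprod D a gam N z).
Proof.
move=> Dn nN zn; have dn0 := d_gt0 Dn; have de1 := separation_le1 Dn.
have eta0 : 0 < eta by rewrite divr_gt0.
have an0 : 0 <= cabs (a n) by exact: cabs_ge0.
have dn1 : d n <= 1 by rewrite gerBl.
have aE : cabs (a n) = 1 - d n by rewrite /d; ring.
pose r : R := 1 - d n / 2.
have r1 : r < 1 by rewrite /r; lra.
have near w : cabs (w - a n) <= 2 * (eta * d n) -> cabs w <= 1 - 3 / 4 * d n.
  move=> wn; have := cabsD (w - a n) (a n); rewrite subrK => h.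
  have : eta * d n <= d n / 32.
    by rewrite mulrC ler_wpM2l ?(ltW dn0)// /eta ler_piMl.
  by lra.
have ed0 : 0 < eta * d n by rewrite mulr_gt0.
have hz : cabs z <= 1 - 3 / 4 * d n by apply: near; lra.
pose G w := \prod_(k < N | (k : nat) != n) fac D a k w.
have PE w : bprod D a gam N w = gam * (fac D a n w * G w).
  by rewrite bprod_fac (bigD1 (Ordinal nN)).
apply: (@cabs_deriv_ge _ (bprod D a gam N) z _ (eta * d n)
  (4 / (1 - r) ^+ 3 * (\sum_(k < N) defect D a k))) => //.
- rewrite mulr_ge0 ?(sum_defect_ge0 ha)// divr_ge0// exprn_ge0//.
  by rewrite subr_ge0 ltW.
- move=> w wz; apply: bprod_remainder => //; rewrite /r.
    by apply: le_trans hz _; lra.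
  apply: le_trans (near w _) _; last lra.
  by have := cabsD (w - z) (z - a n); rewrite addrA subrK; lra.
- move=> w wz.
  have hwn : cabs (w - a n) <= 2 * (eta * d n).
    by have := cabsD (w - z) (z - a n); rewrite addrA subrK; lra.
  have hw := near w hwn.
  have w1 : cabs w < 1 by apply: le_lt_trans hw _; lra.
  have z1 : cabs z < 1 by apply: le_lt_trans hz _; lra.
  have nD : n \in D by rewrite mem_set.
  (* The remaining factors vary slowly, by the two-point Schwarz-Pick bound. *)
  pose K : R := 2 / d n.
  have K0 : 0 <= K by rewrite divr_ge0// ltW.
  have sq (x : R) : 0 <= x -> x <= 1 - 3 / 4 * d n -> d n / 2 <= 1 - x ^+ 2.
    move=> x0 x1; have : x ^+ 2 <= x by rewrite expr2 ler_piMr//; lra.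
    by lra.
  have lipG u v : cabs u <= 1 - 3 / 4 * d n -> cabs v <= 1 - 3 / 4 * d n ->
      cabs (G v - G u) <= K * cabs (v - u).
    move=> hu hv.
    have hK : 1 <= K ^+ 2 * ((1 - cabs u ^+ 2) * (1 - cabs v ^+ 2)).
      apply: (@le_trans _ _ (K ^+ 2 * ((d n / 2) * (d n / 2)))).
        rewrite le_eqVlt; apply/orP; left; apply/eqP.
        by rewrite /K; field; exact: lt0r_neq0.
      rewrite ler_wpM2l ?sqr_ge0// ler_pM ?divr_ge0 ?(ltW dn0)//.
        by apply: sq => //; exact: cabs_ge0.
      by apply: sq => //; exact: cabs_ge0.
    have u1 : cabs u < 1 by apply: le_lt_trans hu _; lra.
    have v1 : cabs v < 1 by apply: le_lt_trans hv _; lra.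
    have [g1 g2 g3] := schwarz_pick_prod ha (fun k => k != n) N u1 v1 K0 hK.
    apply: (le_trans g3); apply: ler_piMr.
      by rewrite mulr_ge0 ?cabs_ge0.
    by rewrite gerBl mulr_ge0 ?cabs_ge0.
  have anh : cabs (a n) <= 1 - 3 / 4 * d n by rewrite aE; lra.
  have Gw : delta - 4 * eta <= cabs (G w).
    have := lipG _ _ hw anh; have := separation_le_fac N Dn.
    rewrite -/(G _) => h1 h2.
    have h3 := cabs_subr_ge (G (a n)) (G w).
    have : K * cabs (a n - w) <= 4 * eta.
      rewrite cabs_distC; apply: le_trans (ler_wpM2l K0 hwn) _.
      rewrite le_eqVlt; apply/orP; left; apply/eqP.
        by rewrite /K; field; exact: lt0r_neq0.
    by rewrite -/(G _) in h1; lra.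
  have Gl := lipG _ _ hz hw.
  (* The factor vanishing at a n is small but varies fast. *)
  have Fz : cabs (fac D a n z) <= eta.
    rewrite /fac nD blaschke_factorE cabsM cabs_blaschke_unit mul1r.
    rewrite /moebius cabsM cabsV cabs_distC ler_pdivrMr; last first.
      by rewrite cabs_gt0; apply: den_neq0 => //; [exact: ha|exact: ltW].
    apply: (le_trans zn); rewrite ler_wpM2l ?(ltW eta0)//.
    by apply: cabs_den_ge_c; exact: ltW.
  have den_le u : cabs (u - a n) <= d n / 4 ->
      cabs (1 - (a n)^* * u) <= 9 / 4 * d n.
    move=> ua; have -> : 1 - (a n)^* * u =
      (1 - a n * (a n)^*) - (a n)^* * (u - a n) by ring.
    apply: le_trans (cabsB _ _) _.
    rewrite cabs_1Bsqr; last by apply: ltW; exact: ha.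
    have := one_sub_sqr_le an0; rewrite cabsM cabsJ.
    have : cabs (a n) * cabs (u - a n) <= 1 * (d n / 4).
      by rewrite ler_pM ?cabs_ge0//; apply: ltW; exact: ha.
    by lra.
  have e4 : 2 * (eta * d n) <= d n / 4.
    have : eta * d n <= d n / 32.
      by rewrite mulrC ler_wpM2l ?(ltW dn0)// /eta ler_piMl.
    by lra.
  have Fl : cabs (w - z) / (6 * d n) <= cabs (fac D a n w - fac D a n z).
    rewrite /fac nD !blaschke_factorE -mulrBr (cabsM (blaschke_unit _)).
    rewrite cabs_blaschke_unit mul1r.
    rewrite (moebiusB (ha Dn) (ltW z1) (ltW w1)).
    have Dz := den_neq0 (ha Dn) (ltW z1); have Dw := den_neq0 (ha Dn) (ltW w1).
    have hDz : cabs (1 - (a n)^* * z) <= 9 / 4 * d n by apply: den_le; lra.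
    have hDw := den_le w (le_trans hwn e4).
    rewrite mulrAC mulrC ler_wpM2r ?cabs_ge0//.
    rewrite -cabs_gt0 in Dz; rewrite -cabs_gt0 in Dw.
    rewrite ler_pdivlMr ?mulr_gt0// ler_pdivrMl ?mulr_gt0//.
    apply: (@le_trans _ _ ((9 / 4 * d n) * (9 / 4 * d n))).
      by rewrite ler_pM ?cabs_ge0// hDz//; lra.
    apply: (@le_trans _ _ (6 * d n * d n)); first by nra.
    rewrite ler_wpM2l ?mulr_ge0 ?(ltW dn0)// lerD2l lerN2 expr2.
    by rewrite ler_piMr// ltW// ha.
  rewrite !PE -mulrBr cabsM hgam mul1r.
  have -> : fac D a n w * G w - fac D a n z * G z =
    (fac D a n w - fac D a n z) * G w + fac D a n z * (G w - G z) by ring.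
  have h := cabs_subr_ge ((fac D a n w - fac D a n z) * G w)
    (- (fac D a n z * (G w - G z))).
  rewrite opprK cabsN !cabsM in h; apply: le_trans h.
  have p1 : cabs (w - z) / (6 * d n) * (delta - 4 * eta) <=
    cabs (fac D a n w - fac D a n z) * cabs (G w).
    apply: ler_pM => //; first by rewrite divr_ge0 ?cabs_ge0// mulr_ge0// ltW.
    by rewrite /eta; have := delta0; lra.
  have p2 : cabs (fac D a n z) * cabs (G w - G z) <= eta * (K * cabs (w - z)).
    by apply: ler_pM => //; exact: cabs_ge0.
  apply: le_trans (lerB p1 p2); rewrite le_eqVlt; apply/orP; left; apply/eqP.
  by rewrite /K /eta; field; exact: lt0r_neq0.
Qed.

(** A common point would make the euclidean distance of the two zeros less than
    [delta |1 - a_n^* a_m|], contradicting separation. *)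
Lemma disjoint_boxes n m z : D n -> D m -> cabs (z - a n) <= eta * d n ->
  cabs (z - a m) <= eta * d m -> n = m.
Proof.
move=> Dn Dm hn hm; apply/eqP/negPn/negP => nm.
have dn0 := d_gt0 Dn; have dm0 := d_gt0 Dm.
have := separation_le_dist Dn Dm nm; rewrite /dist cabsM cabsV.
have D0 : 0 < cabs (1 - (a n)^* * a m).
  by rewrite cabs_gt0; apply: den_neq0; [exact: ha|apply: ltW; exact: ha].
rewrite ler_pdivlMr// => h.
have g1 : d n <= cabs (1 - (a n)^* * a m).
  by apply: cabs_den_ge_c; apply: ltW; exact: ha.
have g2 : d m <= cabs (1 - (a n)^* * a m).
  by apply: cabs_den_ge_z; apply: ltW; exact: ha.
have := cabsB (z - a m) (z - a n).
rewrite (_ : z - a m - (z - a n) = a n - a m); last by ring.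
have := ler_wpM2l (ltW delta0) g1; have := ler_wpM2l (ltW delta0) g2.
have := mulr_gt0 delta0 dn0; have := mulr_gt0 delta0 dm0.
by move: hn hm; rewrite /eta; lra.
Qed.

End separated_zeros.

(** * Arcs around separated zeros *)

Section arcs.
Context {R : realType}.
Variables (D : set nat) (a : nat -> R[i]%C) (gam : R[i]%C) (delta : R).
Hypothesis ha : forall n, D n -> cabs (a n) < 1.
Hypothesis hgam : cabs gam = 1.
Hypothesis hsep : separated_zeros D a delta.

Let delta0 : 0 < delta. Proof. by case: hsep. Qed.

Lemma circle_integral_arc (l h c : R) : 0 <= l -> 0 <= h -> l + h <= 2 * pi ->
  0 <= c ->
  circle_integral (fun t => c * \1_(`[l, (l + h)]%classic) t) = (c * h)%:E.
Proof.
move=> l0 h0 lh c0.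
have sub : `[l, (l + h)]%classic `&` `[0, (2 * pi)]%classic =
    `[l, (l + h)]%classic :> set R.
  apply/seteqP; split => [t []//|t tI]; split => //; move: tI.
  by rewrite /= !in_itv/= => /andP[lt tl]; rewrite (le_trans l0)//= (le_trans tl).
have mE : lebesgue_measure (`[l, (l + h)]%classic : set R) = h%:E.
  rewrite lebesgue_measure_itv /= lte_fin ltrDl.
  case: ltP => hh; first by rewrite -EFinD addrC addKr.
  by congr (_%:E); lra.
have mI : measurable (`[l, (l + h)]%classic : set R) by exact: measurable_itv.
rewrite circle_integralZ//.
by rewrite /circle_integral integral_indic// sub [X in (_ * X)%E]mE -EFinM.
Qed.

(** Moving radially by half the radius of the disk around [a_n] leaves room for an
    arc. It starts or ends at the argument of [a_n], so as not to leave the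
    period. *)
Lemma arc_in_box (n : nat) (r : R) : D n -> r < 1 ->
  0 <= r - cabs (a n) <= delta / 64 * (1 - cabs (a n)) ->
  exists l : R, [/\ 0 <= l, l + delta / 128 * (1 - cabs (a n)) <= 2 * pi &
    forall t, l <= t <= l + delta / 128 * (1 - cabs (a n)) ->
      cabs (circle_pt r t - a n) <= delta / 32 * (1 - cabs (a n))].
Proof.
move=> Dn r1 /andP[r0 rn]; have an0 := cabs_ge0 (a n).
have de1 := separation_le1 ha hsep Dn.
have [phi /andP[phi0 phi1] aE] := polar (a n).
set rho := cabs (a n) in r0 rn an0 aE *.
have rho1 : rho < 1 by exact: ha.
pose h : R := delta / 128 * (1 - rho).
have h0 : 0 <= h by rewrite mulr_ge0 ?divr_ge0 ?(ltW delta0) ?subr_ge0 ?(ltW rho1).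
have h1 : h <= 1.
  rewrite -[1]mulr1 ler_pM// ?divr_ge0 ?subr_ge0 ?(ltW delta0) ?(ltW rho1)//.
    by rewrite ler_pdivrMr// mul1r; lra.
  by rewrite gerBl.
have pi1 : 1 <= (pi : R).
  by have := pihalf_ge1 R; rewrite ler_pdivlMr//; lra.
have close t : `|t - phi| <= h ->
    cabs (circle_pt r t - a n) <= delta / 32 * (1 - rho).
  move=> th; rewrite aE.
  have -> : circle_pt r t - circle_pt rho phi =
      (circle_pt r t - circle_pt r phi) + circle_pt (r - rho) phi.
    by rewrite /circle_pt; apply/eqP; rewrite eq_complex /=; apply/andP; split;
       apply/eqP; ring.
  apply: le_trans (cabsD _ _) _; rewrite cabs_circle_pt (ger0_norm r0).
  have := circle_pt_lip r phi t.
  have r00 : 0 <= r by lra.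
  rewrite (ger0_norm r00) => hl.
  have : 2 * r * `|t - phi| <= 2 * 1 * h.
    by rewrite ler_pM ?mulr_ge0// ler_pM2l// ltW.
  by rewrite /h; lra.
have [pp|pp] := leP phi pi.
  exists phi; split => //; first by rewrite -/h; lra.
  move=> t /andP[t1 t2]; apply: close; rewrite ger0_norm ?subr_ge0//.
  by rewrite lerBlDl.
exists (phi - h); split; first lra.
  by rewrite -/h subrK.
move=> t; rewrite -/h subrK => /andP[t1 t2].
by apply: close; rewrite ler0_norm ?subr_le0// opprB; lra.
Qed.

(** A circle that passes just outside several zeros meets the disks around them in
    disjoint arcs, and on the arc of [a_n], of length proportional to
    [1 - |a_n|], the derivative is at least a multiple of [1 / (1 - |a_n|)]. *)
Lemma partial_mean_ge_arcs (p r : R) (J : pred nat) (N0 N : nat) :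
  0 < p -> 0 < r < 1 -> (N0 <= N)%N ->
  (forall n, J n -> D n /\
    0 <= r - cabs (a n) <= delta / 64 * (1 - cabs (a n))) ->
  (((delta / 12) `^ p * (delta / 128) *
    \sum_(n < N0 | J n) (1 - cabs (a n)) `^ (1 - p))%:E <=
   partial_mean D a gam p r N)%E.
Proof.
move=> p0 r01 NN hJ; have /andP[r0 r1] := r01.
have /choice[l hl] : forall n, exists l : R, J n ->
  [/\ 0 <= l, l + delta / 128 * (1 - cabs (a n)) <= 2 * pi &
    forall t, l <= t <= l + delta / 128 * (1 - cabs (a n)) ->
      cabs (circle_pt r t - a n) <= delta / 32 * (1 - cabs (a n))].
  move=> n; case: (boolP (J n)) => [Jn|_]; last by exists 0.
  have [Dn hr] := hJ _ Jn.
  by have [l hl] := arc_in_box Dn r1 hr; exists l.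
pose I (n : nat) : set R := `[l n, (l n + delta / 128 * (1 - cabs (a n)))]%classic.
pose c (n : nat) : R := (delta / (12 * (1 - cabs (a n)))) `^ p.
pose F (n : 'I_N0) (t : R) : R := c n * \1_(I n) t.
have F0 n t : 0 <= F n t by rewrite mulr_ge0 ?powR_ge0.
have mI (n : nat) : measurable (I n) by exact: measurable_itv.
have mF n : measurable_fun setT (F n).
  by apply: measurable_funM.
have msF : measurable_fun setT (fun t => \sum_(n < N0 | J n) F n t).
  by apply: measurable_sum_cond => n _; exact: mF.
apply: (@le_trans _ _
    (circle_integral (fun t => \sum_(n < N0 | J n) F n t))); last first.
  apply: circle_integral_le => //; first exact: measurable_dbprod_powR.
    by move=> t; apply: sumr_ge0 => n _; exact: F0.
  move=> t _.
  have box n : J n -> t \in I n ->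
      cabs (circle_pt r t - a n) <= delta / 32 * (1 - cabs (a n)).
    by move=> /hl[_ _ h] /set_mem; rewrite /I /= in_itv /=; exact: h.
  case: (pickP (fun n : 'I_N0 => J n && (t \in I n))) => [n /andP[Jn tn]|none].
    rewrite (bigD1 n)//= big1 ?addr0; last first.
      move=> m /andP[Jm mn]; rewrite /F indicE.
      case: (boolP (t \in I m)) => [tm|_]; last by rewrite mulr0.
      have := disjoint_boxes ha hsep (proj1 (hJ _ Jm)) (proj1 (hJ _ Jn))
        (box _ Jm tm) (box _ Jn tn).
      by move/val_inj => e; rewrite e eqxx in mn.
    rewrite /F indicE tn mulr1 /c.
    have [Dn _] := hJ _ Jn; have an := ha Dn.
    have dn0 : 0 < 1 - cabs (a n) by rewrite subr_gt0.
    rewrite ge0_ler_powR ?(ltW p0)// ?nnegrE ?cabs_ge0//.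
      by rewrite divr_ge0 ?mulr_ge0// ltW.
    apply: (dbprod_ge ha hgam hsep Dn) => //.
      exact: leq_trans (ltn_ord n) NN.
    exact: box.
  rewrite big1 ?powR_ge0// => n Jn; rewrite /F indicE.
  by have := none n; rewrite Jn /= => ->; rewrite mulr0.
rewrite circle_integral_sum//.
rewrite big_distrr/= -sumEFin; apply: lee_sum => n Jn.
have [l0 l1 _] := hl _ Jn.
have [Dn _] := hJ _ Jn; have dn0 : 0 < 1 - cabs (a n) by rewrite subr_gt0 ha.
rewrite circle_integral_arc ?powR_ge0//; last first.
  by rewrite mulr_ge0 ?divr_ge0 ?(ltW delta0) ?(ltW dn0).
have cE : c n = (delta / 12) `^ p * (1 - cabs (a n)) `^ (- p).
  rewrite /c (_ : delta / _ = delta / 12 * (1 - cabs (a n))^-1); last first.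
    by field; exact: lt0r_neq0.
  rewrite powRM ?divr_ge0 ?invr_ge0 ?(ltW delta0) ?(ltW dn0)//.
  by rewrite -(powR_inv1 (ltW dn0)) -powRrM mulN1r.
rewrite lee_fin cE powRD ?(gt_eqF dn0) ?implybT// powRr1 ?(ltW dn0)//.
by rewrite le_eqVlt; apply/orP; left; apply/eqP; ring.
Qed.

End arcs.

(** * A Cauchy estimate *)

Section circle_points.
Context {R : realType}.
Implicit Types (r s t : R).

Lemma circle_ptM r r' s t :
  circle_pt r s * circle_pt r' t = circle_pt (r * r') (s + t).
Proof.
rewrite /circle_pt cosD sinD; apply/eqP; rewrite eq_complex /=.
by apply/andP; split; apply/eqP; ring.
Qed.

Lemma circle_pt1 : circle_pt 1 0 = 1 :> R[i]%C.
Proof. by rewrite /circle_pt cos0 sin0 mulr1 mulr0. Qed.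

Lemma circle_ptX r t n : circle_pt r t ^+ n = circle_pt (r ^+ n) (n%:R * t).
Proof.
elim: n => [|n IH]; first by rewrite !expr0 mul0r circle_pt1.
by rewrite !exprS IH circle_ptM -natr1 mulrDl mul1r addrC.
Qed.

Lemma circle_ptV r t : r != 0 -> (circle_pt r t)^-1 = circle_pt r^-1 (- t).
Proof.
move=> r0; have h : circle_pt r t * circle_pt r^-1 (- t) = 1.
  by rewrite circle_ptM divff// subrr circle_pt1.
have z0 : circle_pt r t != 0.
  by rewrite -cabs_gt0 cabs_circle_pt normr_gt0.
by rewrite -[LHS]mulr1 -h mulKf.
Qed.

End circle_points.

Section trigonometric_means.
Context {R : realType}.
Implicit Types (f g : R -> R) (m x y : R).

(** Carrying an antiderivative along makes the mean visibly additive and reduces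
    every computation to values at the endpoints of the period. *)
Definition has_mean f m := continuous f /\
  exists2 F : R -> R, (forall t, is_derive t (1 : R) F (f t)) &
    F (2 * pi) - F 0 = 2 * pi * m.

Lemma has_mean0 : has_mean (fun=> 0) 0.
Proof.
split; first by move=> t; exact: cvg_cst.
exists (fun=> 0); last by rewrite subrr mulr0.
by move=> t; exact: is_derive_cst.
Qed.

Lemma has_meanD f g m m' : has_mean f m -> has_mean g m' ->
  has_mean (fun t => f t + g t) (m + m').
Proof.
move=> [cf [F dF Fm]] [cg [G dG Gm]]; split.
  by move=> t; apply: cvgD; [exact: cf|exact: cg].
exists (fun t => F t + G t).
  by move=> t; have := dF t; have := dG t => ? ?; exact: is_deriveD.
have -> : 2 * pi * (m + m') = 2 * pi * m + 2 * pi * m' by ring.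
by rewrite -Fm -Gm; ring.
Qed.

Lemma has_mean_sum n (f : 'I_n -> R -> R) (m : 'I_n -> R) :
  (forall i, has_mean (f i) (m i)) ->
  has_mean (fun t => \sum_(i < n) f i t) (\sum_(i < n) m i).
Proof.
elim: n f m => [f m _|n IH f m h].
  rewrite big_ord0 (_ : (fun t => _) = fun=> 0); first exact: has_mean0.
  by apply/funext => t; rewrite big_ord0.
rewrite big_ord_recr (_ : (fun t => _) = fun t =>
  \sum_(i < n) f (widen_ord (leqnSn n) i) t + f ord_max t).
  by apply: has_meanD; [apply: IH => i; exact: h|exact: h].
by apply/funext => t; rewrite big_ord_recr.
Qed.

Lemma has_mean_trig x y (j k : nat) :
  has_mean (fun t => x * cos ((j%:R - k%:R) * t) - y * sin ((j%:R - k%:R) * t))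
    (if j == k then x else 0).
Proof.
set nu : R := j%:R - k%:R.
have dlin t : is_derive t (1 : R) (fun u : R => nu * u) nu.
  by apply: is_derive_eq; rewrite -[_ *: _]/(nu * 1) mulr1.
have dcos t := @is_derive1_comp _ cos (fun u => nu * u) t _ _
  (is_derive_cos (nu * t)) (dlin t).
have dsin t := @is_derive1_comp _ sin (fun u => nu * u) t _ _
  (is_derive_sin (nu * t)) (dlin t).
split.
  move=> t; apply: cvgB; apply: cvgM; try exact: cvg_cst.
    apply: differentiable_continuous; apply/derivable1_diffP.
    exact: (@ex_derive _ _ _ _ _ _ _ (dcos t)).
  apply: differentiable_continuous; apply/derivable1_diffP.
  exact: (@ex_derive _ _ _ _ _ _ _ (dsin t)).
case: eqVneq => [jk|jk].
  have nu0 : nu = 0 by rewrite /nu jk subrr.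
  exists (fun t => x * t).
    move=> t; rewrite nu0 mul0r cos0 sin0 mulr1 mulr0 subr0.
    by apply: is_derive_eq; rewrite -[_ *: _]/(x * 1) mulr1.
  by rewrite mulr0 subr0 mulrC.
have nu0 : nu != 0 by rewrite subr_eq0 eqr_nat.
exists (fun t => x / nu * sin (nu * t) + y / nu * cos (nu * t)).
  move=> t; have := dcos t; have := dsin t => ? ?.
  apply: is_derive_eq.
  rewrite -![_ *: _]/(_ * _); field; exact: nu0.
have per (m : nat) :
    sin (m%:R * (2 * pi)) = 0 :> R /\ cos (m%:R * (2 * pi)) = 1 :> R.
  elim: m => [|m [IHs IHc]]; first by rewrite mul0r sin0 cos0.
  have -> : m.+1%:R * (2 * pi) = m%:R * (2 * pi) + pi *+ 2 :> R.
    by rewrite -natr1 -[pi *+ 2]mulr_natr; ring.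
  by rewrite sinD2pi cosD2pi.
have [sj cj] := per j; have [sk ck] := per k.
rewrite mulr0 sin0 cos0 /nu mulrBl sinB cosB sj cj sk ck; ring.
Qed.

Lemma integral_has_mean f m : has_mean f m ->
  (\int[lebesgue_measure]_(t in `[0%R, (2 * pi)%R]) (f t)%:E = (2 * pi * m)%:E)%E.
Proof.
move=> [cf [F dF Fm]]; have p0 : 0 < 2 * pi :> R by rewrite mulr_gt0// pi_gt0.
by rewrite (FTC_is_derive p0 (fun t _ => dF t) (fun t _ => cf t)) Fm.
Qed.

End trigonometric_means.

Section cauchy_estimate.
Context {R : realType}.
Implicit Types (P Q : {poly R[i]%C}) (z al : R[i]%C) (f g : R[i]%C -> R[i]%C).

Lemma power_small (th e : R) : 0 < th < 1 -> 0 < e -> exists n, th ^+ n <= e.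
Proof.
move=> /andP[th0 th1] e0.
have : th ^+ n @[n --> \oo] --> (0 : R) by apply: cvg_expr; rewrite gtr0_norm.
move=> /cvgrPdist_lt/(_ _ e0)[n _ /(_ n (leqnn n))] /=.
rewrite sub0r normrN ger0_norm ?exprn_ge0 ?(ltW th0)// => h.
by exists n; exact: ltW.
Qed.

Lemma sum_geometric_le n : \sum_(k < n) (2 / 3 : R) ^+ k <= 3.
Proof.
have -> : \sum_(k < n) (2 / 3 : R) ^+ k = 3 * (1 - (2 / 3) ^+ n).
  elim: n => [|n IH]; first by rewrite big_ord0 expr0 subrr mulr0.
  by rewrite big_ord_recr /= IH exprS; field.
have : 0 <= (2 / 3 : R) ^+ n by rewrite exprn_ge0.
by lra.
Qed.

(** The value of a polynomial [P] at [al] is the mean over the circle of radius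
    [3 / 4] of [P(z)] times the Cauchy kernel [1 / (1 - al / z)], and for this it
    is enough to keep the terms of the kernel up to the degree of [P]. The
    truncated kernel is at most [3] in modulus, since [|al / z| <= 2 / 3]. The
    function [T] is the real part of the integrand, turned by the phase of
    [P(al)] and written as a trigonometric polynomial. *)
Lemma poly_circle_mean P al : cabs al <= 2^-1 ->
  exists2 T : R -> R, has_mean T (cabs P.[al]) &
    forall t, T t <= 3 * cabs P.[circle_pt (3 / 4) t].
Proof.
move=> al2; pose r : R := 3 / 4.
have r0 : r != 0 by rewrite /r; lra.
have [u u1 uE] : exists2 u : R[i]%C, cabs u = 1 & u * P.[al] = (cabs P.[al])%:C%C.
  have [->|P0] := eqVneq P.[al] 0.
    by exists 1; rewrite ?cabs1// mulr0 cabs0.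
  exists ((cabs P.[al])%:C%C / P.[al]); last by rewrite divfK.
  by rewrite cabsM cabsV cabs_real ger0_norm ?cabs_ge0// divff// cabs_eq0.
pose n := size P.
pose c (j k : 'I_n) : R[i]%C := u * P`_j * al ^+ k * (r ^+ j * r^-1 ^+ k)%:C%C.
pose T t : R := \sum_(j < n) \sum_(k < n)
  (complex.Re (c j k) * cos ((j%:R - k%:R) * t) -
   complex.Im (c j k) * sin ((j%:R - k%:R) * t)).
have TE t : T t = complex.Re (u * P.[circle_pt r t] *
    \sum_(k < n) (al / circle_pt r t) ^+ k).
  have ReD : {morph (@complex.Re R) : x y / x + y} by move=> [? ?] [? ?].
  rewrite horner_coef -mulrA big_distrlr/= big_distrr/=.
  rewrite (big_morph _ ReD (erefl : complex.Re (0 : R[i]%C) = 0)).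
  apply: eq_bigr => j _; rewrite big_distrr/=.
  rewrite (big_morph _ ReD (erefl : complex.Re (0 : R[i]%C) = 0)).
  apply: eq_bigr => k _.
  rewrite exprMn circle_ptV// !circle_ptX.
  have -> : u * (P`_j * circle_pt (r ^+ j) (j%:R * t) *
      (al ^+ k * circle_pt (r^-1 ^+ k) (k%:R * - t))) =
    u * P`_j * al ^+ k * (circle_pt (r ^+ j) (j%:R * t) *
      circle_pt (r^-1 ^+ k) (k%:R * - t)) by ring.
  rewrite circle_ptM mulrN -mulrBl /c.
  case: (u * P`_j * al ^+ k) => x y; rewrite /circle_pt /=; ring.
exists T.
  have <- : \sum_(j < n) \sum_(k < n)
      (if (j : nat) == k then complex.Re (c j k) else 0) = cabs P.[al].
    have -> : cabs P.[al] = complex.Re (u * P.[al]) by rewrite uE.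
    have ReD : {morph (@complex.Re R) : x y / x + y} by move=> [? ?] [? ?].
    rewrite horner_coef big_distrr/=.
    rewrite (big_morph _ ReD (erefl : complex.Re (0 : R[i]%C) = 0)).
    apply: eq_bigr => j _; rewrite (bigD1 j)//= eqxx big1 ?addr0.
      by rewrite /c -exprMn divff// expr1n mulr1 mulrA.
    by move=> k /negPf kj; rewrite eq_sym; move: kj; rewrite -val_eqE => ->.
  apply: has_mean_sum => j; apply: has_mean_sum => k; exact: has_mean_trig.
move=> t; rewrite TE; apply: le_trans (ler_norm _) _.
apply: le_trans (Re_le_cabs _) _; rewrite !cabsM u1 mul1r mulrC.
rewrite ler_wpM2r ?cabs_ge0//; apply: le_trans (cabs_sum _ _ _) _.
apply: le_trans (sum_geometric_le n); apply: ler_sum => k _.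
rewrite cabsX lerXn2r ?nnegrE ?cabs_ge0//.
rewrite cabsM cabsV cabs_circle_pt ger0_norm ?divr_ge0//.
by rewrite ler_pdivrMr /r//; lra.
Qed.

(** Uniform limits of polynomials on a disk form an algebra and inherit the
    estimate of [poly_circle_mean]; for the derivative of a finite Blaschke
    product they replace Cauchy's integral formula. The bound in the definition
    makes products of limits work. *)
Definition poly_limit (r : R) f :=
  (exists M : R, forall z, cabs z <= r -> cabs (f z) <= M) /\
  forall e : R, 0 < e -> exists P, forall z, cabs z <= r ->
    cabs (f z - P.[z]) <= e.

Lemma poly_limit_cst r (c : R[i]%C) : poly_limit r (fun=> c).
Proof.
split; first by exists (cabs c).
by move=> e e0; exists c%:P => z _; rewrite hornerC subrr cabs0 ltW.
Qed.

Lemma poly_limit_id r : poly_limit r id.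
Proof.
split; first by exists r.
by move=> e e0; exists 'X => z _; rewrite hornerX subrr cabs0 ltW.
Qed.

Lemma poly_limitD r f g : poly_limit r f -> poly_limit r g ->
  poly_limit r (fun z => f z + g z).
Proof.
move=> [[M hM] hf] [[M' hM'] hg]; split.
  by exists (M + M') => z zr; rewrite (le_trans (cabsD _ _))// lerD ?hM ?hM'.
move=> e e0; have e2 : 0 < e / 2 by rewrite divr_gt0.
have [P hP] := hf _ e2; have [Q hQ] := hg _ e2.
exists (P + Q) => z zr; rewrite hornerD opprD addrACA (splitr e).
by rewrite (le_trans (cabsD _ _))// lerD ?hP ?hQ.
Qed.

Lemma poly_limitM r f g : poly_limit r f -> poly_limit r g ->
  poly_limit r (fun z => f z * g z).
Proof.
move=> [[M0 hM0] hf] [[M0' hM0'] hg].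
pose M := Num.max 0 M0; pose M' := Num.max 0 M0'.
have M_ge0 : 0 <= M by rewrite le_max lexx.
have M'_ge0 : 0 <= M' by rewrite le_max lexx.
have hM z : cabs z <= r -> cabs (f z) <= M.
  by move=> /hM0 h; rewrite (le_trans h)// le_max lexx orbT.
have hM' z : cabs z <= r -> cabs (g z) <= M'.
  by move=> /hM0' h; rewrite (le_trans h)// le_max lexx orbT.
split.
  by exists (M * M') => z zr; rewrite cabsM ler_pM ?cabs_ge0 ?hM ?hM'.
move=> e e0; pose e1 : R := Num.min 1 (e / (2 * (M + 1))).
have e10 : 0 < e1 by rewrite lt_min ltr01 divr_gt0// mulr_gt0// ltr_wpDl.
have e11 : e1 <= 1 by rewrite ge_min lexx.
have e1M : M * e1 <= e / 2.
  have : e1 <= e / (2 * (M + 1)) by rewrite ge_min lexx orbT.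
  rewrite ler_pdivlMr ?mulr_gt0 ?ltr_wpDl// => h.
  have : 0 <= e1 by exact: ltW.
  by lra.
pose e2 : R := e / (2 * (M' + 1)).
have e20 : 0 < e2 by rewrite divr_gt0// mulr_gt0// ltr_wpDl.
have [P hP] := hf _ e20; have [Q hQ] := hg _ e10.
exists (P * Q) => z zr; rewrite hornerM.
have -> : f z * g z - P.[z] * Q.[z] =
  f z * (g z - Q.[z]) + (f z - P.[z]) * Q.[z] by ring.
have Qz : cabs Q.[z] <= M' + 1.
  have := cabsB (g z) (g z - Q.[z]); rewrite opprB addrC subrK.
  by have := hM' _ zr; have := hQ _ zr; lra.
rewrite (le_trans (cabsD _ _))// !cabsM (splitr e) lerD//.
  apply: le_trans e1M; apply: ler_pM; rewrite ?cabs_ge0//; first exact: hM.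
  exact: hQ.
have <- : e2 * (M' + 1) = e / 2.
  by rewrite /e2; field; rewrite gt_eqF// ltr_wpDl.
by apply: ler_pM; rewrite ?cabs_ge0//; exact: hP.
Qed.

Lemma poly_limit_inv_den r (c : R[i]%C) : 0 < r < 1 -> cabs c < 1 ->
  poly_limit r (fun z => (1 - c^* * z)^-1).
Proof.
move=> /andP[r0 r1] c1; have r10 : 0 < 1 - r by rewrite subr_gt0.
have den z : cabs z <= r -> 1 - r <= cabs (1 - c^* * z).
  move=> zr; apply: le_trans (cabs_den_ge_z _ (ltW c1)).
  by rewrite lerD2l lerN2.
split.
  exists (1 - r)^-1 => z zr; rewrite cabsV lef_pV2 ?posrE ?den//.
  exact: lt_le_trans (den _ zr).
move=> e e0.
have r01 : 0 < r < 1 by rewrite r0.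
have [n hn] := power_small r01 (mulr_gt0 e0 r10).
exists (\sum_(k < n) (c^* *: 'X) ^+ k) => z zr.
have d0 : 1 - c^* * z != 0.
  by rewrite -cabs_gt0; exact: lt_le_trans (den _ zr).
rewrite horner_sum.
have -> : \sum_(k < n) ((c^* *: 'X) ^+ k).[z] =
    (1 - (c^* * z) ^+ n) / (1 - c^* * z).
  apply: (canRL (mulfK d0)); rewrite mulrC.
  elim: n {hn} => [|n IH]; first by rewrite big_ord0 expr0 subrr mulr0.
  by rewrite big_ord_recr /= mulrDr IH horner_exp hornerZ hornerX exprS; ring.
have -> : (1 - c^* * z)^-1 - (1 - (c^* * z) ^+ n) / (1 - c^* * z) =
  (c^* * z) ^+ n / (1 - c^* * z) by field.
rewrite cabsM cabsV cabsX ler_pdivrMr; last exact: lt_le_trans (den _ zr).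
apply: (@le_trans _ _ (r ^+ n)); last first.
  by rewrite (le_trans hn)// ler_wpM2l ?(ltW e0)// den.
rewrite lerXn2r ?nnegrE ?cabs_ge0 ?(ltW r0)// cabsM cabsJ.
by rewrite (le_trans _ zr)// ler_piMl ?cabs_ge0// ltW.
Qed.

Lemma poly_limit_cauchy f al : poly_limit (3 / 4) f -> cabs al <= 2^-1 ->
  continuous (fun t : R => cabs (f (circle_pt (3 / 4) t))) ->
  ((2 * pi * cabs (f al))%:E <=
   3%:E * circle_integral (fun t => cabs (f (circle_pt (3 / 4) t))))%E.
Proof.
move=> [_ hf] al2 cg; set g := fun t : R => _ in cg *.
have pi0 : 0 < (pi : R) by exact: pi_gt0.
have g0 t : 0 <= g t by exact: cabs_ge0.
have mg : measurable_fun setT g by exact: continuous_measurable_fun.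
apply/lee_addgt0Pr => e e0.
(* An approximation within e1 costs 2 pi e1 at al and three times that on the
   circle. *)
pose e1 : R := e / (8 * pi).
have e10 : 0 < e1 by rewrite divr_gt0// mulr_gt0.
have [P hP] := hf _ e10; have [T mT hT] := poly_circle_mean P al2.
have h1 : 2 * pi * cabs (f al) <= 2 * pi * cabs P.[al] + 2 * pi * e1.
  rewrite -mulrDr ler_wpM2l ?mulr_ge0 ?(ltW pi0)//.
  have := cabsD P.[al] (f al - P.[al]); rewrite addrC subrK.
  by have := hP al; rewrite (le_trans al2) => [/(_ isT)|]; lra.
have h2 : ((2 * pi * cabs P.[al])%:E <=
    circle_integral (fun t => 3 * (g t + e1))%R)%E.
  rewrite -(integral_has_mean mT); apply: le_integral => //=.
  - apply: (@continuous_compact_integrable R T); first exact: segment_compact.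
    by apply: continuous_subspaceT; case: mT.
  - apply: (@continuous_compact_integrable R (fun t => 3 * (g t + e1))).
      exact: segment_compact.
    apply: continuous_subspaceT => t; apply: cvgM; first exact: cvg_cst.
    by apply: cvgD; [exact: cg|exact: cvg_cst].
  - move=> t _; rewrite lee_fin; apply: le_trans (hT t) _.
    rewrite ler_wpM2l//.
    have := cabsB (f (circle_pt (3 / 4) t))
      (f (circle_pt (3 / 4) t) - P.[circle_pt (3 / 4) t]).
    rewrite opprB addrC subrK => h; apply: (le_trans h); rewrite lerD2l.
    by apply: hP; rewrite cabs_circle_pt ger0_norm ?divr_ge0.
have h3 : circle_integral (fun t => 3 * (g t + e1)) =
    (3%:E * circle_integral g + (6 * pi * e1)%:E)%E.
  rewrite circle_integralZ//; first last.
  - by move=> t; rewrite addr_ge0 ?(ltW e10).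
  - by apply: measurable_funD.
  rewrite /circle_integral; under eq_integral do rewrite EFinD.
  rewrite ge0_integralD//; first last.
  - by move=> t _; rewrite lee_fin ltW.
  - exact/measurable_EFinP/measurable_funTS.
  - by move=> t _; rewrite lee_fin.
  rewrite integral_cst//= lebesgue_measure_itv/= lte_fin mulr_gt0//.
  rewrite ge0_muleDr ?integral_ge0//.
  - by rewrite -EFinD -!EFinM; congr (_ + _%:E)%E; ring.
  - by move=> t _; rewrite lee_fin.
  - rewrite -EFinD -EFinM lee_fin oppr0 addr0 mulr_ge0 ?(ltW e10)//.
    by rewrite mulr_ge0// ltW.
apply: (@le_trans _ _ ((2 * pi * cabs P.[al])%:E + (2 * pi * e1)%:E)%E).
  by rewrite -EFinD lee_fin.
have -> : e = 6 * pi * e1 + 2 * pi * e1.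
  rewrite /e1; move: (pi : R) (lt0r_neq0 pi0) => q q0.
  by field.
by rewrite (EFinD (6 * pi * e1)) addeA -h3 leeD2r.
Qed.

End cauchy_estimate.

(** * Zeros in the disk of radius one half *)

Section small_zeros.
Context {R : realType}.
Implicit Types (D : set nat) (a : nat -> R[i]%C) (gam : R[i]%C) (p r : R).

Lemma poly_limit_fac D a k r : (forall n, D n -> cabs (a n) < 1) ->
  0 < r < 1 -> poly_limit r (fac D a k).
Proof.
move=> ha r01; rewrite /fac; case: (boolP (k \in D)) => [/set_mem/ha ak|_].
  rewrite (_ : (fun z => _) = fun z => blaschke_unit (a k) *
    ((a k + -1 * z) * (1 - (a k)^* * z)^-1)); last first.
    by apply/funext => z; rewrite blaschke_factorE /moebius mulN1r.
  apply: poly_limitM; first exact: poly_limit_cst.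
  apply: poly_limitM; last exact: poly_limit_inv_den.
  apply: poly_limitD; first exact: poly_limit_cst.
  by apply: poly_limitM; [exact: poly_limit_cst|exact: poly_limit_id].
exact: poly_limit_cst.
Qed.

Lemma poly_limit_dfac D a k r : (forall n, D n -> cabs (a n) < 1) ->
  0 < r < 1 -> poly_limit r (dfac D a k).
Proof.
move=> ha r01; rewrite /dfac; case: (boolP (k \in D)) => [/set_mem/ha ak|_].
  rewrite (_ : (fun z => _) = fun z =>
    (blaschke_unit (a k) * - (1 - a k * (a k)^*)) *
    ((1 - (a k)^* * z)^-1 * (1 - (a k)^* * z)^-1)); last first.
    by apply/funext => z; rewrite /dmoebius -exprVn expr2 !mulrA.
  apply: poly_limitM; first exact: poly_limit_cst.
  by apply: poly_limitM; exact: poly_limit_inv_den.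
exact: poly_limit_cst.
Qed.

Lemma poly_limit_dbprod D a gam N r : (forall n, D n -> cabs (a n) < 1) ->
  0 < r < 1 -> poly_limit r (dbprod D a gam N).
Proof.
move=> ha r01.
suff [] : poly_limit r (bprod D a gam N) /\ poly_limit r (dbprod D a gam N) by [].
elim: N => [|N [IH IH']]; first by split; exact: poly_limit_cst.
have hf := poly_limit_fac N ha r01; have hdf := poly_limit_dfac N ha r01.
split; first exact: poly_limitM.
by apply: poly_limitD; exact: poly_limitM.
Qed.

(** A bounded function with a large integral has a large integral of its [p]-th
    power, whatever the sign of [p - 1]: above the level [lam] one has
    [x = x^(1 - p) x^p], and [x^(1 - p)] is monotone between [lam] and [M]. *)
Lemma le_add_powR (p lam M x : R) : 0 < lam -> 0 <= x <= M ->
  x <= lam + Num.max (lam `^ (1 - p)) (M `^ (1 - p)) * x `^ p.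
Proof.
move=> lam0 /andP[x0 xM]; set C := Num.max _ _.
have C0 : 0 <= C by rewrite le_max powR_ge0.
have [xl|lx] := leP x lam; first by rewrite ler_wpDr// mulr_ge0// powR_ge0.
have x_gt0 : 0 < x := lt_trans lam0 lx.
have M0 : 0 < M := lt_le_trans x_gt0 xM.
apply: (@le_trans _ _ (C * x `^ p)); last by rewrite lerDr ltW.
have hx : x `^ (1 - p) * x `^ p = x.
  by rewrite -powRD ?subrK ?powRr1 ?(gt_eqF x_gt0) ?implybT.
apply: (@le_trans _ _ (x `^ (1 - p) * x `^ p)); first by rewrite hx.
rewrite ler_wpM2r ?powR_ge0// /C le_max.
have [p1|p1] := leP 0 (1 - p).
  by rewrite [X in _ || X]ge0_ler_powR ?orbT ?nnegrE// ltW.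
rewrite (_ : 1 - p = - (p - 1)); last by rewrite opprB.
rewrite !powRN lef_pV2 ?posrE ?powR_gt0//.
by rewrite ge0_ler_powR ?nnegrE ?(ltW lam0) ?(ltW lx)//; lra.
Qed.

(** At the zero itself the derivative is at least [delta / 12]; the Cauchy estimate
    turns this into a lower bound for its [L^1] mean over the circle of radius
    [3 / 4], and [le_add_powR] into one for its [L^p] mean. *)
Lemma small_zero_mean p delta : 0 < p -> 0 < delta ->
  exists2 c : R, 0 < c & forall D a gam n N,
    (forall n, D n -> cabs (a n) < 1) -> cabs gam = 1 ->
    separated_zeros D a delta -> D n -> cabs (a n) <= 2^-1 -> (n < N)%N ->
    (c%:E <= partial_mean D a gam p (3 / 4) N)%E.
Proof.
move=> p0 delta0.
(* The level lam takes up half of the lower bound for the L^1 mean. *)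
pose lam : R := delta / 72.
have lam0 : 0 < lam by rewrite divr_gt0.
pose C : R := Num.max (lam `^ (1 - p)) (8 `^ (1 - p)).
have C0 : 0 < C by rewrite lt_max powR_gt0.
have pi0 : 0 < (pi : R) by exact: pi_gt0.
exists (2 * pi * lam / C); first by rewrite divr_gt0// !mulr_gt0.
move=> D a gam n N ha hgam hsep Dn an2 nN.
have r01 : 0 < (3 / 4 : R) < 1 by apply/andP; split; lra.
pose g t : R := cabs (dbprod D a gam N (circle_pt (3 / 4) t)).
have g0 t : 0 <= g t by exact: cabs_ge0.
have gM t : g t <= 8.
  apply: (@le_trans _ _ (2 / (1 - 3 / 4))); last first.
    by rewrite (_ : 1 - 3 / 4 = 4^-1); [rewrite invrK; lra|field].
  apply: (cabs_dbprod_le ha hgam); first lra.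
  by rewrite cabs_circle_pt ger0_norm.
have cg : continuous g by exact: continuous_cabs_dbprod.
have h1 := poly_limit_cauchy (poly_limit_dbprod gam N ha r01) an2 cg.
have h2 : delta / 12 <= cabs (dbprod D a gam N (a n)).
  have := @dbprod_ge R D a gam delta ha hgam hsep n N (a n) Dn nN.
  have dn0 : 0 < 1 - cabs (a n) by rewrite subr_gt0 ha.
  rewrite subrr cabs0 !mulr_ge0 ?invr_ge0 ?(ltW delta0) ?(ltW dn0)//.
  move=> /(_ isT); apply: le_trans.
  rewrite ler_wpM2l ?(ltW delta0)// lef_pV2 ?posrE ?mulr_gt0//.
  by rewrite ler_piMr// gerBl cabs_ge0.
have mg : measurable_fun setT g by exact: continuous_measurable_fun.
have mgp : measurable_fun setT (fun t => g t `^ p).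
  by have := measurable_dbprod_powR N p ha hgam r01.
have h3 : (circle_integral g <=
    (2 * pi * lam)%:E + C%:E * partial_mean D a gam p (3 / 4) N)%E.
  apply: (@le_trans _ _ (circle_integral (fun t => lam + C * g t `^ p)%R)).
    apply: circle_integral_le => //.
      by apply: measurable_funD => //; exact: measurable_funM.
    by move=> t _; rewrite /C; apply: le_add_powR => //; rewrite g0 gM.
  rewrite /circle_integral; under eq_integral do rewrite EFinD.
  rewrite ge0_integralD//; first last.
  - by apply/measurable_EFinP/measurable_funTS; exact: measurable_funM.
  - by move=> t _; rewrite lee_fin mulr_ge0 ?powR_ge0// ltW.
  - by move=> t _; rewrite lee_fin ltW.
  have -> : (\int[lebesgue_measure]_(x in `[0%R, (2 * pi)%R]) lam%:E =
      (2 * pi * lam)%:E)%E.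
    rewrite integral_cst//= lebesgue_measure_itv/= lte_fin mulr_gt0//.
    by rewrite -EFinD oppr0 addr0 -EFinM mulrC.
  rewrite leeD2l// -[X in (X <= _)%E]/(circle_integral (fun t => C * g t `^ p)).
  by rewrite circle_integralZ ?(ltW C0)// => t; exact: powR_ge0.
have h4 : ((2 * pi * (delta / 12))%:E <=
    3%:E * ((2 * pi * lam)%:E + C%:E * partial_mean D a gam p (3 / 4) N))%E.
  apply: le_trans (lee_wpmul2l _ h3); last by rewrite lee_fin.
  by apply: le_trans h1; rewrite lee_fin ler_wpM2l// mulr_ge0 ?(ltW pi0).
move: h4; case: (partial_mean D a gam p (3 / 4) N) => [y| |].
- move=> h4; have {}h4 : 2 * pi * (delta / 12) <= 3 * (2 * pi * lam + C * y).
    by rewrite -lee_fin.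
  rewrite lee_fin.
  rewrite ler_pdivrMr// mulrC; move: h4; rewrite /lam.
  have : 0 <= pi * delta by rewrite mulr_ge0// ltW.
  by lra.
- by rewrite leey.
- by rewrite gt0_muleNy ?lte_fin// addeNy gt0_muleNy// lte_fin.
Qed.

(** Two points of modulus at most [1 / 2] have pseudohyperbolic distance at most
    [1 / (1 + 1 / 4) = 4 / 5], so many of them would make the product of the
    distances smaller than [delta]. *)
Lemma small_count delta : 0 < delta -> exists M : nat, forall D a N,
  (forall n, D n -> cabs (a n) < 1) -> separated_zeros D a delta ->
  (#|[pred k : 'I_N | ((k : nat) \in D) && (cabs (a k) <= 2^-1)%R]| <= M)%N.
Proof.
move=> delta0.
have r01 : 0 < (4 / 5 : R) < 1 by apply/andP; split; lra.
have d20 : 0 < delta / 2 by rewrite divr_gt0.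
have [M hM] := power_small r01 d20.
exists M => D a N ha hsep.
set P := [pred k : 'I_N | _].
have [n Pn|P0] := pickP P; last by rewrite (eq_card0 P0).
have nP : n \in P by exact: Pn.
rewrite (cardD1 n) nP /= add1n ltnNge; apply/negP => Mle.
have /andP[nD an] := Pn; have Dn := set_mem nD.
have := separation_le_partial ha hsep N Dn.
have {}hM : (4 / 5 : R) ^+ M < delta by lra.
apply/negP; rewrite -ltNge; apply: le_lt_trans hM.
apply: (@le_trans _ _ ((4 / 5) ^+ #|[predD1 P & n]|)); last first.
  by rewrite ler_wiXn2l//; lra.
rewrite -prodr_const big_mkcond [X in _ <= X]big_mkcond.
apply: ler_prod => k _; rewrite !inE.
have [->|kn] := eqVneq k n; first by rewrite eqxx andbF ler01 lexx.
rewrite (_ : (k : nat) != n)//= andbT.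
case: (boolP ((k : nat) \in D)) => [kD|_] /=; last by rewrite ler01 lexx.
rewrite cabs_ge0 /=.
have ak := ha _ (set_mem kD); have an1 := ha _ Dn.
case: ifPn => [ak2|_]; last exact: (moebius_le1 ak (ltW an1)).
have := sqr_moebius ak (ltW an1); rewrite /moebius.
set m := cabs (_ / _) => hm; have m0 : 0 <= m by exact: cabs_ge0.
rewrite -(@ler_pXn2r _ 2) ?nnegrE ?divr_ge0//.
have sq (x : R) : 0 <= x -> x <= 2^-1 -> 3 / 4 <= 1 - x ^+ 2.
  move=> x0 x2; have : x ^+ 2 <= 2^-1 * 2^-1 by rewrite expr2 ler_pM.
  by lra.
have s1 := sq _ (cabs_ge0 _) ak2; have s2 := sq _ (cabs_ge0 _) an.
have D1 : cabs (1 - (a k)^* * a n) <= 5 / 4.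
  apply: le_trans (cabsB _ _) _; rewrite cabs1 cabsM cabsJ.
  have : cabs (a k) * cabs (a n) <= 2^-1 * 2^-1 by rewrite ler_pM ?cabs_ge0.
  by lra.
have D0 : 0 < cabs (1 - (a k)^* * a n).
  by rewrite cabs_gt0; apply: den_neq0 => //; exact: ltW.
have : 9 / 25 <= 1 - m ^+ 2.
  rewrite hm ler_pdivlMr ?exprn_gt0//.
  apply: (@le_trans _ _ (9 / 25 * (5 / 4) ^+ 2)).
    by rewrite ler_wpM2l// ler_pXn2r ?nnegrE// ltW.
  apply: (@le_trans _ _ (3 / 4 * (3 / 4))); first by lra.
  by rewrite ler_pM.
by lra.
Qed.

End small_zeros.

(** * Lower bound *)

Section lower_estimate.
Context {R : realType}.
Variables (w : R -> R) (p : R).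
Hypothesis hw : normal_weight w.
Hypothesis hwc : comparable_to_1_on_compacts w.
Hypothesis p0 : 0 < p.

Let w0 r : 0 <= r < 1 -> 0 <= w r.
Proof. by case: hw => _ + _; exact. Qed.

Lemma level_exists (th d : R) : 0 < th < 1 -> 0 < d <= 1 ->
  exists j, th * d < th ^+ j <= d.
Proof.
move=> th01 /andP[d0 d1]; have /andP[th0 th1] := th01.
have ex := power_small th01 d0.
have [j hj jmin] := ex_minnP ex; exists j; rewrite hj andbT.
case: j hj jmin => [|j] hj jmin.
  rewrite expr0 (lt_le_trans _ (le_refl 1))// (le_lt_trans _ th1)//.
  by rewrite ler_piMr// ltW.
rewrite exprS ltr_pM2l// ltNge; apply/negP => /jmin.
by rewrite ltnn.
Qed.

Lemma sum_geometric_lt (x : R) n : 0 <= x < 1 ->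
  \sum_(j < n) x ^+ j <= (1 - x)^-1.
Proof.
move=> /andP[x0 x1]; have x10 : 0 < 1 - x by rewrite subr_gt0.
rewrite -[leRHS]mul1r ler_pdivlMr//.
have -> : (\sum_(j < n) x ^+ j) * (1 - x) = 1 - x ^+ n.
  elim: n => [|n IH]; first by rewrite big_ord0 mul0r expr0 subrr.
  by rewrite big_ord_recr /= mulrDl IH exprS; ring.
by rewrite gerBl exprn_ge0.
Qed.

(** A zero at distance [1 - rho] from the unit circle is compared with the circle
    at distance [th ^ j], the two being equal up to the factor [th]. The weight
    changes by a bounded factor between them, and the extra exponent [eps]
    becomes a geometric factor in the level [j]. *)
Lemma level_term (th eps : R) : 0 < th < 1 -> 0 < eps ->
  exists2 C : R, 0 < C & forall rho j, 0 <= rho < 1 ->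
    th * (1 - rho) < th ^+ j <= 1 - rho ->
    (1 - rho) `^ (2 - p + eps) * w rho <=
    C * (th `^ eps) ^+ j *
      (w (1 - th ^+ j) * th ^+ j * (1 - rho) `^ (1 - p)).
Proof.
move=> /andP[th0 th1] eps0.
have [_ _ [a0 [_ [r0 [/andP[_ r01] [inc _] _]]]]] := hw.
have [C1 C10 hC1] := almost_increasing r01 inc (comparable_over_power a0 hwc).
pose C : R := C1 * th^-1 `^ (1 + eps + `|a0|).
have ith : 0 < th^-1 by rewrite invr_gt0.
exists C; first by rewrite mulr_gt0// powR_gt0.
move=> rho j /andP[rho0 rho1]; set q := th ^+ j; set d := 1 - rho.
move=> /andP[h1 h2].
have q0 : 0 < q by rewrite exprn_gt0.
have d0 : 0 < d by rewrite subr_gt0.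
have d1 : d <= 1 by rewrite gerBl.
pose r : R := 1 - q; have rE : 1 - r = q by rewrite /r; ring.
have wr0 : 0 <= w r.
  by rewrite w0// /r subr_ge0 (le_trans h2 d1) gtrBl q0.
pose x : R := d / q; have x0 : 0 < x by rewrite divr_gt0.
have dE : d = x * q by rewrite /x divfK// gt_eqF.
have x1 : 1 <= x by rewrite /x ler_pdivlMr// mul1r.
have xth : x <= th^-1.
  by rewrite /x ler_pdivrMr// -ler_pdivrMl// mulrC invrK mulrC ltW.
have wrho : w rho <= C1 * w r * x `^ a0.
  have := hC1 rho r rho0; rewrite /over_power rE -/d => h.
  have {h} := h (_ : rho <= r) (_ : r < 1).
  have -> : rho <= r by move: h2; rewrite /r /d; lra.
  have -> : r < 1 by rewrite gtrBl.
  move=> /(_ isT isT); rewrite ler_pdivrMr ?powR_gt0// => h.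
  apply: (le_trans h); rewrite dE powRM ?(ltW x0) ?(ltW q0)//.
  rewrite le_eqVlt; apply/orP; left; apply/eqP; field.
  by rewrite gt_eqF// powR_gt0.
have dpow : d `^ (2 - p + eps) = d `^ (1 - p) * (x `^ (1 + eps) * (q * q `^ eps)).
  rewrite (_ : 2 - p + eps = (1 - p) + (1 + eps)); last by ring.
  rewrite powRD ?(gt_eqF d0) ?implybT//; congr (_ * _).
  rewrite dE powRM ?(ltW x0) ?(ltW q0)//; congr (_ * _).
  by rewrite powRD ?(gt_eqF q0) ?implybT// powRr1// ltW.
have qpow : (th `^ eps) ^+ j = q `^ eps.
  by rewrite /q -!powR_mulrn ?powR_ge0 ?(ltW th0)// powRAC.
have xpow : x `^ (1 + eps) * x `^ a0 <= th^-1 `^ (1 + eps + `|a0|).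
  rewrite -powRD ?(gt_eqF x0) ?implybT//.
  apply: (@le_trans _ _ (x `^ (1 + eps + `|a0|))).
    by rewrite ler_powR// lerD2l ler_norm.
  rewrite ge0_ler_powR ?nnegrE ?(ltW x0) ?(ltW ith)//.
  by rewrite !addr_ge0// ltW.
rewrite dpow qpow -/r.
apply: (@le_trans _ _ (d `^ (1 - p) * (x `^ (1 + eps) * (q * q `^ eps)) *
  (C1 * w r * x `^ a0))).
  by rewrite ler_wpM2l// !mulr_ge0 ?powR_ge0// ltW.
have -> : d `^ (1 - p) * (x `^ (1 + eps) * (q * q `^ eps)) * (C1 * w r * x `^ a0) =
  (C1 * w r * q * q `^ eps * d `^ (1 - p)) * (x `^ (1 + eps) * x `^ a0) by ring.
have -> : C * q `^ eps * (w r * q * d `^ (1 - p)) =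
  (C1 * w r * q * q `^ eps * d `^ (1 - p)) * th^-1 `^ (1 + eps + `|a0|).
  by rewrite /C; ring.
by rewrite ler_wpM2l// !mulr_ge0 ?powR_ge0// ltW.
Qed.

Lemma weighted_sup_ge0 (B : R[i]%C -> R[i]%C^o) : (0 <= weighted_sup w p B)%E.
Proof.
apply: (@le_trans _ _ ((w (3 / 4) * (1 - 3 / 4))%:E * circle_mean p B (3 / 4))%E).
  apply: mule_ge0.
    rewrite lee_fin; apply: mulr_ge0; last lra.
    by apply: w0; apply/andP; split; lra.
  by apply: integral_ge0 => t _; rewrite lee_fin powR_ge0.
by apply: ereal_sup_ubound; exists (3 / 4) => //=; rewrite in_itv/=; lra.
Qed.

Lemma weighted_sup_ge (B : R[i]%C -> R[i]%C^o) (r x s : R) : 2^-1 < r < 1 ->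
  (x%:E <= circle_mean p B r)%E -> weighted_sup w p B = s%:E ->
  w r * (1 - r) * x <= s.
Proof.
move=> /andP[r2 r1] xr sE; rewrite -lee_fin -sE EFinM.
have r0 : 0 <= r by rewrite (le_trans _ (ltW r2))// invr_ge0.
apply: (@le_trans _ _ ((w r * (1 - r))%:E * circle_mean p B r)%E).
  by rewrite lee_wpmul2l// lee_fin mulr_ge0 ?w0 ?r0// subr_ge0 ltW.
by apply: ereal_sup_ubound; exists r => //=; rewrite in_itv/= r2.
Qed.

(** The zeros outside the disk of radius [1 / 2] are grouped by level. All arcs of
    one level lie on one circle, so each level contributes at most a multiple of
    the supremum, and the levels add up because of the geometric factor from
    [level_term]. The zeros inside are boundedly many, and if there is one at all
    then the supremum is bounded below. *)
Lemma lower_bound (delta eps : R) : 0 < delta -> 0 < eps ->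
  exists2 c : R, 0 < c &
    forall (D : set nat) (a : nat -> R[i]%C) (B : R[i]%C -> R[i]%C^o),
      blaschke_product D a B -> separated_zeros D a delta ->
      (zero_sum D a (fun x => ((1 - x) `^ (2 - p + eps) * w x)%R) <=
       c%:E * weighted_sup w p B)%E.
Proof.
move=> delta0 eps0; pose th : R := 1 - Num.min 1 delta / 64.
(* The ratio th puts the circle of a level within delta / 64 (1 - |a_n|) of each
   of its zeros, as partial_mean_ge_arcs asks. A separation constant is at most
   1 as soon as there is a zero, so that the minimum matters only for th > 0. *)
have m1 : Num.min 1 delta <= 1 by rewrite ge_min lexx.
have m0 : 0 < Num.min 1 delta by rewrite lt_min ltr01.
have th01 : 0 < th < 1 by rewrite /th; apply/andP; split; lra.
have /andP[th0 th1] := th01.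
have [C2 C20 hC2] := level_term th01 eps0.
pose ka : R := (delta / 12) `^ p * (delta / 128).
have ka0 : 0 < ka by rewrite mulr_gt0 ?powR_gt0 ?divr_gt0.
have [c3 c30 hc3] := small_zero_mean p0 delta0.
have [M hM] := small_count delta0.
have half01 : 0 < (2^-1 : R) < 1 by apply/andP; split; lra.
have hcmp := comparableM (comparable_power (2 - p + eps)) hwc.
have [m [V [m'0 hV]]] := hcmp _ half01.
pose s0 : R := w (3 / 4) * (1 - 3 / 4) * c3.
have s00 : 0 < s0.
  have q01 : 0 < (3 / 4 : R) < 1 by apply/andP; split; lra.
  have [m' [V' [m'1 hV']]] := hwc q01.
  have /andP[hw' _] : m' <= w (3 / 4) <= V'.
    by apply: hV'; apply/andP; split; lra.
  rewrite /s0 mulr_gt0// mulr_gt0//; [exact: lt_le_trans hw'|lra].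
have V0 : 0 <= V.
  have /andP[h1 h2] : m <= (1 - 0) `^ (2 - p + eps) * w 0 <= V.
    by apply: hV; apply/andP; split; lra.
  by rewrite (le_trans (ltW m'0))// (le_trans h1).
pose the : R := th `^ eps.
have the01 : 0 <= the < 1.
  have : th `^ eps < 1 `^ eps by rewrite gt0_ltr_powR ?nnegrE ?(ltW th0).
  by rewrite powR_ge0 powR1.
have the1 : 0 < 1 - the by rewrite subr_gt0; case/andP: the01.
pose K1 : R := C2 / ka / (1 - the).
pose K2 : R := M%:R * V / s0.
have K10 : 0 < K1 by rewrite !divr_gt0.
have K20 : 0 <= K2 by rewrite divr_ge0 ?(ltW s00)// mulr_ge0.
have Ck0 : 0 <= C2 / ka by rewrite divr_ge0 ?(ltW C20) ?(ltW ka0).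
exists (K1 + K2); first by rewrite ltr_pwDl.
move=> D a B hB hsep; have [gam [ha hgam hcvg]] := blaschke_approximation hB.
pose W x : R := (1 - x) `^ (2 - p + eps) * w x.
have W0 n : D n -> 0 <= W (cabs (a n)).
  by move=> Dn; rewrite mulr_ge0 ?powR_ge0// w0// cabs_ge0 ha.
have := weighted_sup_ge0 B.
case sE : (weighted_sup w p B) => [s| |] // s_ge0; last first.
  by rewrite gt0_muley ?leey// lte_fin ltr_pwDl.
rewrite lee_fin in s_ge0.
apply: zero_sum_le => // N0; rewrite -EFinM lee_fin.
(* A product with at least N0 factors vanishes at the zeros of index below N0. *)
have mean_ge (x r : R) : 0 < r < 1 ->
    (forall N, (N0 <= N)%N -> (x%:E <= partial_mean D a gam p r N)%E) ->
    (x%:E <= circle_mean p B r)%E.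
  move=> r01 hx; have cv := hcvg p r p0 r01.
  rewrite -(cvg_lim _ cv)//; apply: lime_ge; first exact: cvgP cv.
  by exists N0 => // N /=; exact: hx.
rewrite (bigID (fun k : 'I_N0 => 2^-1 < cabs (a k)))/= mulrDl lerD//.
  have /choice[lev hlev] : forall n, exists j, D n ->
      th * (1 - cabs (a n)) < th ^+ j <= 1 - cabs (a n).
    move=> n; case: (pselect (D n)) => [Dn|nD]; last by exists 0%N.
    have [|j hj] := @level_exists th (1 - cabs (a n)) th01; last by exists j.
    by rewrite subr_gt0 ha// gerBl cabs_ge0.
  pose J := \max_(k < N0) lev k.
  pose Q (j : 'I_J.+1) : pred nat :=
    fun n => [&& n \in D, 2^-1 < cabs (a n) & lev n == j].
  rewrite (partition_big (fun k : 'I_N0 => inord (lev k) : 'I_J.+1) xpredT)//=.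
  apply: (@le_trans _ _ (\sum_(j < J.+1) (C2 / ka * s) * the ^+ j)); last first.
    rewrite -big_distrr/= /K1 [leRHS]mulrAC.
    by rewrite ler_wpM2l ?sum_geometric_lt// mulr_ge0.
  apply: ler_sum => j _.
  pose r : R := 1 - th ^+ j.
  have QE (k : 'I_N0) : ((k : nat) \in D) && (2^-1 < cabs (a k)) &&
      (inord (lev k) == j :> 'I_J.+1) = Q j k.
    rewrite /Q -andbA; congr [&& _, _ & _].
    rewrite -val_eqE /= inordK// ltnS /J.
    by rewrite (leq_bigmax (F := fun k : 'I_N0 => lev k)).
  under eq_bigl do rewrite QE.
  have term (k : 'I_N0) : Q j k -> W (cabs (a k)) <=
      C2 * the ^+ j * (w r * th ^+ j * (1 - cabs (a k)) `^ (1 - p)).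
    move=> /and3P[kD _ /eqP kj]; apply: (hC2 (cabs (a k)) j).
      by rewrite cabs_ge0 ha//; exact: set_mem.
    by rewrite -kj; apply: hlev; exact: set_mem.
  apply: (@le_trans _ _ (\sum_(k < N0 | Q j k)
    C2 * the ^+ j * (w r * th ^+ j * (1 - cabs (a k)) `^ (1 - p)))).
    by apply: ler_sum => k; exact: term.
  rewrite -big_distrr/= -big_distrr/=.
  set S := \sum_(k < N0 | _) _.
  have [k Qk|none] := pickP (fun k : 'I_N0 => Q j k); last first.
    rewrite /S big_pred0// !mulr0.
    exact: mulr_ge0 (mulr_ge0 Ck0 s_ge0) (exprn_ge0 _ (powR_ge0 _ _)).
  have r2 : 2^-1 < r < 1.
    have /and3P[kD k2 /eqP kj] := Qk.
    have /andP[h1 h2] := hlev _ (set_mem kD); rewrite kj in h1 h2.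
    have tj0 : 0 < th ^+ j by rewrite exprn_gt0.
    by rewrite /r; apply/andP; split; lra.
  have r01 : 0 < r < 1.
    by case/andP: r2 => r2 ->; rewrite (lt_trans _ r2)// invr_gt0.
  have rE : 1 - r = th ^+ j by rewrite /r; ring.
  have arcs : w r * (1 - r) * (ka * S) <= s.
    apply: (weighted_sup_ge r2 _ sE); apply: mean_ge => // N NN.
    apply: (partial_mean_ge_arcs ha hgam hsep p0 r01 NN) => n /and3P[nD n2 /eqP nj].
    have Dn := set_mem nD; split => //.
    have /andP[h1 h2] := hlev _ Dn; rewrite nj in h1 h2.
    have de1 := separation_le1 ha hsep Dn.
    have thE : th = 1 - delta / 64.
      by rewrite /th; congr (1 - _ / _); apply/min_idPr.
    move: h1 h2; rewrite /r -/th; set q := th ^+ j; rewrite thE => h1 h2.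
    by apply/andP; split; lra.
  rewrite rE in arcs.
  have -> : C2 * the ^+ j * (w r * th ^+ j * S) =
    C2 / ka * the ^+ j * (w r * th ^+ j * (ka * S)).
    by field; rewrite gt_eqF.
  rewrite [leRHS]mulrAC ler_wpM2l//.
  exact: mulr_ge0 Ck0 (exprn_ge0 _ (powR_ge0 _ _)).
pose P (k : 'I_N0) := ((k : nat) \in D) && ~~ (2^-1 < cabs (a k)).
apply: (@le_trans _ _ (\sum_(k < N0 | P k) V)).
  apply: ler_sum => k /andP[kD]; rewrite -leNgt => k2.
  have /hV/andP[_] : 0 <= cabs (a k) <= 2^-1 by rewrite cabs_ge0.
  by [].
rewrite sumr_const.
have [k /andP[kD k2]|none] := pickP P; last first.
  by rewrite (eq_card0 none) mulr0n mulr_ge0.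
rewrite -leNgt in k2.
have s0s : s0 <= s.
  have r2 : 2^-1 < (3 / 4 : R) < 1 by apply/andP; split; lra.
  apply: (weighted_sup_ge r2 _ sE); apply: mean_ge => [|N NN].
    by apply/andP; split; lra.
  apply: (hc3 D a gam k N ha hgam hsep (set_mem kD) k2).
  exact: leq_trans (ltn_ord k) NN.
have cnt : (#|P| <= M)%N.
  apply: leq_trans (hM D a N0 ha hsep); apply: subset_leq_card.
  apply/fintype.subsetP => i; rewrite unfold_in /P -leNgt => h.
  by rewrite inE.
rewrite -[X in X <= _]mulr_natl; apply: (@le_trans _ _ (M%:R * V)).
  by rewrite ler_wpM2r// ler_nat.
rewrite /K2 mulrAC ler_pdivlMr//.
by rewrite ler_wpM2l// mulr_ge0.
Qed.

End lower_estimate.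

(** * The two-sided estimate *)

Theorem corollary1 (R : realType) (w : R -> R) (p : R)
    (hw : normal_weight w) (hwc : comparable_to_1_on_compacts w)
    (hp : 2^-1 < p) :
  ([\/ [/\ p <= 1, a_index w < 2 * p - 2 & -1 < b_index w],
       [/\ 1 < p, a_index w < p - 1 & p - 2 < b_index w] |
       log_increasing w /\
       ([/\ p <= 1, a_index w = 2 * p - 2 & -1 < b_index w] \/
        [/\ 1 < p, a_index w = p - 1 & p - 2 < b_index w])] ->
   exists2 c : R, 0 < c &
     forall (D : set nat) (a : nat -> R[i]%C) (B : R[i]%C -> R[i]%C^o),
       blaschke_product D a B ->
       ((a_index w < 2 * p - 2 /\ p <= 1) \/ (a_index w < p - 1 /\ 1 < p) ->
        (weighted_sup w p B <=
         c%:E * zero_sum D a (fun x => ((1 - x) `^ (2 - p) * w x)%R))%E) /\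
       ((a_index w = 2 * p - 2 /\ p <= 1) \/ (a_index w = p - 1 /\ 1 < p) ->
        (weighted_sup w p B <=
         c%:E * zero_sum D a
           (fun x => ((1 - x) `^ (2 - p) * w x * log_factor x)%R))%E)) /\
  ([\/ [/\ p <= 1, a_index w < 2 * p - 2 & -1 < b_index w],
       [/\ 1 < p, a_index w < p - 2 & -1 < b_index w] |
       log_increasing w /\
       ([/\ p <= 1, a_index w = 2 * p - 2 & -1 < b_index w] \/
        [/\ 1 < p, a_index w = p - 1 & p - 2 < b_index w])] ->
   forall delta eps : R, 0 < delta -> 0 < eps ->
   exists2 c : R, 0 < c &
     forall (D : set nat) (a : nat -> R[i]%C) (B : R[i]%C -> R[i]%C^o),
       blaschke_product D a B -> separated_zeros D a delta ->
       (zero_sum D a (fun x => ((1 - x) `^ (2 - p + eps) * w x)%R) <=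
        c%:E * weighted_sup w p B)%E).
Proof.
have p0 : 0 < p by apply: lt_trans hp; rewrite invr_gt0.
split; last by move=> _ delta eps; exact: lower_bound.
have one1 (x : R) : 1 <= (fun=> 1 : R) x by [].
have dropL (D : set nat) (a : nat -> R[i]%C) :
    zero_sum D a (fun x => (1 - x) `^ (2 - p) * w x * 1) =
    zero_sum D a (fun x => (1 - x) `^ (2 - p) * w x).
  by congr (zero_sum D a _); apply/funext => x; rewrite mulr1.
have upper s : a_index w < s -> exists2 C : R, 0 < C &
    forall x y, 0 <= x -> x <= y -> y < 1 ->
      over_power w s x <= C * (over_power w s y * 1).
  move=> /(normal_upper hw hwc)[C C0 hC]; exists C => // x y x0 xy y1.
  by rewrite mulr1; exact: hC.
case=> [[p1 ha hb]|[p1 ha hb]|[hlog [[p1 ha hb]|[p1 ha hb]]]].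
- have [c c0 hc] := upper_bound_le1 hw hwc hp one1 p1 hb (upper _ ha).
  exists c => // D a B hB; split; first by rewrite -dropL => _; exact: hc.
  by move=> [[e _]|[_]]; [move: ha; rewrite e ltxx|rewrite ltNge p1].
- have [c c0 hc] := upper_bound_gt1 hw hwc hp one1 p1 hb (upper _ ha).
  exists c => // D a B hB; split; first by rewrite -dropL => _; exact: hc.
  by move=> [[_]|[e _]]; [rewrite leNgt p1|move: ha; rewrite e ltxx].
- have := normal_upper_log hw hwc hlog; rewrite ha => up.
  have [c c0 hc] := upper_bound_le1 hw hwc hp (@log_factor_ge1 R) p1 hb up.
  exists c => // D a B hB; split; last by move=> _; exact: hc.
  by move=> [[e _]|[_]]; [move: e; rewrite ltxx|rewrite ltNge p1].
- have := normal_upper_log hw hwc hlog; rewrite ha => up.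
  have [c c0 hc] := upper_bound_gt1 hw hwc hp (@log_factor_ge1 R) p1 hb up.
  exists c => // D a B hB; split; last by move=> _; exact: hc.
  by move=> [[_]|[e _]]; [rewrite leNgt p1|move: e; rewrite ltxx].
Qed.
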